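(* Let $(M,\omega)$ be a connected symplectic Fréchet manifold endowed with a symplectic action of a Fréchet Lie group $G$ with Lie algebra $\mathfrak g$. Assume that the action has an $\operatorname{ad}$-equivariant momentum map $J:M\to\mathfrak g$ relative to a non-degenerate symmetric positive-definite pairing $\kappa:\mathfrak g\times\mathfrak g\to\mathbb R$. Let $j$ be an almost complex structure on $M$ compatible with $\omega$. Let $m\in M$ be a critical point of $\|J\|_\kappa^2$ such that $j_m$ is invariant under $\mathfrak g_m$. In infinite dimensions, assume the following (which always hold in finite dimensions): (1) $G$ has a smooth exponential map; (2) $G_m$ is a Lie subgroup of $G$; (3) the isotropy representation of $\mathfrak g_m$ on $T_mM$ has a momentum map $\hat J:T_mM\to\mathfrak g_m$; (4) the operators $C_m^\pm$ are essentially self-adjoint. Then the restriction of the Hessian of $\|J\|_\kappa^2$ at $m$ to the subspace $\mathfrak g_{\mathbb C}\cdot m=\mathfrak g\cdot m+j(\mathfrak g\cdot m)$ of $T_mM$ is positive semi-definite.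
   Context: Symplectic forms are weak ($\omega$ closed, $X\mapsto\omega_m(X,\cdot)$ injective). $\Upsilon_g:M\to M$ is the (left) action of $g\in G$; $\xi\cdot m=\xi^*(m)=\frac{d}{dt}|_{t=0}\Upsilon_{\exp(t\xi)}(m)$, $\mathfrak g_m=\{\xi:\xi\cdot m=0\}$. A momentum map $J:M\to\mathfrak g$ relative to $\kappa$ satisfies $\omega_m(\xi\cdot m,X)+\kappa(T_mJ(X),\xi)=0$; $\operatorname{ad}$-equivariance means $T_mJ(\xi\cdot m)=[\xi,J(m)]$ for all $m,\xi$. $\|J\|_\kappa^2(m)=\kappa(J(m),J(m))$. It is a standing assumption (automatic in finite dimensions) that the $\kappa$-adjoints of all $\operatorname{ad}_\xi$ exist. The isotropy representation sends $\sigma\in\mathfrak g_m$ to $\tau_m\sigma^*(X)=\frac{d}{dt}|_{t=0}T_m\Upsilon_{\exp(t\sigma)}(X)$ on $T_mM$; its momentum map is $\kappa(\hat J(X),\sigma)=\frac12\omega_m(X,\tau_m\sigma^*X)$ for all $\sigma\in\mathfrak g_m$. $\operatorname{Hess}_mf(X)=\frac{d^2}{dt^2}|_0f(\gamma(t))$ for a curve with $\gamma(0)=m,\dot\gamma(0)=X$. $j$ is a smooth family of $j_m:T_mM\to T_mM$ with $j_m^2=-\mathrm{id}$, compatible: $\omega(j\cdot,j\cdot)=\omega$, $\omega(X,jX)>0$ for $X\neq0$; not assumed integrable. With $\tau_j(g)=T\Upsilon_g\circ j\circ T\Upsilon_{g^{-1}}-j$ and $\tau_j'(\xi)=\frac{d}{dt}|_0\tau_j(\exp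 t\xi)$, ''$j_m$ is invariant under $\mathfrak g_m$'' means $\tau_j'(\xi)_m=0$ for all $\xi\in\mathfrak g_m$. On $\mathfrak g$ put $L_m\xi=T_mJ(j(\xi\cdot m))$ and $Z_m\xi=T_mJ(\xi\cdot m)$; on $\mathfrak g_{\mathbb C}=\mathfrak g\oplus\mathrm i\mathfrak g$ put $C_m^\pm=L_m\pm\mathrm iZ_m$ (complex-linear). $\kappa_{\mathbb C}$ is the Hermitian extension of $\kappa$, and $\bar{\mathfrak g}_{\mathbb C}$ the Hilbert space completion of $\mathfrak g_{\mathbb C}$ with respect to $\kappa_{\mathbb C}$. $C_m^\pm$ are densely defined Hermitian operators on $\bar{\mathfrak g}_{\mathbb C}$ with domain $\mathfrak g_{\mathbb C}$; they are essentially self-adjoint if their closures are self-adjoint. *)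

(* Defs.v *)
From HB Require Import structures.
From mathcomp Require Import all_boot all_order all_algebra sesquilinear.
From mathcomp Require Import complex.
From mathcomp Require Import all_classical all_reals all_analysis.

Set Implicit Arguments.
Unset Strict Implicit.
Unset Printing Implicit Defensive.

Import Order.TTheory GRing.Theory Num.Theory.
Import numFieldNormedType.Exports.

Local Open Scope classical_set_scope.
Local Open Scope ring_scope.

(* Michal-Bastiani calculus in locally convex spaces: the library derivative  *)
(* ['D_v f x] is restricted to normed modules.                               *)
Section Calculus.
Context {R : realType}.
Implicit Types E F : tvsType R.

(* [tvsType] is locally convex by definition; a countable uniformity makes   *)
(* the space metrizable.                                                     *)
Definition frechet_space E : Prop :=
  [/\ hausdorff_space E, countable_uniformity E &
      forall F : set_system E, ProperFilter F -> cauchy F ->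
        exists x : E, F --> x].

Definition finite_dimensional (E : lmodType R) : Prop :=
  exists n (b : 'I_n -> E), forall x, exists c : 'I_n -> R,
    x = \sum_i c i *: b i.

Definition dquot E F (f : E -> F) (x v : E) (h : R) : F :=
  h^-1 *: (f (x + h *: v) - f x).

Definition dderivable E F (f : E -> F) (x v : E) : Prop :=
  exists l : F, dquot f x v h @[h --> (0 : R)^'] --> l.

Definition dderive E F (f : E -> F) (x v : E) : F :=
  xget 0 [set l : F | dquot f x v h @[h --> (0 : R)^'] --> l].

(* [f] is of class C^n on the open set [U]: for n > 0, the differential      *)
(* (x, v) |-> df(x; v) exists and is of class C^(n-1) on [U * E].            *)
Fixpoint class_C (n : nat) E F (U : set E) (f : E -> F) : Prop :=
  {within U, continuous f} /\
  (if n is n'.+1 then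
     (forall x v, U x -> dderivable f x v) /\
     class_C n' (U `*` [set: E]) (fun p : (E * E)%type => dderive f p.1 p.2)
   else True).

Definition smooth_on E F (U : set E) (f : E -> F) : Prop :=
  forall n, class_C n U f.

Definition ddt0 F (c : R -> F) : F := dderive (c : R^o -> F) 0 1.

End Calculus.

(* The atlas of a manifold modelled on [E] is indexed by the points of [M]:  *)
(* [dom A p] is the domain of a chart around [p], [cmap A p] the chart and   *)
(* [cinv A p] its inverse.  The tangent space T_pM is [E], read in the chart *)
(* chosen at [p].                                                            *)
Record atlas (R : realType) (E : tvsType R) (M : topologicalType) := Atlas {
  dom : M -> set M ;
  cmap : M -> M -> E ;
  cinv : M -> E -> M }.

Section Manifolds.
Context {R : realType}.
Implicit Types (E F : tvsType R) (M N : topologicalType).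

Definition cimg E M (A : atlas E M) (p : M) : set E := cmap A p @` dom A p.

Definition manifold E M (A : atlas E M) : Prop :=
  [/\ hausdorff_space M,
      forall p, [/\ open (dom A p), dom A p p & open (cimg A p)],
      forall p x, dom A p x -> cinv A p (cmap A p x) = x,
      forall p, {within dom A p, continuous (cmap A p)} /\
                {within cimg A p, continuous (cinv A p)} &
      forall p q, smooth_on (cmap A p @` (dom A p `&` dom A q))
                            (cmap A q \o cinv A p)].

Definition tvs_atlas E : atlas E E :=
  Atlas (fun _ => setT) (fun _ x => x) (fun _ x => x).

Definition prod_atlas E F M N (A : atlas E M) (B : atlas F N) :
    atlas (E * F)%type (M * N)%type :=
  Atlas (fun p => dom A p.1 `*` dom B p.2)
        (fun p x => (cmap A p.1 x.1, cmap B p.2 x.2))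
        (fun p x => (cinv A p.1 x.1, cinv B p.2 x.2)).

Definition smooth E F M N (A : atlas E M) (B : atlas F N) (f : M -> N) : Prop :=
  continuous f /\
  forall p, smooth_on (cmap A p @` (dom A p `&` f @^-1` dom B (f p)))
                      (cmap B (f p) \o f \o cinv A p).

Definition tmap E F M N (A : atlas E M) (B : atlas F N) (f : M -> N)
    (m : M) (X : E) : F :=
  dderive (cmap B (f m) \o f \o cinv A m) (cmap A m m) X.

Definition smooth_curve E M (A : atlas E M) (c : R -> M) : Prop :=
  smooth (tvs_atlas R^o) A (c : R^o -> M).

(* the velocity at time 0, in T_mM, of a curve [c] with [c 0 = m] *)
Definition velocity E M (A : atlas E M) (m : M) (c : R -> M) : E :=
  ddt0 (fun t => cmap A m (c t)).

(* A tangent vector at [cinv A p x], given by its coordinates [u] in the     *)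
(* chart at [p], seen in T_(cinv A p x)M; and conversely.                    *)
Definition of_chart E M (A : atlas E M) (p : M) (x u : E) : E :=
  dderive (cmap A (cinv A p x) \o cinv A p) x u.

Definition to_chart E M (A : atlas E M) (p : M) (x X : E) : E :=
  let q := cinv A p x in dderive (cmap A p \o cinv A q) (cmap A q q) X.

Definition bilinear_form (V W : lmodType R) (b : V -> W -> R) : Prop :=
  (forall x, scalar (b x)) /\ (forall y, scalar (b^~ y)).

Definition form_in_chart E M (A : atlas E M) (w : M -> E -> E -> R) (p : M)
    (x u v : E) : R^o :=
  w (cinv A p x) (of_chart A p x u) (of_chart A p x v).

(* Closedness is dw = 0 in each chart, evaluated on constant vector fields.  *)
Definition symplectic_form E M (A : atlas E M) (w : M -> E -> E -> R) : Prop :=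
  [/\ forall m, bilinear_form (w m) /\ (forall X Y, w m X Y = - w m Y X),
      forall p, smooth_on (cimg A p `*` [set: (E * E)%type])
        (fun z : (E * (E * E))%type => form_in_chart A w p z.1 z.2.1 z.2.2),
      forall p x u1 u2 u3, cimg A p x ->
        dderive (fun y => form_in_chart A w p y u2 u3) x u1
        + dderive (fun y => form_in_chart A w p y u3 u1) x u2
        + dderive (fun y => form_in_chart A w p y u1 u2) x u3 = 0 &
      forall m X, (forall Y, w m X Y = 0) -> X = 0].

Definition almost_complex E M (A : atlas E M) (j : M -> E -> E) : Prop :=
  [/\ forall m, linear (j m),
      forall m X, j m (j m X) = - X &
      forall p, smooth_on (cimg A p `*` [set: E])
        (fun z : (E * E)%type => to_chart A p z.1
           (j (cinv A p z.1) (of_chart A p z.1 z.2)))].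

Definition compatible E M (w : M -> E -> E -> R) (j : M -> E -> E) : Prop :=
  (forall m X Y, w m (j m X) (j m Y) = w m X Y) /\
  (forall m X, X != 0 -> 0 < w m X (j m X)).

Definition critical_point E M (A : atlas E M) (f : M -> R^o) (m : M) : Prop :=
  forall X, tmap A (tvs_atlas R^o) f m X = 0.

(* The Hessian in the direction [X] is computed along an arbitrary curve     *)
(* representing [X]; at a critical point the choice is immaterial.           *)
Definition hessian_psd_on E M (A : atlas E M) (f : M -> R^o) (m : M)
    (S : set E) : Prop :=
  forall X, S X -> forall c : R -> M,
    smooth_curve A c -> c 0 = m -> velocity A m c = X ->
    0 <= derive1n 2 (f \o c) 0.

End Manifolds.

#[short(type="topoGroupType")]
HB.structure Definition TopoGroup := {G of Topological G & Group G}.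

Section LieGroups.
Context {R : realType} {g : tvsType R} {G : topoGroupType}.
Variable (A : atlas g G).

Definition lie_group : Prop :=
  [/\ manifold A,
      smooth (prod_atlas A A) A (fun p : (G * G)%type => (p.1 * p.2)%g) &
      smooth A A (fun a : G => (a^-1)%g)].

(* The left-invariant vector field a |-> T_1(a * -) xi and the value at 1 of *)
(* the Lie bracket of two of them, in the chart at 1.                        *)
Definition left_invariant (xi x : g) : g :=
  dderive (fun z => cmap A 1%g (cinv A 1%g x * cinv A 1%g z)%g)
          (cmap A 1%g 1%g) xi.

Definition bracket (xi eta : g) : g :=
  let e := cmap A 1%g 1%g in
  dderive (left_invariant eta) e (left_invariant xi e)
  - dderive (left_invariant xi) e (left_invariant eta e).

(* [expG] is the exponential map; its smoothness is a separate hypothesis. *)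
Definition exponential_map (expG : g -> G) : Prop :=
  forall xi : g,
    [/\ smooth_curve A (fun t => expG (t *: xi)),
        forall s t, expG ((s + t) *: xi) = (expG (s *: xi) * expG (t *: xi))%g &
        velocity A 1%g (fun t => expG (t *: xi)) = xi].

(* ([phi], [psi]) is a chart on [U] of the maximal atlas generated by [A]. *)
Definition is_chart (U : set G) (phi : G -> g) (psi : g -> G) : Prop :=
  [/\ open U, open (phi @` U),
      forall a, U a -> psi (phi a) = a,
      forall p, smooth_on (cmap A p @` (dom A p `&` U)) (phi \o cinv A p) &
      forall p, smooth_on (phi @` (dom A p `&` U)) (cmap A p \o psi)].

Definition closed_subspace (F : set g) : Prop :=
  [/\ closed F, F 0 & forall (k : R) x y, F x -> F y -> F (k *: x + y)].

Definition lie_subgroup (H : set G) : Prop :=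
  [/\ H 1%g, forall a b, H a -> H b -> H (a * b)%g,
      forall a, H a -> H (a^-1)%g &
      exists2 F : set g, closed_subspace F &
        forall h, H h -> exists U phi psi,
          [/\ is_chart U phi psi, U h &
              phi @` (U `&` H) = phi @` U `&` F]].

End LieGroups.

Section Actions.
Context {R : realType} {E g : tvsType R} {M : topologicalType}
  {G : topoGroupType}.
Variables (AM : atlas E M) (AG : atlas g G) (act : G -> M -> M) (expG : g -> G).

Definition smooth_action : Prop :=
  [/\ forall m, act 1%g m = m,
      forall a b m, act (a * b)%g m = act a (act b m) &
      smooth (prod_atlas AG AM) AM (fun p : (G * M)%type => act p.1 p.2)].

Definition preserves_form (w : M -> E -> E -> R) : Prop :=
  forall a m X Y,
    w (act a m) (tmap AM AM (act a) m X) (tmap AM AM (act a) m Y) = w m X Y.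

Definition inf_act (xi : g) (m : M) : E :=
  velocity AM m (fun t => act (expG (t *: xi)) m).

Definition stabilizer (m : M) : set G := [set a | act a m = m].

Definition stabilizer_alg (m : M) : set g := [set xi | inf_act xi m = 0].

(* tau_m sigma^*; meaningful for [sigma] in [stabilizer_alg m], where        *)
(* [act (expG (t *: sigma)) m = m].                                          *)
Definition isotropy_rep (m : M) (sigma : g) (X : E) : E :=
  ddt0 (fun t => tmap AM AM (act (expG (t *: sigma))) m X).

Definition pairing (kappa : g -> g -> R) : Prop :=
  [/\ bilinear_form kappa,
      continuous (fun p : (g * g)%type => kappa p.1 p.2 : R^o),
      forall x y, kappa x y = kappa y x,
      forall x, x != 0 -> 0 < kappa x x &
      forall x, (forall y, kappa x y = 0) -> x = 0].

Definition momentum_map (w : M -> E -> E -> R) (kappa : g -> g -> R)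
    (J : M -> g) : Prop :=
  smooth AM (tvs_atlas g) J /\
  forall m xi X,
    w m (inf_act xi m) X + kappa (tmap AM (tvs_atlas g) J m X) xi = 0.

Definition ad_equivariant (J : M -> g) : Prop :=
  forall m xi, tmap AM (tvs_atlas g) J m (inf_act xi m) = bracket AG xi (J m).

Definition ad_adjoints_exist (kappa : g -> g -> R) : Prop :=
  forall xi, exists adj : g -> g, forall eta zeta,
    kappa (bracket AG xi eta) zeta = kappa eta (adj zeta).

Definition isotropy_momentum_map (w : M -> E -> E -> R)
    (kappa : g -> g -> R) (m : M) (Jhat : E -> g) : Prop :=
  [/\ smooth (tvs_atlas E) (tvs_atlas g) Jhat,
      forall X, stabilizer_alg m (Jhat X) &
      forall X sigma, stabilizer_alg m sigma ->
        kappa (Jhat X) sigma = 2^-1 * w m X (isotropy_rep m sigma X)].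

Definition norm_sq (kappa : g -> g -> R) (J : M -> g) : M -> R^o :=
  fun m => kappa (J m) (J m).

Definition tau (j : M -> E -> E) (a : G) (m : M) (X : E) : E :=
  let n := act (a^-1)%g m in
  tmap AM AM (act a) n (j n (tmap AM AM (act (a^-1)%g) m X)) - j m X.

Definition tau' (j : M -> E -> E) (xi : g) (m : M) (X : E) : E :=
  ddt0 (fun t => tau j (expG (t *: xi)) m X).

Definition invariant_at (j : M -> E -> E) (m : M) : Prop :=
  forall xi, stabilizer_alg m xi -> forall X, tau' j xi m X = 0.

Definition complex_orbit_space (j : M -> E -> E) (m : M) : set E :=
  [set X | exists xi eta, X = inf_act xi m + j m (inf_act eta m)].

Definition opL (j : M -> E -> E) (J : M -> g) (m : M) (xi : g) : g :=
  tmap AM (tvs_atlas g) J m (j m (inf_act xi m)).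

Definition opZ (J : M -> g) (m : M) (xi : g) : g :=
  tmap AM (tvs_atlas g) J m (inf_act xi m).

(* The complex-linear operator L_m + s i Z_m on g_C, with (xi, eta) standing *)
(* for xi + i eta; C_m^+ and C_m^- are the cases s = 1 and s = -1.           *)
Definition opC (s : R) (j : M -> E -> E) (J : M -> g) (m : M)
    (p : (g * g)%type) : (g * g)%type :=
  (opL j J m p.1 - s *: opZ J m p.2, opL j J m p.2 + s *: opZ J m p.1).

End Actions.

Section Complexification.
Context {R : realType} {g : tvsType R}.
Local Notation C := R[i].

Definition complex_scale (z : C) (p : (g * g)%type) : (g * g)%type :=
  (complex.Re z *: p.1 - complex.Im z *: p.2,
   complex.Re z *: p.2 + complex.Im z *: p.1).

(* linear in the first argument, as the library's Hermitian forms *)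
Definition hermitian_ext (kappa : g -> g -> R) (p q : (g * g)%type) : C :=
  ((kappa p.1 q.1 + kappa p.2 q.2) +i* (kappa p.2 q.1 - kappa p.1 q.2))%C.

Definition hilbert_completion (kappa : g -> g -> R)
    (H : completeNormedModType C) (dot : {dot H for Num.conj})
    (iota : (g * g)%type -> H) : Prop :=
  [/\ forall x, `|x| ^+ 2 = dot x x,
      forall p q, iota (p + q) = iota p + iota q,
      forall z p, iota (complex_scale z p) = z *: iota p,
      forall p q, dot (iota p) (iota q) = hermitian_ext kappa p q &
      closure (range iota) = [set: H]].

(* Densely defined operators on H are handled through their graphs.         *)
Definition adjoint_graph (H : completeNormedModType C)
    (dot : {dot H for Num.conj}) (T : set (H * H)) : set (H * H) :=
  [set y | forall x, T x -> dot x.2 y.1 = dot x.1 y.2].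

Definition closure_graph (H : completeNormedModType C)
    (iota : (g * g)%type -> H) (A : (g * g)%type -> (g * g)%type) :
    set (H * H) :=
  closure (range (fun p => (iota p, iota (A p)))).

Definition essentially_self_adjoint (H : completeNormedModType C)
    (dot : {dot H for Num.conj}) (iota : (g * g)%type -> H)
    (A : (g * g)%type -> (g * g)%type) : Prop :=
  adjoint_graph dot (closure_graph iota A) = closure_graph iota A.

End Complexification.

(* Main.v *)
Require Import Defs.
From HB Require Import structures.
From mathcomp Require Import all_boot all_order all_algebra sesquilinear.
From mathcomp Require Import complex.
From mathcomp Require Import all_classical all_reals all_analysis.
From mathcomp Require Import ring lra.

Set Implicit Arguments.
Unset Strict Implicit.
Unset Printing Implicit Defensive.

Import Order.TTheory GRing.Theory Num.Theory.
Import numFieldNormedType.Exports.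

Local Open Scope classical_set_scope.
Local Open Scope ring_scope.

(* Put [sigma = J m]. Criticality and the weak non-degeneracy of [w] give      *)
(* [sigma . m = 0], so [exp (t sigma)] fixes [m]; it acts by [V t] on T_mM and *)
(* by [U t = Ad (exp (t sigma))] on g.  Along a curve with velocity [X], the   *)
(* Hessian is [2 (|TJ X|^2 + w (X, tau_m sigma^* X))].  For [X] equal to       *)
(* [xi . m + j (eta . m)], the relations [V t (xi . m) = (U t xi) . m] and     *)
(* [V t o j = j o V t] turn it into [2 (|L eta|^2 - |Z eta|^2)], that is       *)
(* [2 <C^+ eta, C^- eta>].                                                     *)
(*   The operators -C^+ and -C^- are non-negative and commute on g_C, but for  *)
(* unbounded operators this and essential self-adjointness do not make the     *)
(* product non-negative (Nelson's phenomenon).  Here the unitary group [U]     *)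
(* preserves g_C, commutes with C^+, and its generator is a multiple of the    *)
(* difference C^+ - C^-.  Hence [S = (1 - lam C^+)^-1] maps the graph of the   *)
(* closure of -C^- into itself.  For (x, y) in this graph, the sequence        *)
(* [<S^k x, S^k y>] is convex and bounded, so it does not increase; comparing  *)
(* its first two terms and letting [lam] tend to 0 gives the claim.  If g is   *)
(* finite dimensional, [S] exists on g_C itself by linear algebra.             *)

(** * Mean values and Hadamard derivatives in locally convex spaces *)

(** At a critical point [sigma = J m] satisfies [sigma . m = 0], since the differential of the
    square norm there is [X |-> - 2 w (sigma . m, X)] ([critical_fixed]). Along a curve [c] through
    [m] the first derivative is [2 kappa (TJ c', J c)]. Writing [J c = sigma + (J c - sigma)] and
    trading the [sigma] part for [w (sigma . c, c')] by the momentum identity gives a second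
    derivative that depends on the velocity alone ([hessian_along_curve]). On [g_C . m] the terms in
    [xi] and the mixed terms cancel ([hessian_value]), which leaves [2 (|L eta|^2 - |Z eta|^2)]. The
    theorem is thus the inequality [|Z eta| <= |L eta|] ([norm_opZ_le_opL]).

    This inequality says that the product of [- C^+] and [- C^-] is non-negative on real vectors.
    Each factor is non-negative because [w (X, j X) >= 0] for [X = xi . m + s j (eta . m)] with
    [s = 1] or [s = -1] ([opC_le0]). The factors commute because the flow of [sigma] preserves
    [kappa], [w] and, by invariance, [j] ([tflow_j], [opLZ_commute]). The passage from commuting
    factors to a non-negative product ([commuting_product_ge0]) uses bounded resolvents only,
    without square roots or spectral measures. On the Hilbert completion the resolvent comes from a
    minimization ([resolvent_exists]), and the flow makes it compatible with both operators
    ([strongly_commuting_product_ge0]).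

    The geometric input is read off from second derivatives of two smooth maps in charts. Symmetry
    of second derivatives ([C2_sym]) identifies the linearized vector field of [sigma] at [m] with
    the isotropy representation ([field_in_chart_hdiff]), and the derivative of [Ad] with the
    bracket ([Ad_exp_hdiff]). *)

Section Calculus.
Context {R : realType}.
Implicit Types E F K : tvsType R.

Definition convex_in F (N : set F) : Prop :=
  forall a b (t : R), N a -> N b -> 0 <= t <= 1 -> N (t *: a + (1 - t) *: b).

Lemma convex_nbhs F (y : F) (W : set F) : nbhs y W ->
  exists N, [/\ open N, N y, convex_in N & N `<=` W].
Proof.
move=> Wy; have [B Bc [Bo Bn]] := @locally_convex R F.
have [N [BN Ny] NW] := Bn y W Wy.
exists N; split => //; first exact: Bo.
move=> a b t Na Nb /andP[t0 t1].
have := Bc N (mem_set BN) a b (Itv01 t0 t1) (mem_set Na) (mem_set Nb).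
by move=> /set_mem.
Qed.

Lemma cvg_punctured0 (P : set R) : (\forall h \near (0 : R)^', P h) <->
  exists2 r, 0 < r & forall h, `|h| < r -> h != 0 -> P h.
Proof.
split.
  move=> /nbhs_ballP[r /= r0 rP]; exists r => // h hr h0; apply: rP => //.
  by rewrite /= -ball_normE /= sub0r normrN.
move=> [r r0 rP]; apply/nbhs_ballP; exists r => //= h.
by rewrite -ball_normE /= sub0r normrN => hr h0; apply: rP.
Qed.

(** The slope over the whole interval is the average of the two slopes, weighted by the lengths of
    the pieces. *)
Lemma convex_slope F (N : set F) (c : R -> F) (a b d : R) : convex_in N ->
  a < b -> b < d ->
  N ((b - a)^-1 *: (c b - c a)) -> N ((d - b)^-1 *: (c d - c b)) ->
  N ((d - a)^-1 *: (c d - c a)).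
Proof.
move=> cN ab bd N1 N2.
pose t := (b - a) / (d - a).
have da : d - a != 0 by rewrite subr_eq0 gt_eqF// (lt_trans ab).
have := cN _ _ t N1 N2.
have -> : 1 - t = (d - b) / (d - a) by rewrite /t; field.
rewrite !scalerA.
have -> : t * (b - a)^-1 = (d - a)^-1.
  by rewrite /t; field; rewrite da subr_eq0 gt_eqF.
have -> : (d - b) / (d - a) * (d - b)^-1 = (d - a)^-1.
  by field; rewrite da subr_eq0 gt_eqF.
rewrite -scalerDr [_ - _ + _]addrC addrA subrK; apply.
rewrite /t divr_ge0 /=; [|lra..].
by rewrite ler_pdivrMr; lra.
Qed.

(* The supremum of the [s] whose slope from 0 lies in [N] is 1; convexity of    *)
(* [N] replaces the Hahn-Banach theorem.                                        *)
Lemma mean_value_in F (N : set F) (c : R -> F) : open N -> convex_in N ->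
  (forall t : R, 0 <= t <= 1 -> exists2 l, N l &
     dquot (c : R^o -> F) t 1 h @[h --> (0 : R)^'] --> l) ->
  N (c 1 - c 0).
Proof.
move=> oN cN dc.
pose sl a b := N ((b - a)^-1 *: (c b - c a)).
have near_slope (t : R) : 0 <= t <= 1 -> exists2 r, 0 < r & forall s,
    (t < s < t + r -> sl t s) /\ (t - r < s < t -> sl s t).
  move=> /dc[l Nl /(_ N)]; rewrite nbhs_filterE.
  move=> /(_ (open_nbhs_nbhs (conj oN Nl)))/cvg_punctured0[r r0 rP].
  exists r => // s; split=> /andP[s1 s2].
    have /= := rP (s - t); rewrite /dquot /sl scaler1 subrKC /=.
    by apply; [rewrite ger0_norm; lra|rewrite subr_eq0; apply/eqP; lra].
  have /= := rP (s - t); rewrite /dquot /sl scaler1 subrKC /=.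
  have -> : (s - t)^-1 *: (c s - c t) = (t - s)^-1 *: (c t - c s).
    by rewrite -[s - t]opprB -[c s - _]opprB invrN scaleNr scalerN opprK.
  by apply; [rewrite ler0_norm; lra|rewrite subr_eq0; apply/eqP; lra].
pose S := [set t | 0 < t <= 1 /\ forall s, 0 < s <= t -> sl 0 s].
have [r0 r0_gt0 rP0] := near_slope 0 ltac:(lra).
have S0 : S (Num.min (r0 / 2) 1).
  split; first by rewrite lt_min ge_min lexx orbT andbT; lra.
  move=> s /andP[s0]; rewrite le_min => /andP[s1 s2].
  by apply: (rP0 s).1; lra.
have supS : has_sup S.
  by split; [exists (Num.min (r0 / 2) 1)|exists 1 => t [/andP[]]].
pose T := sup S.
have T0 : 0 < T.
  have [/andP[h _] _] := S0.
  by apply: (lt_le_trans h); apply: ub_le_sup => //; case: supS.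
have T1 : T <= 1 by apply: ge_sup; [exact: supS.1|move=> t [/andP[]]].
have below s : 0 < s -> s < T -> sl 0 s.
  move=> s0 sT; have [t St st] := sup_adherent (ltac:(lra) : 0 < T - s) supS.
  by apply: St.2; rewrite s0 /=; move: st; rewrite -/T; lra.
have [r r_gt0 rP] := near_slope T ltac:(lra).
(* The supremum belongs to the set: a point [s < T] close to [T] splits [[0, T]] into two intervals
   with slopes in [N]. *)
have slT : sl 0 T.
  pose s := Num.max (T / 2) (T - r / 2).
  have s1 : T / 2 <= s by rewrite le_max lexx.
  have s2 : T - r / 2 <= s by rewrite le_max lexx orbT.
  have s3 : s < T by rewrite gt_max; apply/andP; split; lra.
  apply: (@convex_slope _ _ c 0 s T) => //; first lra.
    by apply: below => //; lra.
  by apply: (rP s).2; lra.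
(* If [T < 1], the slopes just to the right of [T] extend the property beyond the supremum. *)
have T1' : T = 1.
  apply/eqP; rewrite eq_le T1 /= leNgt; apply/negP => ltT1.
  pose s := Num.min 1 (T + r / 2).
  have s1 : s <= 1 by rewrite ge_min lexx.
  have s2 : s <= T + r / 2 by rewrite ge_min lexx orbT.
  have s3 : T < s by rewrite lt_min; apply/andP; split; lra.
  suff : s <= T by lra.
  apply: ub_le_sup; first by case: supS.
  split; first by lra.
  move=> u /andP[u0 us]; have [uT|uT|->//] := ltgtP u T; first exact: below.
  by apply: (@convex_slope _ _ c 0 T u) => //; apply: (rP u).1; lra.
by have := slT; rewrite T1' /sl subr0 invr1 scale1r.
Qed.

End Calculus.

(** * Hadamard derivatives and the chain rule *)

Section Hadamard.
Context {R : realType}.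
Implicit Types E F K : tvsType R.

Lemma tvs_cvgD E (T : Type) (G : set_system T) (FG : Filter G) (f g : T -> E)
    (a b : E) : f @ G --> a -> g @ G --> b -> (fun t => f t + g t) @ G --> a + b.
Proof.
move=> fa gb; apply: (@cvg_comp _ _ _ (fun t => (f t, g t))
  (fun p : E * E => p.1 + p.2) G (nbhs (a, b))); first exact: cvg_pair.
exact: (@add_continuous E (a, b)).
Qed.

Lemma tvs_cvgZ E (T : Type) (G : set_system T) (FG : Filter G) (k : T -> R)
    (f : T -> E) (c : R) (a : E) :
  k @ G --> c -> f @ G --> a -> (fun t => k t *: f t) @ G --> c *: a.
Proof.
move=> kc fa; apply: (@cvg_comp _ _ _ (fun t => (k t : R^o, f t))
  (fun p : R^o * E => p.1 *: p.2) G (nbhs (c : R^o, a))).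
  exact: (@cvg_pair _ _ _ G (nbhs (c : R^o)) (nbhs a)).
exact: (@scale_continuous R E (c, a)).
Qed.

Lemma tvs_cvgB E (T : Type) (G : set_system T) (FG : Filter G) (f g : T -> E)
    (a b : E) : f @ G --> a -> g @ G --> b -> (fun t => f t - g t) @ G --> a - b.
Proof.
move=> fa gb; apply: (@cvg_comp _ _ _ (fun t => (f t, g t))
  (fun p : E * E => p.1 - p.2) G (nbhs (a, b))); first exact: cvg_pair.
exact: (@sub_continuous E (a, b)).
Qed.

(* Hadamard differentiability at one point: it is implied by class C^1 and      *)
(* already satisfies the chain rule, so no class C^n is needed for composites.  *)
Definition hdiff E F (f : E -> F) (x : E) (df : E -> F) : Prop :=
  forall v,
    dquot f x p.1 p.2 @[p --> filter_prod (nbhs v) (0 : R)^'] --> df v.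

(** Joint continuity of [(y, h, w) |-> y + h *: w] at [(x, 0, v)], unfolded into neighbourhoods. *)
Lemma nbhs_addZ E (x v : E) (A : set E) : nbhs x A ->
  exists P Q, exists2 r : R, 0 < r & [/\ nbhs x P, nbhs v Q &
    forall y w h, P y -> Q w -> `|h| < r -> A (y + h *: w)].
Proof.
move=> Ax.
have : (fun p : E * (R^o * E) => p.1 + p.2.1 *: p.2.2) @ (x, (0 : R^o, v)) --> x.
  rewrite -[X in _ --> X]addr0 -[X in x + X](scale0r v).
  apply: tvs_cvgD; first exact: cvg_fst.
  apply: (@tvs_cvgZ _ _ _ _ (fun p : E * (R^o * E) => p.2.1)
    (fun p : E * (R^o * E) => p.2.2)).
    by apply: (@cvg_comp _ _ _ snd fst _ (nbhs (0 : R^o, v)));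
      [exact: cvg_snd|exact: cvg_fst].
  by apply: (@cvg_comp _ _ _ snd snd _ (nbhs (0 : R^o, v)));
    [exact: cvg_snd|exact: cvg_snd].
move=> /(_ A Ax)[[P B] /= [Px [[C Q] /= [C0 Qv] CQ]] PB].
have /nbhs_ballP[r /= r0 rC] := C0.
exists P, Q, r => //; split => // y w h Py Qw hr.
apply: (PB (y, (h, w))); split => //=; apply: CQ; split => //=.
by apply: rC; rewrite -ball_normE /= sub0r normrN.
Qed.

Lemma hdiff_line E F (f : E -> F) x df v : hdiff f x df ->
  dquot f x v h @[h --> (0 : R)^'] --> df v.
Proof.
move=> hf W /hf[[P Q] /= [Pv Q0] PQ].
by apply: filterS Q0 => h Qh; apply: (PQ (v, h)); split => //; apply: nbhs_singleton.
Qed.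

Lemma dderive_unique E F (f : E -> F) x v l : hausdorff_space F ->
  dquot f x v h @[h --> (0 : R)^'] --> l -> dderive f x v = l.
Proof.
move=> hF fl; rewrite /dderive.
apply: xget_unique => //= l' fl'.
by apply: (@cvg_unique _ _ (dquot f x v h @[h --> (0 : R)^'])).
Qed.

Lemma dderivable_cvg E F (f : E -> F) x v : hausdorff_space F ->
  dderivable f x v -> dquot f x v h @[h --> (0 : R)^'] --> dderive f x v.
Proof. by move=> hF [l fl]; rewrite (dderive_unique hF fl). Qed.

Lemma hdiff_dderive E F (f : E -> F) x df v : hausdorff_space F ->
  hdiff f x df -> dderive f x v = df v.
Proof. by move=> hF hf; apply: dderive_unique => //; apply: hdiff_line. Qed.

Lemma hdiff_ext E F (f : E -> F) x df dg : df =1 dg ->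
  hdiff f x df -> hdiff f x dg.
Proof. by move=> e hf v; rewrite -e; apply: hf. Qed.

Lemma hdiff_near E F (f g : E -> F) x df : (\forall y \near x, f y = g y) ->
  hdiff f x df -> hdiff g x df.
Proof.
move=> fg hf v W /hf[[P Q] /= [Pv Q0] PQ].
have [P1 [Q1 [r r0 [P1x Q1v H]]]] := nbhs_addZ v fg.
exists (P `&` Q1, Q `&` [set h | `|h| < r]) => /=.
  split; apply: filterI => //.
  by apply/cvg_punctured0; exists r.
move=> [w h] /= [[Pw Q1w] [Qh hr]].
have := PQ (w, h) (conj Pw Qh); rewrite /= /dquot.
by rewrite (H x w h) ?(nbhs_singleton fg) //; apply: nbhs_singleton.
Qed.

(** The quotient of the composite is that of [g] along the moving direction [dquot f x w h], which
    tends to [df v]. Convergence jointly in the direction is what Hadamard differentiability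
    supplies. *)
Lemma hdiff_comp E F K (f : E -> F) (g : F -> K) x df dg :
  hdiff f x df -> hdiff g (f x) dg -> hdiff (g \o f) x (dg \o df).
Proof.
move=> hf hg v W /hg[[P Q] /= [Pv Q0] PQ].
have [[P1 Q1] /= [P1v Q10] PQ1] := hf v _ Pv.
exists (P1, Q `&` Q1 `&` [set h | h != 0]) => /=.
  split => //; apply: filterI; first exact: filterI.
  by apply/cvg_punctured0; exists 1.
move=> [w h] /= [Pw [[Qh Q1h] h0]].
have := PQ (dquot f x w h, h) (conj (PQ1 (w, h) (conj Pw Q1h)) Qh).
by rewrite /= /dquot scalerA divff// scale1r subrKC.
Qed.

Lemma hdiff_pair E F K (f : E -> F) (g : E -> K) x df dg :
  hdiff f x df -> hdiff g x dg ->
  hdiff (fun y => (f y, g y)) x (fun v => (df v, dg v)).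
Proof.
move=> hf hg v; apply: (@cvg_pair _ _ _ _ (nbhs (df v)) (nbhs (dg v))).
  exact: hf.
exact: hg.
Qed.

Lemma hdiff_linear E F (f : E -> F) x : linear f -> continuous f -> hdiff f x f.
Proof.
move=> lf cf v.
have e : {near filter_prod (nbhs v) (0 : R)^',
    f \o fst =1 (fun p => dquot f x p.1 p.2)}.
  exists (setT, [set h | h != 0]) => /=.
    by split; [exact: filterT|apply/cvg_punctured0; exists 1].
  move=> [w h] /= [_ h0]; rewrite /dquot [x + _]addrC lf addrK scalerA mulVf//.
  by rewrite scale1r.
apply: cvg_trans; first exact: (near_eq_cvg e).
apply: cvg_comp; first exact: cvg_fst.
exact: cf.
Qed.

Lemma hdiff_cst E F (c : F) (x : E) : hdiff (fun=> c) x (fun=> 0).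
Proof.
move=> v; rewrite /dquot; under eq_fun do rewrite subrr scaler0.
exact: cvg_cst.
Qed.

Lemma hdiff_id E (x : E) : hdiff id x id.
Proof. by apply: hdiff_linear => // y; exact: cvg_id. Qed.

Lemma hdiffD E F (f g : E -> F) x df dg : hdiff f x df -> hdiff g x dg ->
  hdiff (fun y => f y + g y) x (fun v => df v + dg v).
Proof.
move=> hf hg.
apply: (hdiff_comp (hdiff_pair hf hg) (g := fun p : F * F => p.1 + p.2)
  (dg := fun p : F * F => p.1 + p.2)).
apply: hdiff_linear; last exact: add_continuous.
by move=> a u v /=; rewrite scalerDr addrACA.
Qed.

Lemma hdiff0 E F (f : E -> F) x df : hausdorff_space F -> hdiff f x df -> df 0 = 0.
Proof.
move=> hF hf; rewrite -(hdiff_dderive 0 hF hf); apply: dderive_unique => //.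
rewrite /dquot; under eq_fun do rewrite scaler0 addr0 subrr scaler0.
exact: cvg_cst.
Qed.

(** Substituting [h * a] for [h] turns the quotient in the direction [a *: v] into [a] times the one
    in the direction [v]. *)
Lemma hdiffZ E F (f : E -> F) x df a v : hausdorff_space F -> hdiff f x df ->
  df (a *: v) = a *: df v.
Proof.
move=> hF hf; have [->|a0] := eqVneq a 0.
  by rewrite !scale0r (hdiff0 hF hf).
rewrite -(hdiff_dderive (a *: v) hF hf); apply: dderive_unique => //.
have -> : dquot f x (a *: v) = fun h => a *: dquot f x v (h * a).
  apply: funext => h; rewrite /dquot !scalerA; congr (_ *: _).
  have [->|h0] := eqVneq h 0; first by rewrite mul0r invr0 mulr0.
  by field; apply/andP.
have lim : (fun h : R => h * a) @ (0 : R)^' --> (0 : R)^'.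
  move=> P /cvg_punctured0[r r0 rP]; apply/cvg_punctured0.
  exists (r / `|a|); first by rewrite divr_gt0 ?normr_gt0.
  move=> h hr h0; apply: rP; last by rewrite mulf_neq0.
  by rewrite normrM -ltr_pdivlMr ?normr_gt0.
apply: tvs_cvgZ; first exact: cvg_cst.
by apply: cvg_comp; [exact: lim|exact: hdiff_line].
Qed.

(** The quotient equals [b x w2 + b w1 (y + h *: w2)], and joint continuity passes to the limit. *)
Lemma hdiff_bilinear E F K (b : E -> F -> K) x y :
  (forall u, linear (b u)) -> (forall v, linear (b^~ v)) ->
  continuous (fun p : E * F => b p.1 p.2) ->
  hdiff (fun p : E * F => b p.1 p.2) (x, y) (fun p => b x p.2 + b p.1 y).
Proof.
move=> lr ll cb v.
have e : {near filter_prod (nbhs v) (0 : R)^',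
    (fun p : (E * F) * R => b x p.1.2 + b p.1.1 (y + p.2 *: p.1.2)) =1
    (fun p => dquot (fun p : E * F => b p.1 p.2) (x, y) p.1 p.2)}.
  exists (setT, [set h | h != 0]) => /=.
    by split; [exact: filterT|apply/cvg_punctured0; exists 1].
  move=> [[w1 w2] h] /= [_ h0]; rewrite /dquot /=.
  have -> : b (x + h *: w1) (y + h *: w2) - b x y =
      h *: (b x w2 + b w1 (y + h *: w2)).
    rewrite [x + _]addrC (ll (y + h *: w2) h w1 x).
    by rewrite [in b x (y + _)]addrC lr scalerDr addrA addrK addrC.
  by rewrite scalerA mulVf// scale1r.
apply: cvg_trans; first exact: (near_eq_cvg e).
have cont (x' : E) (z : F) (G : set_system ((E * F) * R)) (FG : Filter G)
    (p1 : (E * F) * R -> E) (p2 : (E * F) * R -> F) :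
    p1 @ G --> x' -> p2 @ G --> z -> (fun p => b (p1 p) (p2 p)) @ G --> b x' z.
  move=> h1 h2.
  apply: (@cvg_comp _ _ _ (fun p => (p1 p, p2 p)) (fun p : E * F => b p.1 p.2)
    G (nbhs (x', z))); first exact: cvg_pair.
  exact: (cb (x', z)).
have c2 : (fun p : (E * F) * R => p.1.2) @ filter_prod (nbhs v) (0 : R)^' --> v.2.
  apply: (@cvg_comp _ _ _ fst snd _ (nbhs v)); [exact: cvg_fst|exact: cvg_snd].
have c1 : (fun p : (E * F) * R => p.1.1) @ filter_prod (nbhs v) (0 : R)^' --> v.1.
  apply: (@cvg_comp _ _ _ fst fst _ (nbhs v)); [exact: cvg_fst|exact: cvg_fst].
apply: (@cvg_comp _ _ _ (fun p : (E * F) * R =>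
  (b x p.1.2, b p.1.1 (y + p.2 *: p.1.2))) (fun q : K * K => q.1 + q.2)
  _ (nbhs (b x v.2, b v.1 y)));
  last exact: (@add_continuous K (b x v.2, b v.1 y)).
apply: cvg_pair; apply: cont => //; first exact: cvg_cst.
move=> W /(nbhs_addZ v.2)[P [Q [r r0 [Px Qv H]]]].
have [[P1 Q1] /= [P1v Q10] PQ1] := c2 _ Qv.
exists (P1, Q1 `&` [set h | `|h| < r]).
  by split => //=; apply: filterI => //; apply/cvg_punctured0; exists r.
move=> [w h] /= [Pw [Qh hr]]; apply: H => //; first exact: nbhs_singleton.
exact: (PQ1 (w, h)).
Qed.

End Hadamard.

(** * Maps of class C^1 and C^2: linearity of the derivative, symmetry of the second one *)

Section ClassC1.
Context {R : realType}.
Implicit Types E F K : tvsType R.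

Lemma smooth_on_subset E F (U V : set E) (f : E -> F) : V `<=` U ->
  smooth_on U f -> smooth_on V f.
Proof.
move=> VU Uf n; move: (Uf n); elim: n E F U V VU f {Uf} => [|n IHn] E F U V VU f.
  by move=> [cf _]; split => //; exact: continuous_subspaceW cf.
move=> [cf [df Cf]]; split; first exact: continuous_subspaceW cf.
split; first by move=> x v /VU; exact: df.
by apply: IHn Cf => p /= [/VU].
Qed.

Lemma open_setXT E F (U : set E) : open U -> open (U `*` [set: F]).
Proof.
move=> oU; rewrite openE => -[x v] [/= Ux _].
by exists (U, setT) => //=; split; [exact: open_nbhs_nbhs|exact: filterT].
Qed.
Arguments open_setXT {E} F {U}.

Lemma class_C_continuous n E F (U : set E) (f : E -> F) x : open U ->
  class_C n U f -> U x -> f @ x --> f x.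
Proof.
move=> oU Cf Ux; have cf : {within U, continuous f} by case: n Cf => [|n] [].
by move: cf; rewrite (continuous_open_subspace f oU); apply; exact: mem_set.
Qed.

Lemma C1_dderive_continuous E F (U : set E) (f : E -> F) x v : open U ->
  class_C 1 U f -> U x ->
  (fun p : E * E => dderive f p.1 p.2) @ (x, v) --> dderive f x v.
Proof.
move=> oU [_ [_ Cf]] Ux.
have Cf0 : class_C 0 (U `*` setT) (fun p : (E * E)%type => dderive f p.1 p.2).
  exact: Cf.
exact: (class_C_continuous (x := (x, v)) (open_setXT E oU) Cf0).
Qed.

Lemma dquot_segment E F (f : E -> F) y w h (s k : R) : h != 0 ->
  dquot ((fun t => h^-1 *: f (y + (t * h) *: w)) : R^o -> F) s 1 k =
  dquot f (y + (s * h) *: w) w (k * h).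
Proof.
move=> h0; rewrite /dquot -scalerBr scalerA -addrA -scalerDl.
have -> : k^-1 * h^-1 = (k * h)^-1.
  have [->|k0] := eqVneq k 0; first by rewrite mul0r invr0 mul0r.
  by field; rewrite k0 h0.
by congr (_ *: (f (_ + _ *: _) - _)); rewrite /GRing.scale /= mulr1; ring.
Qed.

Lemma punctured_mulr (a : R) : a != 0 -> h * a @[h --> (0 : R)^'] --> (0 : R)^'.
Proof.
move=> a0 P /cvg_punctured0[r r0 rP]; apply/cvg_punctured0.
exists (r / `|a|); first by rewrite divr_gt0 ?normr_gt0.
move=> h hr h0; apply: rP; last by rewrite mulf_neq0.
by rewrite normrM -ltr_pdivlMr ?normr_gt0.
Qed.

(** The quotient is the increment over [[0, 1]] of [t |-> h^-1 *: f (y + (t * h) *: w)], whose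
    derivatives are those of [f] along the segment. *)
Lemma dquot_in E F (f : E -> F) (N : set F) (l : R -> F) y w h : h != 0 ->
  open N -> convex_in N ->
  (forall s, 0 <= s <= 1 -> N (l s) /\
     dquot f (y + (s * h) *: w) w k @[k --> (0 : R)^'] --> l s) ->
  N (dquot f y w h).
Proof.
move=> h0 oN cN H.
have := @mean_value_in R F N (fun t => h^-1 *: f (y + (t * h) *: w)) oN cN.
rewrite mul1r mul0r scale0r addr0 -scalerBr; apply => s s01.
have [Nl fl] := H s s01; exists (l s) => //.
under eq_fun do rewrite dquot_segment//.
by apply: cvg_comp fl; exact: punctured_mulr.
Qed.

(* The limit is uniform in the base point; additivity of the derivative and     *)
(* the symmetry of second derivatives rest on this.                             *)
Lemma C1_dquot E F (U : set E) (f : E -> F) x v : hausdorff_space F -> open U ->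
  class_C 1 U f -> U x ->
  dquot f q.1.1 q.1.2 q.2 @[q --> filter_prod (nbhs (x, v)) (0 : R)^'] -->
  dderive f x v.
Proof.
move=> hF oU Cf Ux W /convex_nbhs[N [oN Nl cN NW]].
have oUT := open_setXT E oU.
have [[A B] /= [Ax Bv] AB] : nbhs (x, v)
    ((U `*` setT) `&` [set p : E * E | N (dderive f p.1 p.2)]).
  apply: filterI; first by apply: open_nbhs_nbhs; split.
  exact: (C1_dderive_continuous (v := v) oU Cf Ux (open_nbhs_nbhs (conj oN Nl))).
have [P [Q [r r0 [Px Qv H]]]] := nbhs_addZ v Ax.
exists (P `*` (Q `&` B), [set h | `|h| < r /\ h != 0]) => /=.
  split; first by exists (P, Q `&` B) => //; split => //; exact: filterI.
  by apply/cvg_punctured0; exists r.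
move=> [[y w] h] /= [[Py [Qw Bw]] [hr h0]]; apply: NW.
apply: (@dquot_in _ _ _ _ (fun s => dderive f (y + (s * h) *: w) w)) => // s s01.
have Ays : A (y + (s * h) *: w).
  apply: H => //; rewrite normrM ger0_norm; last by case/andP: s01.
  by apply: le_lt_trans hr; rewrite ler_piMl//; case/andP: s01.
have [[Uy _] Ny] := AB (y + (s * h) *: w, w) (conj Ays Bw); split => //.
by apply: dderivable_cvg => //; case: Cf => _ [df _]; apply: df.
Qed.

Lemma C1_hdiff E F (U : set E) (f : E -> F) x : hausdorff_space F -> open U ->
  class_C 1 U f -> U x -> hdiff f x (dderive f x).
Proof.
move=> hF oU Cf Ux v W /(C1_dquot hF oU Cf Ux)[[P Q] /= [[[P1 P2] /= [P1x P2v] P12] Q0] PQ].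
exists (P2, Q) => // -[w h] /= [Pw Qh].
by apply: (PQ (x, w, h)); split => //; apply: P12; split => //; exact: nbhs_singleton.
Qed.

Lemma cvg_line E (x v : E) : (fun h : R => x + h *: v) @ (0 : R)^' --> x.
Proof.
move=> A /(nbhs_addZ v)[P [Q [r r0 [Px Qv H]]]]; apply/cvg_punctured0.
by exists r => // h hr _; apply: H => //; exact: nbhs_singleton.
Qed.

Lemma cvg_filter_prod_pair (T1 T2 S : Type) (G : set_system S) (FG : Filter G)
    (A : set_system T1) (B : set_system T2) (f : S -> T1) (k : S -> T2) :
  f @ G `=>` A -> k @ G `=>` B -> (fun s => (f s, k s)) @ G `=>` filter_prod A B.
Proof.
move=> fA kB W [[P Q] /= [AP BQ] PQ].
have h1 := fA _ AP; have h2 := kB _ BQ.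
rewrite /fmap /=; near=> s; apply: PQ; split => /=; near: s; [exact: h1|exact: h2].
Unshelve. all: by end_near. Qed.

(** A step along [u + v] is a step along [u] followed by a step along [v] from the moved base point
    [x + h *: u]. *)
Lemma C1_dderiveD E F (U : set E) (f : E -> F) x u v : hausdorff_space F ->
  open U -> class_C 1 U f -> U x ->
  dderive f x (u + v) = dderive f x u + dderive f x v.
Proof.
move=> hF oU Cf Ux; apply: dderive_unique => //.
have -> : dquot f x (u + v) =
    fun h => dquot f x u h + dquot f (x + h *: u) v h.
  apply: funext => h; rewrite /dquot -scalerDr; congr (_ *: _).
  by rewrite scalerDr addrA [RHS]addrC addrA subrK.
have hf := C1_hdiff hF oU Cf Ux.
apply: tvs_cvgD; first exact: hdiff_line.
apply: (@cvg_comp _ _ _ (fun h : R => (x + h *: u, v, h))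
  (fun q : (E * E) * R => dquot f q.1.1 q.1.2 q.2) _
  (filter_prod (nbhs (x, v)) (0 : R)^')); last exact: C1_dquot Ux.
apply: cvg_filter_prod_pair; last exact: cvg_id.
by apply: cvg_pair; [exact: cvg_line|exact: cvg_cst].
Qed.

Lemma C1_dderive_linear E F (U : set E) (f : E -> F) x : hausdorff_space F ->
  open U -> class_C 1 U f -> U x -> linear (dderive f x).
Proof.
move=> hF oU Cf Ux a u v; rewrite (C1_dderiveD _ _ hF oU Cf Ux).
by rewrite (hdiffZ _ _ hF (C1_hdiff hF oU Cf Ux)).
Qed.

Lemma C1_dderive_cont E F (U : set E) (f : E -> F) x : open U ->
  class_C 1 U f -> U x -> continuous (dderive f x).
Proof.
move=> oU Cf Ux v.
apply: (@cvg_comp _ _ _ (fun v => (x, v)) (fun p : E * E => dderive f p.1 p.2)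
  _ (nbhs (x, v))); last exact: C1_dderive_continuous Ux.
by apply: cvg_pair; [exact: cvg_cst|exact: cvg_id].
Qed.

Lemma C2_dderive E F (U : set E) (f : E -> F) : class_C 2 U f ->
  class_C 1 (U `*` [set: E]) (fun p : (E * E)%type => dderive f p.1 p.2).
Proof. by case=> _ []. Qed.

Lemma C2_dderive_hdiff E F (U : set E) (f : E -> F) x u : hausdorff_space F ->
  open U -> class_C 2 U f -> U x ->
  hdiff (fun y => dderive f y u) x
    (fun v => dderive (fun p : (E * E)%type => dderive f p.1 p.2) (x, u) (v, 0)).
Proof.
move=> hF oU Cf Ux.
have hD := C1_hdiff (x := (x, u)) hF (open_setXT E oU) (C2_dderive Cf) (conj Ux I).
apply: (hdiff_comp (f := fun y => (y, u)) (df := fun v => (v, 0)) _ hD).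
apply: hdiff_pair; [exact: hdiff_id|exact: hdiff_cst].
Qed.

Lemma filter_prod_swap (A B : set_system R) (FA : Filter A) (FB : Filter B) :
  (fun p : R * R => (p.2, p.1)) @ filter_prod A B `=>` filter_prod B A.
Proof. by apply: cvg_filter_prod_pair; [exact: cvg_snd|exact: cvg_fst]. Qed.

Lemma dquot_swap E F (f : E -> F) x u v h k :
  dquot (fun z => dquot f z v k) x u h = dquot (fun z => dquot f z u h) x v k.
Proof.
rewrite /dquot -!scalerBr !scalerA mulrC; congr (_ *: _).
rewrite !opprB addrACA [RHS]addrACA; congr (_ + _); last by rewrite addrC.
by rewrite addrAC.
Qed.

(** For fixed [k], the derivative along [u] of [z |-> dquot f z v k] is the difference quotient
    along [v] of [z |-> df(z; u)]. The mean value statement in the step [h] then traps the double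
    quotient in any convex neighbourhood of the limit. *)
Lemma C2_second_difference E F (U : set E) (f : E -> F) x u v : hausdorff_space F ->
  open U -> class_C 2 U f -> U x ->
  dquot (fun z => dquot f z v p.2) x u p.1
    @[p --> filter_prod (0 : R)^' (0 : R)^'] -->
  dderive (fun p : (E * E)%type => dderive f p.1 p.2) (x, u) (v, 0).
Proof.
move=> hF oU Cf Ux W /convex_nbhs[N [oN Nl cN NW]].
have [[A B] /= [A0 B0] AB] :=
  C1_dquot (x := (x, u)) (v := (v, 0)) hF (open_setXT E oU) (C2_dderive Cf) (conj Ux I)
    (open_nbhs_nbhs (conj oN Nl)).
have Ax : nbhs x (U `&` [set y | A (y, u, (v, 0))]).
  apply: filterI; first by apply: open_nbhs_nbhs; split.
  have : (fun y : E => (y, u, (v, 0) : E * E)) @ x --> (x, u, (v, 0) : E * E).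
    apply: (@cvg_pair _ _ _ (nbhs x) (nbhs (x, u)) (nbhs (v, 0 : E)));
      last exact: cvg_cst.
    by apply: (@cvg_pair _ _ _ (nbhs x) (nbhs x) (nbhs u)); [exact: cvg_id|exact: cvg_cst].
  by apply.
have [P [Q [r r0 [Px Qv H]]]] := nbhs_addZ v Ax.
have [P' [Q' [r' r'0 [P'x Q'v H']]]] := nbhs_addZ u (filterI Ax Px).
exists ([set h | `|h| < r' /\ h != 0], [set k | (`|k| < r /\ k != 0) /\ B k]) => /=.
  split; first by apply/cvg_punctured0; exists r'.
  by apply: filterI => //; apply/cvg_punctured0; exists r.
move=> [h k] /= [[hr h0] [[kr k0] Bk]]; apply: NW.
apply: (@dquot_in _ _ _ _ (fun s => dquot (fun p : (E * E)%type => dderive f p.1 p.2)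
  (x + (s * h) *: u, u) (v, 0) k)) => // s s01.
have [[Uy Ay] Py] : (U `&` [set y | A (y, u, (v, 0))] `&` P) (x + (s * h) *: u).
  apply: H'; [exact: nbhs_singleton|exact: nbhs_singleton|].
  rewrite normrM ger0_norm; last by case/andP: s01.
  by apply: le_lt_trans hr; rewrite ler_piMl//; case/andP: s01.
split; first exact: (AB ((x + (s * h) *: u, u), (v, 0), k)).
set y := x + _ in Uy Ay Py *.
have [Uyk _] := H y v k Py (nbhs_singleton Qv) kr.
rewrite /dquot /= scaler0 addr0.
have df z : U z -> dquot f z u e @[e --> (0 : R)^'] --> dderive f z u.
  by move=> Uz; apply: dderivable_cvg => //; case: Cf => _ [df _]; apply: df.
have -> : (fun e : R => e^-1 *: (k^-1 *: (f (y + e *: u + k *: v) - f (y + e *: u))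
      - k^-1 *: (f (y + k *: v) - f y))) =
    fun e => k^-1 *: (dquot f (y + k *: v) u e - dquot f y u e).
  apply: funext => e; rewrite /dquot -!scalerBr !scalerA mulrC.
  rewrite [y + e *: u + _]addrAC; congr (_ *: _).
  by rewrite !opprB addrACA [RHS]addrACA; congr (_ + _); rewrite addrC.
apply: tvs_cvgZ; first exact: cvg_cst.
by apply: tvs_cvgB; apply: df.
Qed.

(** Schwarz's theorem: exchanging the two increments does not change the double quotient, so both
    mixed derivatives are its limit. *)
Lemma C2_sym E F (U : set E) (f : E -> F) x u v : hausdorff_space F ->
  open U -> class_C 2 U f -> U x ->
  dderive (fun p : (E * E)%type => dderive f p.1 p.2) (x, u) (v, 0) =
  dderive (fun p : (E * E)%type => dderive f p.1 p.2) (x, v) (u, 0).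
Proof.
move=> hF oU Cf Ux.
pose G := filter_prod (0 : R)^' (0 : R)^'.
apply: (@cvg_unique _ hF (dquot (fun z => dquot f z v p.2) x u p.1 @[p --> G])).
  exact: C2_second_difference Ux.
have -> : (fun p : R * R => dquot (fun z => dquot f z v p.2) x u p.1) =
    fun p => dquot (fun z => dquot f z u p.1) x v p.2.
  by apply: funext => p; exact: dquot_swap.
apply: (@cvg_comp _ _ _ (fun p : R * R => (p.2, p.1))
  (fun p : R * R => dquot (fun z => dquot f z u p.2) x v p.1) _ G).
  exact: filter_prod_swap.
exact: C2_second_difference Ux.
Qed.

Lemma cvg_punctured_at F (f : R -> F) t :
  f (t + h) @[h --> (0 : R)^'] --> f t -> f @ t --> f t.
Proof.
move=> ft W Wt; have /cvg_punctured0[r r0 rP] := ft _ Wt.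
apply/nbhs_ballP; exists r => //= s; rewrite -ball_normE /= => hs.
have [->|st] := eqVneq s t; first exact: nbhs_singleton.
rewrite -[s](subrKC t); apply: rP; last by rewrite subr_eq0.
by rewrite distrC.
Qed.

Lemma curve_continuous F (c : R^o -> F) t dc : hdiff c t dc -> c @ t --> c t.
Proof.
move=> hc; apply: (@cvg_punctured_at F c).
rewrite -[X in _ --> X]addr0 -[X in _ + X](scale0r (dc 1)).
have -> : (fun h : R => c (t + h)) = fun h : R => c t + h *: dquot c t 1 h.
  apply: funext => h; rewrite /dquot; have [->|h0] := eqVneq h 0.
    by rewrite scale0r !addr0.
  by rewrite scalerA divff// scale1r subrKC /GRing.scale /= mulr1.
apply: tvs_cvgD; first exact: cvg_cst.
apply: tvs_cvgZ; last exact: hdiff_line.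
exact: (@nbhs_dnbhs R 0).
Qed.

(** By the mean value statement the increment lies in every convex open neighbourhood of 0. *)
Lemma curve_constant F (c : R^o -> F) : hausdorff_space F ->
  (forall t : R, 0 <= t <= 1 -> dquot c t 1 h @[h --> (0 : R)^'] --> (0 : F)) ->
  c 1 = c 0.
Proof.
move=> hF H; apply: hF => A B A1 B0.
have D0 : nbhs (0 : F) [set y | A (c 1 - y)].
  have : (fun y => c 1 - y) @ (0 : F) --> c 1.
    rewrite -[X in _ --> X]subr0.
    apply: (@tvs_cvgB _ _ _ (nbhs (0 : F)) _ (fun=> c 1) id); first exact: cvg_cst.
    exact: cvg_id.
  by move=> /(_ _ A1).
have [N [oN N0 cN ND]] := convex_nbhs D0.
exists (c 0); split; last exact: nbhs_singleton.
have : N (c 1 - c 0).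
  by apply: (@mean_value_in _ F N c) => // t t01; exists 0 => //; exact: H.
by move=> /ND /=; rewrite opprB subrKC.
Qed.

End ClassC1.

(** * Products of commuting non-negative operators *)

Section PositiveProduct.
Context {R : realType} {V : zmodType}.
Variable ip : V -> V -> R.
Hypothesis ipC : forall x y, ip x y = ip y x.
Hypothesis ipBl : forall x y z, ip (x - y) z = ip x z - ip y z.
Hypothesis ip_ge0 : forall x, 0 <= ip x x.

Let ipBr x y z : ip x (y - z) = ip x y - ip x z.
Proof. by rewrite ipC ipBl !(ipC x). Qed.

(** [V] is only an additive group and [ip] is known to respect subtraction, hence [x - (0 - y)] for
    [x + y]. The bound does the work of the Cauchy-Schwarz inequality. *)
Lemma ip_amgm x y : `|ip x y| <= (ip x x + ip y y) / 2.
Proof.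
have ip0r u : ip u 0 = 0 by rewrite -(subrr 0) ipBr subrr.
have ip0l u : ip 0 u = 0 by rewrite ipC ip0r.
have h1 := ip_ge0 (x - y); have h2 := ip_ge0 (x - (0 - y)).
rewrite !ipBr !ipBl !ip0r !ip0l (ipC y x) in h1 h2.
by rewrite ler_norml; apply/andP; split; lra.
Qed.

(** The increments of a convex sequence increase, so a positive first increment would force at least
    linear growth. *)
Lemma convex_bounded_le (b : nat -> R) (C : R) :
  (forall k, 0 <= b k - 2 * b k.+1 + b k.+2) -> (forall k, b k <= C) ->
  b 1%N <= b 0%N.
Proof.
move=> bc bC; rewrite leNgt; apply/negP => b01.
have inc k : b 1%N - b 0%N <= b k.+1 - b k.
  by elim: k => // k IH; have := bc k; lra.
have lin k : b 0%N + k%:R * (b 1%N - b 0%N) <= b k.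
  elim: k => [|k IH]; first by rewrite mul0r addr0.
  by rewrite -natr1 mulrDl mul1r; have := inc k; lra.
have d0 : 0 < b 1%N - b 0%N by lra.
have C0 : 0 <= (C - b 0%N) / (b 1%N - b 0%N).
  by apply: divr_ge0; [have := bC 0%N; lra|exact: ltW].
have := archi_boundP C0; rewrite ltr_pdivrMr//.
by set k := Num.bound _; have := lin k; have := bC k; lra.
Qed.

(* Along the orbit of [(x, y)] the sequence [ip (S^k x) (S^k y)] is convex    *)
(* (because [S] is symmetric) and bounded, hence non-increasing.              *)
Lemma contraction_decreases (S : V -> V) (Gam : set (V * V)) x y :
  (forall u v, ip (S u) v = ip u (S v)) -> (forall u, ip (S u) (S u) <= ip u u) ->
  (forall p, Gam p -> 0 <= ip p.1 p.2) ->
  (forall p q, Gam p -> Gam q -> Gam (p - q)) ->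
  (forall p, Gam p -> Gam (S p.1, S p.2)) ->
  Gam (x, y) -> ip (S x) (S y) <= ip x y.
Proof.
move=> Ssym Sle Gpos GB GS Gxy.
have Gk k : Gam (iter k S x, iter k S y) by elim: k => // k /GS.
have Sk k u : ip (iter k S u) (iter k S u) <= ip u u.
  by elim: k => // k IH; apply: le_trans (Sle _) IH.
apply: (@convex_bounded_le (fun k => ip (iter k S x) (iter k S y))
  ((ip x x + ip y y) / 2)) => k; last first.
  apply: le_trans (ler_norm _) (le_trans (ip_amgm _ _) _).
  by have := Sk k x; have := Sk k y; lra.
(* Positivity on the difference of the orbit points [k] and [k + 2]; by symmetry of [S] both cross
   terms equal the term of index [k + 1]. *)
have := Gpos _ (GB _ _ (Gk k) (Gk k.+2)); rewrite /= ipBl !ipBr.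
by rewrite -(Ssym (iter k S x)) (Ssym (S (iter k S x))); lra.
Qed.

(* With [S = (1 + lam A)^-1] one has [1 - S^2 = lam (A S + S A S)], so the    *)
(* previous lemma tends to [0 <= 2 <A x, B x>] as [lam] goes to 0.            *)
Lemma commuting_product_ge0 (D : Type) (io : D -> V) (A B : D -> D)
    (Gam : set (V * V)) (d : D) :
  (forall p q, ip (io (A p)) (io q) = ip (io p) (io (A q))) ->
  (forall p, Gam p -> 0 <= ip p.1 p.2) ->
  (forall p q, Gam p -> Gam q -> Gam (p - q)) ->
  (forall p, Gam (io p, io (B p))) ->
  (forall lam, 0 < lam -> exists S : V -> V,
    [/\ forall u v, ip (S u) v = ip u (S v),
        forall u, ip (S u) (S u) <= ip u u,
        forall p, Gam p -> Gam (S p.1, S p.2) &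
        forall p v, ip (io p - S (io p)) v = lam * ip (S (io (A p))) v]) ->
  0 <= ip (io (A d)) (io (B d)).
Proof.
move=> Asym Gpos GB GD HS; set c := ip _ _.
pose n p := ip (io p) (io p).
pose C := n (A (A d)) + n (B d) + (n (A d) + n (A (B d))) + (n d + n (A (A (B d)))).
have C0 : 0 <= C by rewrite /C /n !addr_ge0.
(* A negative [c] would be contradicted by [lam = - c / (C + 1)]. *)
suff H lam : 0 < lam -> 0 <= 2 * c + lam * C.
  rewrite leNgt; apply/negP => c0.
  have lam0 : 0 < - c / (C + 1) by apply: divr_gt0; lra.
  have := H _ lam0; suff : - c / (C + 1) * C <= - c by lra.
  by rewrite -mulrA ler_piMr; [by []|lra|rewrite mulrC ler_pdivrMr; lra].
move=> lam0; have [S [Ssym Sle GS Sres]] := HS _ lam0.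
have := contraction_decreases Ssym Sle Gpos GB GS (GD d).
rewrite -subr_ge0.
(* The left side is [<d - S d, B d> + <S d, B d - S B d>], and [1 - S = lam S A]. *)
have -> : ip (io d) (io (B d)) - ip (S (io d)) (S (io (B d))) =
  lam * (ip (S (io (A d))) (io (B d)) + ip (S (io (A (B d)))) (S (io d))).
  by rewrite mulrDr -!Sres !ipBl (ipC (S (io d))) (ipC (io (B d)) (S (io d))); lra.
rewrite pmulr_rge0// => H.
(* Replacing one [S] by the identity costs a multiple of [lam]; three replacements turn both terms
   into [<A d, B d>]. *)
have small p v : `|ip (io p - S (io p)) v| <= lam * ((n (A p) + ip v v) / 2).
  rewrite Sres normrM gtr0_norm// ler_pM2l//.
  by apply: le_trans (ip_amgm _ _) _; have := Sle (io (A p)); rewrite /n; lra.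
have s1 := small (A d) (io (B d)).
have s2 := small (A (B d)) (S (io d)).
have s3 := small d (io (A (B d))).
move: s1 s2 s3; rewrite !ipBl !ler_norml => /andP[a1 a2] /andP[b1 b2] /andP[c1 c2].
have e1 : ip (io (A (B d))) (S (io d)) = ip (S (io d)) (io (A (B d))) by rewrite ipC.
have e2 : ip (io d) (io (A (B d))) = c by rewrite -Asym.
have hS := Sle (io d); rewrite -/(n d) in hS.
have : ip (S (io (A d))) (io (B d)) + ip (S (io (A (B d)))) (S (io d)) <=
    2 * c + lam * C; last exact: le_trans.
have hl : lam * ip (S (io d)) (S (io d)) <= lam * n d by rewrite ler_pM2l.
have n0 p : 0 <= lam * n p.
  by apply: mulr_ge0; [exact: ltW|rewrite /n; exact: ip_ge0].
have p1 := n0 (A (A d)).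
have p2 := n0 (B d).
have p3 := n0 (A d).
have p4 := n0 (A (B d)).
have p5 := n0 d.
have p6 := n0 (A (A (B d))).
rewrite -/(n (B d)) -/(n (A (B d))) -/c !mulrDr !mulrA in a1 a2 b1 b2 c1 c2 *.
rewrite ?/C ?mulrDr.
rewrite e1 in b1 b2; rewrite e2 in c1 c2.
nra.
Qed.

End PositiveProduct.

(** * The product theorem in finite dimension *)

Section FiniteDimension.
Context {R : realType}.

(** A spanning family of minimal length is free: a nontrivial relation would express one member
    through the others. *)
Lemma free_spanning_family (V : lmodType R) : finite_dimensional V ->
  exists n (b : 'I_n -> V), (forall x, exists c : 'I_n -> R, x = \sum_i c i *: b i) /\
    (forall c : 'I_n -> R, \sum_i c i *: b i = 0 -> forall i, c i = 0).
Proof.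
pose P n := `[< exists b : 'I_n -> V, forall x, exists c : 'I_n -> R,
  x = \sum_i c i *: b i >].
move=> [n0 Vn0]; have exP : exists n, P n by exists n0; apply/asboolP.
case: (ex_minnP exP) => n /asboolP[b bV] nmin.
exists n, b; split => // c c0 k; apply: contrapT => /eqP ck.
case: n b bV nmin c c0 k ck => [|n] b bV nmin c c0 k ck; first by case: k ck.
suff /nmin : P n by rewrite ltnn.
apply/asboolP; exists (fun i => b (lift k i)) => x.
have [a ->] := bV x.
exists (fun i => a (lift k i) - a k / c k * c (lift k i)).
have bk : b k = - (c k)^-1 *: \sum_i c (lift k i) *: b (lift k i).
  move: c0; rewrite (bigD1_ord k) //= => /eqP; rewrite addr_eq0 => /eqP e.
  by rewrite scaleNr -scalerN -e scalerA mulVf// scale1r.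
rewrite (bigD1_ord k) //= {1}bk scalerA scaler_sumr -big_split /=.
apply: eq_bigr => i _; rewrite scalerA -scalerDl; congr (_ *: _).
by rewrite addrC mulrN mulNr.
Qed.

(** In a free spanning family [f] is a square matrix acting on row vectors; injectivity makes its
    kernel trivial. *)
Lemma finite_dimensional_surjective (V : lmodType R) (f : V -> V) :
  finite_dimensional V -> linear f -> (forall x, f x = 0 -> x = 0) ->
  forall y, exists x, f x = y.
Proof.
move=> /free_spanning_family[n [b [bV bfree]]] lf finj y.
have f0 : f 0 = 0.
  by have := lf (-1) 0 0; rewrite scaler0 addr0 scaleN1r addNr.
have fsum (c : 'I_n -> R) : f (\sum_i c i *: b i) = \sum_i c i *: f (b i).
  by elim/big_rec2: _ => // i u v _ <-; rewrite lf.
have [M fM] := choice (fun i => bV (f (b i))).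
pose A : 'M[R]_n := \matrix_(i, k) M i k.
have fA (c : 'rV_n) : f (\sum_i c 0 i *: b i) = \sum_k (c *m A) 0 k *: b k.
  rewrite fsum; under eq_bigr do rewrite fM scaler_sumr.
  rewrite exchange_big /=; apply: eq_bigr => k _.
  rewrite mxE scaler_suml; apply: eq_bigr => i _.
  by rewrite mxE scalerA.
have Aunit : A \in unitmx.
  rewrite -row_free_unit -kermx_eq0; apply/rowV0P => c /sub_kermxP cA0.
  have : f (\sum_i c 0 i *: b i) = 0.
    by rewrite fA cA0 big1 // => k _; rewrite mxE scale0r.
  by move=> /finj/bfree c0; apply/rowP => i; rewrite c0 mxE.
have [c ->] := bV y.
exists (\sum_i ((\row_k c k) *m invmx A) 0 i *: b i).
by rewrite fA mulmxKV//; apply: eq_bigr => k _; rewrite mxE.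
Qed.

(** The graph is that of [B] on the whole space, and [S] inverts [T = 1 + lam A]: positivity of [A]
    gives [|T x| >= |x|], so [T] is injective, hence surjective by dimension. *)
Lemma commuting_product_ge0_fd (V : lmodType R) (ip : V -> V -> R) (A B : V -> V)
    (d : V) : finite_dimensional V ->
  (forall x y, ip x y = ip y x) -> (forall y, scalar (ip^~ y)) ->
  (forall x, 0 <= ip x x) -> (forall x, ip x x = 0 -> x = 0) ->
  linear A -> linear B -> (forall x, A (B x) = B (A x)) ->
  (forall x y, ip (A x) y = ip x (A y)) ->
  (forall x, 0 <= ip x (A x)) -> (forall x, 0 <= ip x (B x)) ->
  0 <= ip (A d) (B d).
Proof.
move=> fdV ipC ipl ip0 ip_eq0 lA lB AB Asym Apos Bpos.
have ip0l y : ip 0 y = 0.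
  by have := ipl y (-1) 0 0; rewrite scaler0 addr0 => -> /=; lra.
have ipZl a x y : ip (a *: x) y = a * ip x y.
  by rewrite -[a *: x]addr0 (ipl y a x 0) ip0l addr0.
have ipDl x y z : ip (x + y) z = ip x z + ip y z.
  by rewrite -{1}[x]scale1r (ipl z 1 x y) mul1r.
have ipBl x y z : ip (x - y) z = ip x z - ip y z.
  by rewrite ipDl -scaleN1r ipZl mulN1r.
have ipZr a x y : ip x (a *: y) = a * ip x y by rewrite ipC ipZl ipC.
have ipDr x y z : ip x (y + z) = ip x y + ip x z by rewrite ipC ipDl !(ipC x).
have BB x y : B (x - y) = B x - B y.
  by rewrite addrC -scaleN1r lB scaleN1r addrC.
have AZ a x : A (a *: x) = a *: A x.
  have A0 : A 0 = 0.
    by have := lA (-1) 0 0; rewrite scaler0 addr0 scaleN1r addNr.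
  by have := lA a x 0; rewrite A0 !addr0.
apply: (@commuting_product_ge0 R V ip ipC ipBl ip0 V id A B
  [set p | p.2 = B p.1]) => //=.
- by move=> [x y] /= ->; exact: Bpos.
- by move=> [x x'] [y y'] /= -> ->; rewrite BB.
move=> lam lam0; pose T x := x + lam *: A x.
have lT : linear T.
  by move=> a x y; rewrite /T lA scalerDr !scalerDr addrACA !scalerA (mulrC lam).
have ipT x : ip (T x) (T x) =
    ip x x + 2 * lam * ip x (A x) + lam ^+ 2 * ip (A x) (A x).
  rewrite /T ipDl !ipDr !ipZl !ipZr (ipC (A x) x); ring.
have leT x : ip x x <= ip (T x) (T x).
  rewrite ipT; have h1 := mulr_ge0 (ltW lam0) (Apos x).
  have h2 := mulr_ge0 (sqr_ge0 lam) (ip0 (A x)); lra.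
have T0 x : T x = 0 -> x = 0.
  move=> Tx0; apply: ip_eq0; apply/eqP; rewrite eq_le ip0 andbT.
  by have := leT x; rewrite Tx0 ip0l.
have [S TS] := choice (finite_dimensional_surjective fdV lT T0).
have Tinj x y : T x = T y -> x = y.
  move=> e; apply/eqP; rewrite -subr_eq0; apply/eqP/T0.
  by rewrite addrC -scaleN1r lT e scaleN1r addNr.
have Tsym x y : ip (T x) y = ip x (T y).
  by rewrite /T ipDl ipDr ipZl ipZr Asym.
exists S; split.
- by move=> u v; rewrite -{2}(TS u) -{1}(TS v) Tsym.
- by move=> u; rewrite -{3 4}(TS u).
- move=> [x x'] /= ->; apply: Tinj; rewrite TS /T.
  by rewrite AB [RHS]addrC -lB addrC -/(T (S x)) TS.
move=> p v.
have -> : p - S p = lam *: S (A p).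
  apply: Tinj; rewrite [RHS]/T.
  have -> : lam *: S (A p) + lam *: A (lam *: S (A p)) = lam *: T (S (A p)).
    rewrite /T scalerDr; congr (_ + _ *: _).
    exact: AZ.
  rewrite TS addrC -scaleN1r lT TS scaleN1r addrC /T; by rewrite addrAC subrr add0r.
by rewrite ipZl.
Qed.

End FiniteDimension.

(** * Resolvents of non-negative self-adjoint operators *)

Section SelfAdjoint.
Context {R : realType} {V D : lmodType R}.
Variable ip : V -> V -> R.
Hypothesis ipC : forall x y, ip x y = ip y x.
Hypothesis ip_scalar : forall y, scalar (ip^~ y).
Hypothesis ip_ge0 : forall x, 0 <= ip x x.
Hypothesis ip_eq0 : forall x, ip x x = 0 -> x = 0.
Hypothesis ip_complete : forall u : nat -> V,
  (forall e : R, 0 < e -> exists N, forall n m, (N <= n)%N -> (N <= m)%N ->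
     ip (u n - u m) (u n - u m) <= e) ->
  exists x, forall e : R, 0 < e -> exists N, forall n, (N <= n)%N ->
     ip (x - u n) (x - u n) <= e.

Let ip0l y : ip 0 y = 0.
Proof. by have := ip_scalar y (-1) 0 0; rewrite scaler0 addr0 => -> /=; lra. Qed.
Let ipZl a x y : ip (a *: x) y = a * ip x y.
Proof. by rewrite -[a *: x]addr0 (ip_scalar y a x 0) ip0l addr0. Qed.
Let ipDl x y z : ip (x + y) z = ip x z + ip y z.
Proof. by rewrite -{1}[x]scale1r (ip_scalar z 1 x y) mul1r. Qed.
Let ipNl x y : ip (- x) y = - ip x y.
Proof. by rewrite -scaleN1r ipZl mulN1r. Qed.
Let ipBl x y z : ip (x - y) z = ip x z - ip y z.
Proof. by rewrite ipDl ipNl. Qed.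
Let ip0r y : ip y 0 = 0. Proof. by rewrite ipC ip0l. Qed.
Let ipZr a x y : ip x (a *: y) = a * ip x y.
Proof. by rewrite ipC ipZl ipC. Qed.
Let ipDr x y z : ip x (y + z) = ip x y + ip x z.
Proof. by rewrite ipC ipDl !(ipC x). Qed.
Let ipBr x y z : ip x (y - z) = ip x y - ip x z.
Proof. by rewrite ipC ipBl !(ipC x). Qed.

Lemma ip_young s x y : 0 < s -> `|ip x y| <= (ip x x / s + s * ip y y) / 2.
Proof.
move=> s0; have h1 := ip_ge0 (x - s *: y); have h2 := ip_ge0 (x + s *: y).
rewrite !ipBl !ipBr !ipZl !ipZr (ipC y) in h1.
rewrite !ipDl !ipDr !ipZl !ipZr (ipC y) in h2.
rewrite -(ler_pM2l s0) -[X in X * `|_|](gtr0_norm s0) -normrM ler_norml.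
have -> : s * ((ip x x / s + s * ip y y) / 2) = (ip x x + s * (s * ip y y)) / 2.
  by field; rewrite gt_eqF.
by apply/andP; split; lra.
Qed.

(** The form in which approximation enters below: the error is linear in [s], as [eq_of_small]
    expects. *)
Lemma ip_small s x y : 0 < s -> ip x x <= s ^+ 2 ->
  `|ip x y| <= s * ((1 + ip y y) / 2).
Proof.
move=> s0 xs; apply: le_trans (ip_young x y s0) _.
have : ip x x / s <= s by rewrite ler_pdivrMr// -expr2.
by lra.
Qed.

(** Parallelogram identity: the midpoint of two near-minimizers cannot go below [d]. *)
Lemma minimizing_close x a b d e1 e2 :
  d <= ip (x - 2^-1 *: (a + b)) (x - 2^-1 *: (a + b)) ->
  ip (x - a) (x - a) < d + e1 -> ip (x - b) (x - b) < d + e2 ->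
  ip (a - b) (a - b) <= 2 * (e1 + e2).
Proof.
rewrite !ipBl !ipBr !ipZl !ipZr !ipDl !ipDr (ipC a x) (ipC b x) (ipC b a).
by lra.
Qed.

(** Moving by [s *: u] and by [- s *: u] cannot go below [d], so a near-minimizer is nearly
    orthogonal to [u]. *)
Lemma minimizing_pairing a u d s : 0 < s ->
  (forall t, d <= ip (a - t *: u) (a - t *: u)) -> ip a a < d + s ^+ 2 ->
  `|ip a u| <= s * ((1 + ip u u) / 2).
Proof.
move=> s0 dt da.
have H t : 2 * t * ip a u <= s ^+ 2 + t ^+ 2 * ip u u.
  have := dt t; rewrite !ipBl !ipBr !ipZl !ipZr (ipC u a) => dt'.
  by rewrite [t ^+ 2]expr2; lra.
have H1 := H s; have H2 := H (- s); rewrite sqrrN in H2.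
rewrite -(ler_pM2l s0) -[X in X * `|_|](gtr0_norm s0) -normrM ler_norml.
by rewrite expr2 in H1 H2; apply/andP; split; lra.
Qed.

Lemma eq_of_small (a b C : R) : (forall s : R, 0 < s -> `|a - b| <= s * C) -> a = b.
Proof.
move=> H; apply/eqP; rewrite -subr_eq0 -normr_le0 leNgt; apply/negP => ab.
have C1 : 0 < `|C| + 1 by have := normr_ge0 C; lra.
have /H : 0 < `|a - b| / (2 * (`|C| + 1)) by apply: divr_gt0 => //; lra.
apply/negP; rewrite -ltNge.
rewrite mulrAC ltr_pdivrMr; last lra.
by rewrite ltr_pM2l//; have := ler_norm C; lra.
Qed.

Variable io : D -> V.
Hypothesis io_linear : linear io.

(* [Gam] is the graph of a self-adjoint operator having [A], through the      *)
(* dense embedding [io], as its restriction to a core.                        *)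
Definition self_adjoint_graph (A : D -> D) (Gam : set (V * V)) : Prop :=
  [/\ forall d, Gam (io d, io (A d)),
      forall p q, Gam p -> Gam q -> ip p.2 q.1 = ip p.1 q.2,
      forall q, (forall d, ip (io (A d)) q.1 = ip (io d) q.2) -> Gam q &
      forall p (s : R), Gam p -> 0 < s -> exists d,
        ip (p.1 - io d) (p.1 - io d) <= s ^+ 2 /\
        ip (p.2 - io (A d)) (p.2 - io (A d)) <= s ^+ 2].

Section OneOperator.
Variables (A : D -> D) (Gam : set (V * V)).
Hypothesis saA : self_adjoint_graph A Gam.
Hypothesis A_ge0 : forall d, 0 <= ip (io d) (io (A d)).

(** Linearity of the graph is drawn from its maximality, by testing against the core. *)
Lemma graphB p q : Gam p -> Gam q -> Gam (p - q).
Proof.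
move=> Gp Gq; case: saA => GD Gs Gmax _; apply: Gmax => d /=.
by rewrite !ipBr (Gs _ _ (GD d) Gp) (Gs _ _ (GD d) Gq).
Qed.

Lemma graphZ a p : Gam p -> Gam (a *: p).
Proof.
move=> Gp; case: saA => GD Gs Gmax _; apply: Gmax => d /=.
by rewrite !ipZr (Gs _ _ (GD d) Gp).
Qed.

Lemma graphD p q : Gam p -> Gam q -> Gam (p + q).
Proof.
by move=> Gp /(graphZ (-1)); rewrite scaleN1r => /(graphB Gp); rewrite opprK.
Qed.

Lemma graph0 : Gam 0.
Proof. by case: saA => _ _ Gmax _; apply: Gmax => d /=; rewrite !ip0r. Qed.

Lemma graph_closed q : (forall s : R, 0 < s -> exists2 p, Gam p &
    ip (q.1 - p.1) (q.1 - p.1) <= s ^+ 2 /\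
    ip (q.2 - p.2) (q.2 - p.2) <= s ^+ 2) -> Gam q.
Proof.
move=> H; case: saA => GD Gs Gmax _; apply: Gmax => d.
pose C := (1 + ip (io (A d)) (io (A d))) / 2 + (1 + ip (io d) (io d)) / 2.
apply: (@eq_of_small _ _ C) => s s0; have [p Gp [h1 h2]] := H s s0.
have -> : ip (io (A d)) q.1 - ip (io d) q.2 =
    ip (q.1 - p.1) (io (A d)) - ip (q.2 - p.2) (io d).
  by rewrite !ipBl -!(ipC (io _)) (Gs _ _ (GD d) Gp); lra.
apply: le_trans (ler_normB _ _) _; rewrite /C mulrDr.
by apply: lerD; apply: ip_small.
Qed.

(** Positivity passes from the core to its graph closure; [s] is chosen so that the approximation
    errors add up to at most half of [|<x, y>|]. *)
Lemma graph_ge0 p : Gam p -> 0 <= ip p.1 p.2.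
Proof.
move=> Gp; case: saA => _ _ _ Gap; case: p Gp => x y Gp /=.
pose C := (1 + ip y y) / 2 + (1 + ip x x) / 2 + 2.
have C0 : 0 < C by have := ip_ge0 x; have := ip_ge0 y; rewrite /C; lra.
rewrite leNgt; apply/negP => xy0.
pose s := Num.min 1 (- ip x y / (2 * C)).
have s0 : 0 < s by rewrite lt_min ltr01 divr_gt0//; lra.
have s1 : s <= 1 by rewrite ge_min lexx.
have sC : s * C <= - ip x y / 2.
  have : s <= - ip x y / (2 * C) by rewrite ge_min lexx orbT.
  rewrite -(ler_pM2r C0) => /le_trans; apply.
  have -> : - ip x y / (2 * C) * C = - ip x y / 2 by field; rewrite gt_eqF.
  by [].
have [d /= [h1 h2]] := Gap _ _ Gp s0.
have e1 := ip_small y s0 h1; have e2 := ip_small x s0 h2.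
have e3 := ip_small (y - io (A d)) s0 h1.
have := A_ge0 d.
have -> : ip (io d) (io (A d)) = ip x y - ip (x - io d) y - ip (y - io (A d)) x
    + ip (x - io d) (y - io (A d)).
  by rewrite !ipBl !ipBr (ipC y x) (ipC (io (A d)) x); lra.
move: e1 e2 e3; rewrite !ler_norml => /andP[a1 a2] /andP[b1 b2] /andP[c1 c2].
have c3 : s * ((1 + ip (y - io (A d)) (y - io (A d))) / 2) <= s.
  have ss : s ^+ 2 <= 1 by rewrite expr_le1// ltW.
  by rewrite ler_piMr ?(ltW s0)//; lra.
by move: sC; rewrite /C; lra.
Qed.

Variable lam : R.
Hypothesis lam0 : 0 < lam.

(** The cross term [2 lam <x, A x>] is non-negative. Hence both components of a sequence in the
    graph are Cauchy as soon as the values of [1 + lam A] are. *)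
Lemma graph_coercive p : Gam p ->
  ip p.1 p.1 + lam ^+ 2 * ip p.2 p.2 <= ip (p.1 + lam *: p.2) (p.1 + lam *: p.2).
Proof.
move=> /graph_ge0 /(mulr_ge0 (ltW lam0)).
by rewrite !ipDl !ipDr !ipZl !ipZr (ipC p.2 p.1); lra.
Qed.

(** A non-negative operator does not have the eigenvalue [- lam^-1]. *)
Lemma graph_negative_eq0 w : Gam (w, - lam^-1 *: w) -> w = 0.
Proof.
move=> /graph_ge0 /=; rewrite ipZr mulNr oppr_ge0 pmulr_rle0 ?invr_gt0// => w0.
by apply: ip_eq0; apply/eqP; rewrite eq_le w0 ip_ge0.
Qed.

(** The equation [z + lam A z = x] is solved by projecting [x] onto the range of [1 + lam A]. A
    minimizing sequence converges by the parallelogram identity and coercivity. The residual is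
    orthogonal to the range, so self-adjointness makes it an eigenvector for [- lam^-1], hence
    zero. *)
Lemma resolvent_exists x : exists z, Gam (z, lam^-1 *: (x - z)).
Proof.
pose v (p : V * V) := p.1 + lam *: p.2.
pose Q p := ip (x - v p) (x - v p).
have vB p q : v (p - q) = v p - v q.
  by rewrite /v /= scalerBr opprD addrACA.
have vZ a p : v (a *: p) = a *: v p.
  by rewrite /v /= scalerDr !scalerA mulrC.
have vD p q : v (p + q) = v p + v q by rewrite /v /= scalerDr addrACA.
have hinf : has_inf [set Q p | p in Gam].
  by split; [exists (Q 0), 0 => //; exact: graph0|exists 0 => _ [p _ <-]; exact: ip_ge0].
pose d := inf [set Q p | p in Gam].
have dQ p : Gam p -> d <= Q p.
  by move=> Gp; apply: ge_inf; [case: hinf|exists p].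
pose dl (n : nat) : R := n.+1%:R^-1.
have dl0 n : 0 < dl n by rewrite invr_gt0.
have archi (e : R) : 0 < e -> exists N, forall n, (N <= n)%N -> dl n <= e.
  move=> e0; exists (Num.bound e^-1) => n Nn.
  rewrite -[e]invrK lef_pV2 ?posrE ?invr_gt0//.
  have := archi_boundP (ltac:(by rewrite invr_ge0 ltW) : 0 <= e^-1).
  move=> /ltW /le_trans; apply; rewrite ler_nat; exact: leqW.
clearbody dl.
have minseq n : exists p, Gam p /\ Q p < d + dl n.
  by have [_ [p Gp <-] Qp] := inf_adherent (dl0 n) hinf; exists p.
have [p pP] := choice minseq.
have Gp n : Gam (p n) by have [] := pP n.
have vCauchy n m :
    ip (v (p n) - v (p m)) (v (p n) - v (p m)) <= 2 * (dl n + dl m).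
  apply: (@minimizing_close x _ _ d); [|exact: (pP n).2|exact: (pP m).2].
  by rewrite -vD -vZ; apply: dQ; apply: graphZ; apply: graphD.
have Cauchy n m : ip ((p n).1 - (p m).1) ((p n).1 - (p m).1) +
    lam ^+ 2 * ip ((p n).2 - (p m).2) ((p n).2 - (p m).2) <=
    2 * (dl n + dl m).
  apply: le_trans (vCauchy n m); rewrite -vB.
  exact: (graph_coercive (graphB (Gp n) (Gp m))).
have lam2 : 0 < lam ^+ 2 by rewrite exprn_gt0.
have [z zP] : exists z, forall e : R, 0 < e -> exists N, forall n, (N <= n)%N ->
    ip (z - (p n).1) (z - (p n).1) <= e.
  apply: ip_complete => e e0; have e4 : 0 < e / 4 by lra.
  have [N NP] := archi _ e4; exists N => n m /NP hn /NP hm.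
  have := Cauchy n m; have := mulr_ge0 (ltW lam2) (ip_ge0 ((p n).2 - (p m).2)).
  by lra.
have [y yP] : exists y, forall e : R, 0 < e -> exists N, forall n, (N <= n)%N ->
    ip (y - (p n).2) (y - (p n).2) <= e.
  apply: ip_complete => e e0; have e4 : 0 < lam ^+ 2 * e / 4.
    by rewrite divr_gt0 ?mulr_gt0.
  have [N NP] := archi _ e4; exists N => n m /NP hn /NP hm.
  have := Cauchy n m; have := ip_ge0 ((p n).1 - (p m).1) => h1 h2.
  rewrite -(ler_pM2l lam2); apply: (@le_trans _ _ (2 * (dl n + dl m))); lra.
have near (s : R) : 0 < s -> exists n, [/\ dl n <= s ^+ 2,
    ip (z - (p n).1) (z - (p n).1) <= s ^+ 2 &
    ip (y - (p n).2) (y - (p n).2) <= s ^+ 2].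
  move=> s0; have s2 : 0 < s ^+ 2 by rewrite exprn_gt0.
  have [N1 P1] := archi _ s2; have [N2 P2] := zP _ s2; have [N3 P3] := yP _ s2.
  exists (maxn N1 (maxn N2 N3)); split; [apply: P1|apply: P2|apply: P3].
  - exact: leq_maxl.
  - by rewrite !leq_max leqnn !orbT.
  - by rewrite !leq_max leqnn !orbT.
have Gzy : Gam (z, y).
  apply: graph_closed => s s0; have [n [_ h1 h2]] := near s s0.
  by exists (p n).
pose w := x - v (z, y).
have w_ortho q : Gam q -> ip w (v q) = 0.
  move=> Gq; set u := v q.
  pose C := (1 + ip u u) / 2 + (1 + ip u u) / 2 + lam * ((1 + ip u u) / 2).
  apply: (@eq_of_small _ _ C) => s s0; have [n [h0 h1 h2]] := near s s0.
  rewrite subr0.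
  have -> : w = (x - v (p n)) - (z - (p n).1) - lam *: (y - (p n).2).
    rewrite /w /v /= scalerBr !opprD !opprK !addrA.
    rewrite [x - (p n).1 - _ - z]addrAC [x - (p n).1 - z]addrAC.
    rewrite (addrAC (x - z - (p n).1)) subrK.
    by rewrite [X in _ = X](addrAC _ (- (lam *: y))) subrK.
  have hw : `|ip (x - v (p n)) u| <= s * ((1 + ip u u) / 2).
    apply: (@minimizing_pairing _ _ d) => // [t|].
      rewrite -addrA -opprD -vZ -vD; apply: dQ; apply: graphD => //.
      exact: graphZ.
    by apply: lt_le_trans (pP n).2 _; rewrite lerD2l.
  have h3 := ip_small u s0 h1; have h4 := ip_small u s0 h2.
  rewrite !ipBl ipZl; apply: le_trans (ler_normB _ _) _.
  rewrite /C mulrDr; apply: lerD.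
    apply: le_trans (ler_normB _ _) _; rewrite mulrDr.
    by apply: lerD; rewrite -ipBl.
  by rewrite normrM (gtr0_norm lam0) mulrCA ler_pM2l// -ipBl.
have w0 : w = 0.
  apply: graph_negative_eq0; case: saA => GD _ Gmax _; apply: Gmax => e /=.
  have := w_ortho _ (GD e); rewrite /v /= ipDr !ipZr !(ipC w) => h.
  apply: (mulfI (lt0r_neq0 lam0)).
  have -> : lam * (- lam^-1 * ip (io e) w) = - ip (io e) w.
    by field; rewrite lt0r_neq0.
  by lra.
exists z; suff -> : lam^-1 *: (x - z) = y by [].
have -> : x - z = lam *: y.
  by move: w0; rewrite /w /v /= opprD addrA => /eqP; rewrite subr_eq0 => /eqP.
by rewrite scalerA mulVf ?scale1r// lt0r_neq0.
Qed.

Lemma resolvent_unique z z' x :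
  Gam (z, lam^-1 *: (x - z)) -> Gam (z', lam^-1 *: (x - z')) -> z = z'.
Proof.
move=> Gz Gz'; apply/eqP; rewrite -subr_eq0; apply/eqP/graph_negative_eq0.
have := graphB Gz Gz'; congr Gam; congr (_, _) => /=.
by rewrite -scalerBr opprB addrC addrA subrK scaleNr -scalerN opprB.
Qed.

(** The weak form of [(1 + lam A) z = x], tested on the core. *)
Lemma resolvent_core z x d : Gam (z, lam^-1 *: (x - z)) ->
  ip (io (d + lam *: A d)) z = ip (io d) x.
Proof.
move=> Gz; case: saA => GD Gs _ _.
have io0 : io 0 = 0.
  by have := io_linear (-1) 0 0; rewrite scaler0 addr0 scaleN1r addNr.
rewrite addrC io_linear ipDl ipZl.
have /= -> := Gs _ _ (GD d) Gz.
by rewrite ipZr mulrA mulfV ?lt0r_neq0// mul1r ipBr subrK.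
Qed.

(** Solve [(1 + lam A) z = io d] in the graph, then approximate [z] by the core in graph norm; the
    radius [s / (1 + lam)] absorbs the factor [lam] on the second component. *)
Lemma resolvent_dense d s : 0 < s -> exists e,
  ip (io (d - (e + lam *: A e))) (io (d - (e + lam *: A e))) <= s ^+ 2.
Proof.
move=> s0; have [z Gz] := resolvent_exists (io d); case: saA => _ _ _ Gap.
have ioB a b : io (a - b) = io a - io b.
  by rewrite addrC -scaleN1r io_linear scaleN1r addrC.
have ioZ c a : io (c *: a) = c *: io a.
  by have := io_linear c a 0; rewrite addr0 -(subrr 0) ioB subrr addr0.
pose r := s / (1 + lam).
have l1 : 0 < 1 + lam by exact: addr_gt0 ltr01 lam0.
have [e /= [h1 h2]] := Gap _ _ Gz (divr_gt0 s0 l1).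
exists e; set y := lam^-1 *: (io d - z) in h2.
have -> : io (d - (e + lam *: A e)) = (z - io e) + lam *: (y - io (A e)).
  rewrite opprD addrA !ioB ioZ scalerBr /y scalerA mulfV ?lt0r_neq0// scale1r.
  by rewrite addrA; congr (_ - _); rewrite addrC addrA subrK.
have ipE a b : ip (a + lam *: b) (a + lam *: b) =
    ip a a + 2 * (lam * ip a b) + lam * (lam * ip b b).
  by rewrite ipDl !ipDr !ipZl !ipZr (ipC b a); ring.
rewrite ipE; have := ip_young (z - io e) (y - io (A e)) ltr01.
rewrite ler_norml divr1 mul1r => /andP[_].
rewrite -/r in h1 h2; have -> : s ^+ 2 = (1 + lam) * (1 + lam) * r ^+ 2.
  by rewrite /r; field; rewrite lt0r_neq0.
set q := r ^+ 2 in h1 h2 *; clearbody q => h4.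
have h5 : lam * ip (z - io e) (y - io (A e)) <= lam * q.
  by rewrite ler_pM2l//; lra.
have h6 : lam * (lam * ip (y - io (A e)) (y - io (A e))) <= lam * (lam * q).
  by rewrite !ler_pM2l.
lra.
Qed.

End OneOperator.

(** * Commutation through a unitary flow *)

Section StrongCommutation.
Variables (A B H : D -> D) (GA GB : set (V * V)) (J : D -> D) (I : V -> V).
Variables (U : R -> D -> D) (c : R).
Hypothesis saA : self_adjoint_graph A GA.
Hypothesis saB : self_adjoint_graph B GB.
Hypothesis A_ge0 : forall d, 0 <= ip (io d) (io (A d)).
Hypothesis B_ge0 : forall d, 0 <= ip (io d) (io (B d)).
Hypothesis A_J : forall d, A (J d) = J (A d).
Hypothesis H_J : forall d, H (J d) = J (H d).
Hypothesis io_J : forall d, io (J d) = I (io d).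
Hypothesis I_linear : linear I.
Hypothesis I_skew : forall x y, ip (I x) y = - ip x (I y).
Hypothesis U_linear : forall t, linear (U t).
Hypothesis U_isometry : forall t p q,
  ip (io (U t p)) (io (U t q)) = ip (io p) (io q).
Hypothesis U_inv : forall t p, U t (U (- t) p) = p.
Hypothesis A_U : forall t p, A (U t p) = U t (A p).
Hypothesis U_deriv : forall p (s : R), 0 < s -> exists2 r : R, 0 < r &
  forall t, 0 < `|t| < r ->
    ip (io (t^-1 *: (U t p - p) - H p)) (io (t^-1 *: (U t p - p) - H p)) <= s ^+ 2.
Hypothesis BAH : forall d, B d = A d + c *: H (J d).

(** The point is that [S = (1 + lam A)^-1] preserves [GB]. It commutes with [I] and with the flow,
    hence weakly with [H]; as [B = A + c H J], one gets [<B p, S q> = <S p, B q>] on the core.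
    Maximality of [GB] puts [(S q, S B q)] in [GB], and symmetry of [S] extends this to the whole
    graph. *)
Lemma strongly_commuting_product_ge0 d : 0 <= ip (io (A d)) (io (B d)).
Proof.
have ioB a b : io (a - b) = io a - io b.
  by rewrite addrC -scaleN1r io_linear scaleN1r addrC.
have ioZ k a : io (k *: a) = k *: io a.
  by have := io_linear k a 0; rewrite addr0 -(subrr 0) ioB subrr addr0.
have ioD a b : io (a + b) = io a + io b.
  by have := io_linear 1 a b; rewrite !scale1r.
have IB a b : I (a - b) = I a - I b.
  by rewrite addrC -scaleN1r I_linear scaleN1r addrC.
have IZ k a : I (k *: a) = k *: I a.
  by have := I_linear k a 0; rewrite addr0 -(subrr 0) IB subrr addr0.
have GAI p : GA p -> GA (I p.1, I p.2).
  move=> Gp; case: (saA) => GD Gs Gmax _; apply: Gmax => e /=.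
  have := Gs _ _ (GD (J e)) Gp; rewrite /= A_J !io_J !I_skew.
  by move/oppr_inj.
apply: (@commuting_product_ge0 R V ip ipC ipBl ip_ge0 D io A B GB).
- by move=> p q; case: saA => GD Gs _ _; apply: (Gs _ _ (GD p) (GD q)).
- exact: graph_ge0 saB B_ge0.
- exact: graphB saB.
- by case: saB.
move=> lam lam0.
have [S SP] := choice (resolvent_exists saA A_ge0 lam0).
have SE z x : GA (z, lam^-1 *: (x - z)) -> S x = z.
  by move=> /(resolvent_unique saA A_ge0 lam0 (SP x)).
have Ssym u v : ip (S u) v = ip u (S v).
  case: (saA) => _ Gs _ _; have := Gs _ _ (SP u) (SP v).
  rewrite /= ipZl ipZr => /(mulfI (invr_neq0 (lt0r_neq0 lam0))).
  by rewrite ipBl ipBr; lra.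
have Sle u : ip (S u) (S u) <= ip u u.
  have := graph_coercive saA A_ge0 lam0 (SP u).
  rewrite /= scalerA mulfV ?lt0r_neq0// scale1r subrKC; apply: le_trans.
  by rewrite lerDl mulr_ge0 ?sqr_ge0.
have SA p : S (io (A p)) = lam^-1 *: (io p - S (io p)).
  apply: SE; case: (saA) => GD _ _ _.
  by have := graphZ saA lam^-1 (graphB saA (GD p) (SP (io p))).
have SI x : S (I x) = I (S x).
  by apply: SE; have := GAI _ (SP x); rewrite /= IZ IB.
(* [S] commutes with [U t], weakly, hence with its generator [H] *)
have SU t x y : ip (S (io x)) (io (U t y)) = ip (io (U (- t) x)) (S (io y)).
  rewrite Ssym -{1}(U_inv t x).
  set q := U (- t) x; set z := S (io (U t y)).
  pose C := (1 + ip z z) / 2 + (1 + ip (S (io y)) (S (io y))) / 2.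
  apply: (@eq_of_small _ _ C) => s s0.
  have [e he] := resolvent_dense saA A_ge0 lam0 q s0.
  set e' := e + lam *: A e in he.
  have UD a b : U t (a + b) = U t a + U t b.
    by have := U_linear t 1 a b; rewrite !scale1r.
  (* On vectors [(1 + lam A) e] the identity is exact, because [A] commutes with [U t]; density
     gives the rest. *)
  have eU : ip (io (U t e')) z = ip (io e') (S (io y)).
    rewrite /e' addrC U_linear -A_U addrC.
    rewrite (resolvent_core saA lam0 _ (SP (io (U t y)))) U_isometry.
    by rewrite [_ + e]addrC (resolvent_core saA lam0 _ (SP (io y))).
  have -> : ip (io (U t q)) z - ip (io q) (S (io y)) =
      ip (io (U t (q - e'))) z - ip (io (q - e')) (S (io y)).
    have -> : U t (q - e') = U t q - U t e'.
      by rewrite addrC -scaleN1r U_linear scaleN1r addrC.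
    by rewrite !ioB !ipBl eU; lra.
  apply: le_trans (ler_normB _ _) _; rewrite /C mulrDr.
  by apply: lerD; apply: ip_small => //; rewrite U_isometry.
(* The quotients are taken at [t] on one side and at [- t] on the other, since [U (- t)] is the
   adjoint of [U t]. *)
have SH x y : ip (S (io x)) (io (H y)) = - ip (io (H x)) (S (io y)).
  set z := S (io x); set z' := S (io y).
  pose C := (1 + ip z z) / 2 + (1 + ip z' z') / 2.
  apply: (@eq_of_small _ _ C) => s s0.
  have [r1 r10 h1] := U_deriv y s0; have [r2 r20 h2] := U_deriv x s0.
  pose t := Num.min r1 r2 / 2.
  have t0 : 0 < t by rewrite divr_gt0// lt_min r10.
  have tr : t < Num.min r1 r2 by move: t0; rewrite /t; lra.
  have /h1 k1 : 0 < `|t| < r1.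
    by rewrite gtr0_norm// t0 (lt_le_trans tr)// ge_min lexx.
  have /h2 k2 : 0 < `|- t| < r2.
    by rewrite normrN gtr0_norm// t0 (lt_le_trans tr)// ge_min lexx orbT.
  set a := t^-1 *: _ - _ in k1; set b := (- t)^-1 *: _ - _ in k2.
  have -> : ip z (io (H y)) - - ip (io (H x)) z' =
      - ip (io a) z - ip (io b) z'.
    have e0 : ip (io (U t y)) z = ip (io (U (- t) x)) z'.
      by rewrite -SU ipC.
    have e1 : ip (io y) z = ip (io x) z' by rewrite -Ssym ipC.
    rewrite /a /b !ioB !ioZ !ioB !ipBl !ipZl !ipBl e0 e1 invrN (ipC z).
    lra.
  rewrite -opprD normrN; apply: le_trans (ler_normD _ _) _; rewrite /C mulrDr.
  by apply: lerD; apply: ip_small.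
have SB p q : ip (io (B p)) (S (io q)) = ip (S (io p)) (io (B q)).
  rewrite !BAH !ioD !ipDl !ipDr !ioZ !ipZl !ipZr; congr (_ + _ * _).
    rewrite -Ssym SA [RHS]Ssym SA ipZl ipZr ipBl ipBr -Ssym; congr (_ * _); lra.
  by rewrite SH io_J SI -I_skew -io_J H_J.
have GBS d' : GB (S (io d'), S (io (B d'))).
  by case: (saB) => _ _ Gmax _; apply: Gmax => e /=; rewrite SB Ssym.
exists S; split => //.
  move=> p Gp; case: (saB) => _ Gs Gmax _; apply: Gmax => e /=.
  by rewrite -!Ssym; have := Gs _ _ (GBS e) Gp.
by move=> p v; rewrite SA ipZl mulrA mulfV ?lt0r_neq0// mul1r.
Qed.

End StrongCommutation.

End SelfAdjoint.

(** * Complex Hilbert spaces seen as real ones *)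

Definition realification (R : realType) (H : lmodType R[i]) : Type := H.

Section Realification.
Context {R : realType} (H : lmodType R[i]).

HB.instance Definition _ := GRing.Zmodule.on (realification H).

(** Real scalars act through [R[i]]; the alias keeps this structure apart from the complex one on
    [H]. *)
Definition real_scale (a : R) (x : realification H) : realification H :=
  (a%:C)%C *: (x : H).

Lemma real_scaleA a b x : real_scale a (real_scale b x) = real_scale (a * b) x.
Proof. by rewrite /real_scale scalerA rmorphM. Qed.

Lemma real_scale1 : left_id 1 real_scale.
Proof. by move=> x; rewrite /real_scale rmorph1 scale1r. Qed.

Lemma real_scaleDr : right_distributive real_scale +%R.
Proof. by move=> a x y; rewrite /real_scale scalerDr. Qed.

Lemma real_scaleDl x : {morph real_scale^~ x : a b / a + b}.
Proof. by move=> a b; rewrite /real_scale rmorphD scalerDl. Qed.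

HB.instance Definition _ := GRing.Zmodule_isLmodule.Build R (realification H)
  real_scaleA real_scale1 real_scaleDr real_scaleDl.

End Realification.

Section ComplexHilbert.
Context {R : realType} (H : completeNormedModType R[i]) (dot : {dot H for Num.conj}).
Hypothesis norm_dot : forall x : H, `|x| ^+ 2 = dot x x.

Local Notation V := (realification H).
Definition re_dot (x y : V) : R := complex.Re (dot x y).
Definition mul_i (x : V) : V := ('i)%C *: (x : H).

Lemma re_dotC x y : re_dot x y = re_dot y x.
Proof.
rewrite /re_dot (hermC (dot : {hermitian H for false & Num.conj}) x y) /= expr0 mul1r.
by case: (dot y x).
Qed.

Lemma re_dot_scalar y : scalar (re_dot^~ y).
Proof.
move=> a u v; rewrite /re_dot /GRing.scale /= /real_scale.
rewrite linearDl linearZl_LR /=.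
case: (dot u y) => p q; case: (dot v y) => r s /=.
by rewrite mul0r subr0.
Qed.

(** The norm of [H] has values in [R[i]]; being real, it can be estimated in [R]. *)
Lemma norm_re_dot x : re_dot x x = complex.Re `|x : H| ^+ 2 /\
  `|x : H| = ((complex.Re `|x : H|)%:C)%C.
Proof.
have e : `|x : H| = ((complex.Re `|x : H|)%:C)%C.
  by have := normr_ge0 (x : H); rewrite lecE; case: `|x : H| => a b /= /andP[/eqP ->].
split => //; rewrite /re_dot -norm_dot e /= expr2 /= mulr0 subr0.
by rewrite -expr2.
Qed.

Lemma re_dot_ge0 x : 0 <= re_dot x x.
Proof. by have [-> _] := norm_re_dot x; exact: sqr_ge0. Qed.

Lemma re_dot_eq0 x : re_dot x x = 0 -> x = 0.
Proof.
have [-> e] := norm_re_dot x; move=> /eqP; rewrite sqrf_eq0 => /eqP x0.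
by apply/eqP; rewrite -(normr_eq0 (x : H)) e x0.
Qed.

Lemma norm_lt_re_dot x (e : R) : 0 < e -> re_dot x x < e ^+ 2 -> `|x : H| < (e%:C)%C.
Proof.
have [-> ->] := norm_re_dot x; move=> e0; rewrite ltcR.
have x0 : 0 <= complex.Re `|x : H|.
  by have := normr_ge0 (x : H); rewrite lecE => /andP[].
by rewrite ltr_pXn2r ?nnegrE// ltW.
Qed.

Lemma re_dot_le_norm x (e : R) : 0 < e -> `|x : H| < (e%:C)%C -> re_dot x x <= e ^+ 2.
Proof.
have [-> ->] := norm_re_dot x; move=> e0; rewrite ltcR => xe.
have x0 : 0 <= complex.Re `|x : H|.
  by have := normr_ge0 (x : H); rewrite lecE => /andP[].
by rewrite ler_pXn2r ?nnegrE// ltW.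
Qed.

Lemma re_dot_complete (u : nat -> V) :
  (forall e : R, 0 < e -> exists N, forall n m, (N <= n)%N -> (N <= m)%N ->
     re_dot (u n - u m) (u n - u m) <= e) ->
  exists x, forall e : R, 0 < e -> exists N, forall n, (N <= n)%N ->
     re_dot (x - u n) (x - u n) <= e.
Proof.
move=> uC; pose v : nat -> H := u.
have pos_re (e : R[i]) : 0 < e -> 0 < complex.Re e /\ e = ((complex.Re e)%:C)%C.
  by rewrite ltcE; case: e => a b /= /andP[/eqP -> ->].
have : cauchy (v @ \oo).
  apply: cauchy_exP => e /pos_re[e0 ->].
  have e2 : 0 < complex.Re e ^+ 2 / 2 by rewrite divr_gt0// exprn_gt0.
  have [N NP] := uC _ e2; exists (v N).
  exists N => //= n Nn; rewrite -ball_normE /=; apply: norm_lt_re_dot => //.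
  by apply: le_lt_trans (NP N n (leqnn _) Nn) _; lra.
move=> /cauchy_cvg/cvg_ex[x vx]; exists x => e e0.
(* [r <= 1] and [r <= e] give [r ^+ 2 <= e]. *)
pose r := Num.min 1 e.
have r0 : 0 < r by rewrite lt_min ltr01.
have rC : 0 < (r%:C)%C by rewrite ltcR.
have := vx _ (nbhsx_ballx x _ rC).
move=> [N _ NP]; exists N => n Nn.
have := NP n Nn; rewrite -ball_normE /= => /(re_dot_le_norm r0) h.
apply: le_trans h _; apply: (@le_trans _ _ r); last by rewrite ge_min lexx orbT.
by rewrite expr2; apply: ler_piMl; [exact: ltW|rewrite ge_min lexx].
Qed.

Lemma mul_i_linear : linear mul_i.
Proof.
move=> a x y; rewrite /mul_i [a *: x]/(real_scale a x) /real_scale.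
by rewrite [RHS]/(_ *: (_ *: (x : H)) + _) scalerDr !scalerA mulrC.
Qed.

Lemma mul_i_skew x y : re_dot (mul_i x) y = - re_dot x (mul_i y).
Proof.
rewrite /re_dot /mul_i linearZl_LR linearZr_LR /=.
by case: (dot x y) => a b /=; lra.
Qed.

(** The real part, applied also to [i y], recovers the whole product; this brings adjoint relations
    down to real ones. *)
Lemma dotE (x y : H) : dot x y = (re_dot x y +i* re_dot x (mul_i y))%C.
Proof.
rewrite /re_dot /mul_i linearZr_LR /=.
by case: (dot x y) => a b /=; congr (_ +i* _)%C; lra.
Qed.

Lemma closureP (S : set (H * H)) (q : H * H) : closure S q <->
  forall s : R, 0 < s -> exists2 p, S p &
    re_dot (q.1 - p.1) (q.1 - p.1) <= s ^+ 2 /\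
    re_dot (q.2 - p.2) (q.2 - p.2) <= s ^+ 2.
Proof.
split.
  move=> cS s s0.
  have sC : 0 < (s%:C)%C by rewrite ltcR.
  have B : nbhs q (ball q.1 (s%:C)%C `*` ball q.2 (s%:C)%C).
    exists (ball q.1 (s%:C)%C, ball q.2 (s%:C)%C) => //=.
    by split; apply: nbhsx_ballx.
  have [p [Sp [/= p1 p2]]] := cS _ B; exists p => //.
  by split; apply: re_dot_le_norm => //; move: p1 p2; rewrite -ball_normE.
move=> qS B [[B1 B2] /= [/nbhs_ballP[e1 /= e10 h1] /nbhs_ballP[e2 /= e20 h2]] B12].
have pos_re (e : R[i]) : 0 < e -> 0 < complex.Re e /\ e = ((complex.Re e)%:C)%C.
  by rewrite ltcE; case: e => a b /= /andP[/eqP -> ->].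
have [a1 b1] := pos_re _ e10; have [a2 b2] := pos_re _ e20.
pose s := Num.min (complex.Re e1) (complex.Re e2) / 2.
have s0 : 0 < s by rewrite divr_gt0// lt_min a1.
have sl : s < Num.min (complex.Re e1) (complex.Re e2) by move: s0; rewrite /s; lra.
have [p Sp [p1 p2]] := qS s s0; exists p; split => //; apply: B12; split.
  apply: h1; rewrite -ball_normE /= b1; apply: norm_lt_re_dot => //.
  apply: le_lt_trans p1 _; rewrite ltr_pXn2r ?nnegrE ?ltW//.
  by apply: lt_le_trans sl _; rewrite ge_min lexx.
apply: h2; rewrite -ball_normE /= b2; apply: norm_lt_re_dot => //.
apply: le_lt_trans p2 _; rewrite ltr_pXn2r ?nnegrE ?ltW//.
by apply: lt_le_trans sl _; rewrite ge_min lexx orbT.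
Qed.

End ComplexHilbert.

(** * The operators L + i Z and L - i Z on the completion *)

Section EssentiallySelfAdjoint.
Context {R : realType} {g : tvsType R}.
Variable kappa : g -> g -> R.
Hypothesis kappa_bilinear : bilinear_form kappa.
Hypothesis kappaC : forall x y, kappa x y = kappa y x.
Hypothesis kappa_gt0 : forall x, x != 0 -> 0 < kappa x x.

(** The real part of [hermitian_ext]; [pair_i] is multiplication by [i]. *)
Definition pair_dot (p q : (g * g)%type) : R := kappa p.1 q.1 + kappa p.2 q.2.

Definition pair_i (p : (g * g)%type) : (g * g)%type := (- p.2, p.1).

Let kZl a x y : kappa (a *: x) y = a * kappa x y.
Proof.
have [_ kl] := kappa_bilinear.
have k0 : kappa 0 y = 0.
  by have := kl y (-1) 0 0; rewrite scaler0 addr0 => -> /=; lra.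
by have := kl y a x 0; rewrite addr0 k0 addr0.
Qed.
Let kDl x y z : kappa (x + y) z = kappa x z + kappa y z.
Proof. by have [_ kl] := kappa_bilinear; have := kl z 1 x y; rewrite scale1r mul1r. Qed.
Let kNl x y : kappa (- x) y = - kappa x y.
Proof. by rewrite -scaleN1r kZl mulN1r. Qed.
Let kNr x y : kappa x (- y) = - kappa x y.
Proof. by rewrite kappaC kNl kappaC. Qed.
Let kZr a x y : kappa x (a *: y) = a * kappa x y.
Proof. by rewrite kappaC kZl kappaC. Qed.
Let kDr x y z : kappa x (y + z) = kappa x y + kappa x z.
Proof. by rewrite kappaC kDl !(kappaC x). Qed.
Let k_ge0 x : 0 <= kappa x x.
Proof.
have [->|/kappa_gt0/ltW//] := eqVneq x 0.
by have := kZl 0 0 0; rewrite scale0r mul0r => ->.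
Qed.

Lemma pair_dotC p q : pair_dot p q = pair_dot q p.
Proof. by rewrite /pair_dot (kappaC p.1) (kappaC p.2). Qed.

Lemma pair_dot_scalar q : scalar (pair_dot^~ q).
Proof. by move=> a u v; rewrite /pair_dot /= !kDl !kZl; lra. Qed.

Lemma pair_dot_ge0 p : 0 <= pair_dot p p.
Proof. by rewrite addr_ge0. Qed.

Lemma pair_dot_eq0 p : pair_dot p p = 0 -> p = 0.
Proof.
case: p => x y; rewrite /pair_dot /= => h; congr (_, _); apply/eqP.
  apply: contraT => /kappa_gt0; have := k_ge0 y; lra.
apply: contraT => /kappa_gt0; have := k_ge0 x; lra.
Qed.

Section Completion.
Variables (H : completeNormedModType R[i]) (dot : {dot H for Num.conj}).
Variable iota : (g * g)%type -> H.
Hypothesis completion : hilbert_completion kappa dot iota.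
Local Notation ip := (re_dot dot).

Lemma iota_linear : linear (iota : (g * g)%type -> realification H).
Proof.
case: completion => _ iD iZ _ _ a p q.
rewrite iD [RHS]/(real_scale a (iota p) + _) /real_scale -iZ.
by congr (iota _ + _); rewrite /complex_scale /= !scale0r subr0 addr0.
Qed.

Lemma re_dot_iota p q : ip (iota p) (iota q) = pair_dot p q.
Proof. by case: completion => _ _ _ idot _; rewrite /re_dot idot. Qed.

Lemma iota_i p : iota (pair_i p) = mul_i (iota p).
Proof.
case: completion => _ _ iZ _ _; rewrite /mul_i -iZ; congr iota.
by rewrite /complex_scale /pair_i /= !scale0r !scale1r sub0r add0r.
Qed.

(** The sign is there because [C^+] and [C^-] are non-positive; it moves to the second component of
    the graph. As [C] commutes with [i], the adjoint relation for the real part implies the one for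
    the Hermitian product. *)
Lemma essentially_self_adjoint_graph (C : (g * g)%type -> (g * g)%type) :
  (forall d, C (pair_i d) = pair_i (C d)) ->
  essentially_self_adjoint dot iota C ->
  self_adjoint_graph ip (iota : (g * g)%type -> realification H) (fun d => - C d)
    [set q | closure_graph iota C (q.1, - q.2)].
Proof.
move=> C_i esa.
have norm_dot : forall x : H, `|x| ^+ 2 = dot x x by case: completion.
have ipC := re_dotC dot; have ipS := re_dot_scalar dot.
have ip0 := re_dot_ge0 norm_dot.
have ipN x y : ip (- x) y = - ip x y.
  have := ipS y (-1) x 0; rewrite addr0 scaleN1r => ->.
  by have := ipS y (-1) 0 0; rewrite scaler0 addr0 /= => ->; lra.
have ipNr x y : ip x (- y) = - ip x y by rewrite ipC ipN ipC.
have iotaN d : iota (- d) = - iota d.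
  have i0 : iota 0 = 0 :> realification H.
    by have := iota_linear (-1) 0 0; rewrite scaler0 addr0 scaleN1r addNr.
  by have := iota_linear (-1) d 0; rewrite addr0 !scaleN1r i0 addr0.
have ext (q : realification H * realification H) :
    (forall d, ip (iota (C d)) q.1 = ip (iota d) q.2) ->
    forall x, closure_graph iota C x -> ip x.2 q.1 = ip x.1 q.2.
  move=> hq x /(closureP norm_dot) hx.
  pose c := (1 + ip q.1 q.1) / 2 + (1 + ip q.2 q.2) / 2.
  apply: (@eq_of_small _ _ _ c) => s s0; have [_ [d _ <-] /= [h1 h2]] := hx s s0.
  have -> : ip x.2 q.1 - ip x.1 q.2 =
      ip (x.2 - iota (C d)) q.1 - ip (x.1 - iota d) q.2.
    have ipB a b y : ip (a - b) y = ip a y - ip b y.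
      by have := ipS y 1 a (- b); rewrite scale1r ipN mul1r.
    by rewrite !ipB hq; lra.
  apply: le_trans (ler_normB _ _) _; rewrite /c mulrDr.
  by apply: lerD; apply: (ip_small ipC ipS ip0).
split.
- move=> d /=; rewrite iotaN opprK; apply: subset_closure.
  by exists d.
- move=> p q /= Gp; rewrite -{1}esa => Gq; have := Gq _ Gp; rewrite /= => e.
  have : ip (- p.2) q.1 = ip p.1 (- q.2) by rewrite /re_dot e.
  by rewrite ipN ipNr => /oppr_inj.
- move=> q hq /=; rewrite -esa => x Gx.
  have hq1 d : ip (iota (C d)) q.1 = ip (iota d) (- q.2).
    by have := hq d; rewrite iotaN ipN ipNr => <-; rewrite opprK.
  rewrite !dotE /=; congr (_ +i* _)%C; first exact: (ext (q.1, - q.2)).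
  (* The imaginary part is the real relation for [i q]. *)
  apply: (ext (mul_i q.1, mul_i (- q.2))) => // d /=.
  apply: oppr_inj; rewrite -!mul_i_skew -!iota_i -C_i; exact: hq1.
move=> p s /= /(closureP norm_dot) Gp s0; have [_ [d _ <-] /= [h1 h2]] := Gp s s0.
exists d; split => //; rewrite iotaN opprK.
by move: h2; rewrite -opprD ipN ipNr opprK.
Qed.

End Completion.

Lemma finite_dimensional_prod : finite_dimensional g ->
  finite_dimensional (g * g)%type.
Proof.
move=> [n [b bg]].
exists (n + n)%N, (fun i : 'I_(n + n) =>
  match fintype.split i with inl k => (b k, 0) | inr k => (0, b k) end).
move=> [x y]; have [c ->] := bg x; have [d ->] := bg y.
exists (fun i : 'I_(n + n) => match fintype.split i with inl k => c k | inr k => d k end).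
rewrite big_split_ord /=.
under [X in _ = X + _]eq_bigr do rewrite (unsplitK (inl _)).
under [X in _ = _ + X]eq_bigr do rewrite (unsplitK (inr _)).
have e1 : \sum_(i < n) c i *: (b i, 0 : g) = (\sum_(i < n) c i *: b i, 0).
  elim/big_rec2: _ => // i u v _ ->; congr (_, _);
    exact: (etrans (addr0 _) (scaler0 _ _)).
have e2 : \sum_(i < n) d i *: (0 : g, b i) = (0, \sum_(i < n) d i *: b i).
  elim/big_rec2: _ => // i u v _ ->; congr (_, _);
    exact: (etrans (addr0 _) (scaler0 _ _)).
by rewrite e1 e2; congr (_, _); rewrite ?addr0 ?add0r.
Qed.

Variables (L Z : g -> g) (U : R -> g -> g).
Hypothesis L_linear : linear L.
Hypothesis Z_linear : linear Z.
Hypothesis L_sym : forall x y, kappa (L x) y = kappa x (L y).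
Hypothesis Z_skew : forall x y, kappa (Z x) y = - kappa x (Z y).
Hypothesis LZ : forall x, L (Z x) = Z (L x).

Definition opLZ (s : R) (p : (g * g)%type) : (g * g)%type :=
  (L p.1 - s *: Z p.2, L p.2 + s *: Z p.1).

Hypothesis opLZ_le0 : forall s p, s ^+ 2 = 1 -> pair_dot p (opLZ s p) <= 0.
Hypothesis U_linear : forall t, linear (U t).
Hypothesis U_isometry : forall t x y, kappa (U t x) (U t y) = kappa x y.
Hypothesis U_inv : forall t x, U t (U (- t) x) = x.
Hypothesis L_U : forall t x, L (U t x) = U t (L x).
Hypothesis Z_U : forall t x, Z (U t x) = U t (Z x).
Hypothesis U_deriv : forall x (s : R), 0 < s -> exists2 r : R, 0 < r &
  forall t, 0 < `|t| < r -> kappa (t^-1 *: (U t x - x) + Z x)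
    (t^-1 *: (U t x - x) + Z x) <= s ^+ 2.

Let LB a b : L (a - b) = L a - L b.
Proof. by rewrite addrC -scaleN1r L_linear scaleN1r addrC. Qed.
Let ZB a b : Z (a - b) = Z a - Z b.
Proof. by rewrite addrC -scaleN1r Z_linear scaleN1r addrC. Qed.
Let L0 : L 0 = 0. Proof. by rewrite -[X in L X](subrr 0) LB subrr. Qed.
Let Z0 : Z 0 = 0. Proof. by rewrite -[X in Z X](subrr 0) ZB subrr. Qed.
Let LZr a b : L (a *: b) = a *: L b.
Proof. by have := L_linear a b 0; rewrite L0 !addr0. Qed.
Let ZZr a b : Z (a *: b) = a *: Z b.
Proof. by have := Z_linear a b 0; rewrite Z0 !addr0. Qed.
Let LD a b : L (a + b) = L a + L b.
Proof. by have := L_linear 1 a b; rewrite !scale1r. Qed.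
Let ZD a b : Z (a + b) = Z a + Z b.
Proof. by have := Z_linear 1 a b; rewrite !scale1r. Qed.
Let LN a : L (- a) = - L a. Proof. by rewrite -sub0r LB L0 sub0r. Qed.
Let ZN a : Z (- a) = - Z a. Proof. by rewrite -sub0r ZB Z0 sub0r. Qed.
Let UB t a b : U t (a - b) = U t a - U t b.
Proof. by rewrite addrC -scaleN1r U_linear scaleN1r addrC. Qed.
Let U0 t : U t 0 = 0. Proof. by rewrite -[X in U t X](subrr 0) UB subrr. Qed.
Let UZ t a b : U t (a *: b) = a *: U t b.
Proof. by have := U_linear t a b 0; rewrite U0 !addr0. Qed.
Let UD t a b : U t (a + b) = U t a + U t b.
Proof. by have := U_linear t 1 a b; rewrite !scale1r. Qed.

Lemma opLZ_linear s : linear (opLZ s).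
Proof.
move=> a [x1 x2] [y1 y2]; rewrite /opLZ /= !LD !ZD !LZr !ZZr.
by congr (_, _) => /=; rewrite ?scalerBr !scalerDr !scalerA (mulrC s)
  ?opprD addrACA.
Qed.

Lemma opLZ_sym s p q : pair_dot (opLZ s p) q = pair_dot p (opLZ s q).
Proof.
rewrite /pair_dot /opLZ /= !kDl !kDr !kNl !kNr !kZl !kZr !L_sym !Z_skew.
by lra.
Qed.

Lemma opLZC s r p : opLZ s (opLZ r p) = opLZ r (opLZ s p).
Proof.
rewrite /opLZ /= !LD !ZD !LN !ZN !LZr !ZZr !LZ !scalerDr !scalerN !scalerA.
rewrite (mulrC s r); congr (_, _).
  by rewrite !opprD !addrA; congr (_ + _); rewrite addrAC.
by rewrite !addrA; congr (_ + _); rewrite addrAC.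
Qed.

(** At [(x, 0)] the operators [- C^+] and [- C^-] take the values [- (L x, Z x)] and
    [- (L x, - Z x)], whose product is [|L x|^2 - |Z x|^2]. *)
Lemma norm_Z_le_norm_L (x : g) :
  (finite_dimensional g \/
   exists (H : completeNormedModType R[i]) (dot : {dot H for Num.conj})
     (iota : (g * g)%type -> H),
     [/\ hilbert_completion kappa dot iota,
         essentially_self_adjoint dot iota (opLZ 1) &
         essentially_self_adjoint dot iota (opLZ (-1))]) ->
  kappa (Z x) (Z x) <= kappa (L x) (L x).
Proof.
move=> hyp; pose A p := - opLZ 1 p; pose B p := - opLZ (-1) p.
suff : 0 <= pair_dot (A (x, 0)) (B (x, 0)).
  rewrite /pair_dot /A /B /opLZ /= L0 Z0 !scaler0 !add0r !subr0 !kNl !kNr.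
  by rewrite !kZl !kZr; lra.
have dN p q : pair_dot p (- q) = - pair_dot p q.
  by rewrite /pair_dot /= !kNr; lra.
have Asym s p q : pair_dot (- opLZ s p) q = pair_dot p (- opLZ s q).
  by rewrite pair_dotC !dN pair_dotC opLZ_sym.
have A_ge0 s p : s ^+ 2 = 1 -> 0 <= pair_dot p (- opLZ s p).
  by move=> s1; rewrite dN oppr_ge0; exact: opLZ_le0.
have Alin s : linear (fun p => - opLZ s p).
  by move=> a p q; rewrite opLZ_linear opprD scalerN.
have opN s p : opLZ s (- p) = - opLZ s p.
  have op0 : opLZ s 0 = 0 by rewrite /opLZ /= L0 Z0 scaler0 subr0 addr0.
  by have := opLZ_linear s (-1) p 0; rewrite op0 !addr0 !scaleN1r.
case: hyp => [/finite_dimensional_prod fd|[H [dot [iota [comp e1 e2]]]]].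
  apply: (@commuting_product_ge0_fd R (g * g)%type pair_dot A B (x, 0) fd
    pair_dotC pair_dot_scalar pair_dot_ge0 pair_dot_eq0 (Alin 1) (Alin (-1))).
  - by move=> p; rewrite /A /B !opN opLZC.
  - exact: Asym.
  - by move=> p; apply: A_ge0; rewrite expr1n.
  - by move=> p; apply: A_ge0; rewrite sqrrN expr1n.
have norm_dot : forall x : H, `|x| ^+ 2 = dot x x by case: comp.
have op_i s d : opLZ s (pair_i d) = pair_i (opLZ s d).
  rewrite /opLZ /pair_i /= LN ZN scalerN opprD; congr (_, _).
rewrite -(re_dot_iota comp).
(* The flow has generator [H = - Z], and [- C^-] is [- C^+] plus [-2] times [H] after multiplication
   by [i]. *)
apply: (@strongly_commuting_product_ge0 R (realification H) (g * g)%type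
  (re_dot dot) (re_dotC dot) (re_dot_scalar dot) (re_dot_ge0 norm_dot)
  (re_dot_eq0 norm_dot) (re_dot_complete norm_dot) iota (iota_linear comp)
  A B (fun p => (- Z p.1, - Z p.2)) _ _ pair_i (@mul_i R H)
  (fun t p => (U t p.1, U t p.2)) (-2)
  (essentially_self_adjoint_graph comp (op_i 1) e1)
  (essentially_self_adjoint_graph comp (op_i (-1)) e2)).
- by move=> d; rewrite (re_dot_iota comp); apply: A_ge0; rewrite expr1n.
- by move=> d; rewrite (re_dot_iota comp); apply: A_ge0; rewrite sqrrN expr1n.
- by move=> d; rewrite /A op_i /pair_i.
- by move=> d; rewrite /pair_i /= ZN.
- exact: (iota_i comp).
- exact: mul_i_linear.
- exact: mul_i_skew.
- by move=> t a p q /=; congr (_, _); exact: U_linear.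
- by move=> t p q; rewrite !(re_dot_iota comp) /pair_dot /= !U_isometry.
- by move=> t [p1 p2] /=; rewrite !U_inv.
- move=> t [p1 p2]; rewrite /A /opLZ /= !L_U !Z_U -!UZ -UB -UD.
  have UN a : U t (- a) = - U t a by rewrite -sub0r UB U0 sub0r.
  by congr (_, _); rewrite /= UN.
- move=> [p1 p2] s s0; have s2 : 0 < s / 2 by rewrite divr_gt0.
  have [r1 r10 h1] := U_deriv p1 s2; have [r2 r20 h2] := U_deriv p2 s2.
  exists (Num.min r1 r2); first by rewrite lt_min r10.
  move=> t; rewrite lt_min => /andP[t0 /andP[tr1 tr2]].
  have := h1 t; rewrite t0 tr1 => /(_ isT) k1.
  have := h2 t; rewrite t0 tr2 => /(_ isT) k2.
  rewrite (re_dot_iota comp) /pair_dot /= !opprK.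
  have : (s / 2) ^+ 2 <= s ^+ 2 / 2 by rewrite !expr2; nra.
  by lra.
- move=> [p1 p2]; rewrite /A /B /opLZ /pair_i /= ZN opprK.
  have eAB (a b : g) : - (a - -1 *: b) = - (a - 1 *: b) + -2 *: b.
    rewrite scaleN1r opprK scale1r !opprD opprK -addrA; congr (_ + _).
    by rewrite scalerBl scaleN1r scale1r addrA subrr sub0r.
  congr (_, _) => /=; first exact: eAB.
  have := eAB (L p2) (- Z p1).
  by rewrite !scalerN !opprK.
Qed.

End EssentiallySelfAdjoint.

(** * Charts, Lie groups and actions *)

Section Charts.
Context {R : realType}.
Implicit Types (E F : tvsType R) (M N : topologicalType).

Lemma within_open_cvg (T T' : topologicalType) (U : set T) (f : T -> T') x :
  open U -> {within U, continuous f} -> U x -> f @ x --> f x.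
Proof.
by move=> oU; rewrite (continuous_open_subspace f oU) => cf Ux; apply: cf; exact: mem_set.
Qed.

Section OneManifold.
Context {E : tvsType R} {M : topologicalType} (A : atlas E M).
Hypothesis mA : manifold A.

Lemma dom_open p : open (dom A p). Proof. by case: mA => _ /(_ p)[]. Qed.

Lemma dom_center p : dom A p p. Proof. by case: mA => _ /(_ p)[]. Qed.

Lemma cimg_open p : open (cimg A p). Proof. by case: mA => _ /(_ p)[]. Qed.

Lemma cmapK p x : dom A p x -> cinv A p (cmap A p x) = x.
Proof. by case: mA => _ _ + _ _; apply. Qed.

Lemma cimg_cmap p x : dom A p x -> cimg A p (cmap A p x).
Proof. by move=> px; exists x. Qed.

Lemma cimg_center p : cimg A p (cmap A p p).
Proof. exact/cimg_cmap/dom_center. Qed.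

Lemma cinvK p y : cimg A p y -> cmap A p (cinv A p y) = y.
Proof. by move=> [x px <-]; rewrite cmapK. Qed.

Lemma dom_cinv p y : cimg A p y -> dom A p (cinv A p y).
Proof. by move=> [x px <-]; rewrite cmapK. Qed.

Lemma cinv_cvg p y : cimg A p y -> cinv A p @ y --> cinv A p y.
Proof.
case: mA => _ _ _ /(_ p)[_ cp] _; exact: (within_open_cvg (cimg_open p) cp).
Qed.

Lemma near_cinv p y (O : set M) : cimg A p y -> nbhs (cinv A p y) O ->
  \forall z \near y, cimg A p z /\ O (cinv A p z).
Proof.
move=> py O1; apply: filterI; last exact: (cinv_cvg py O1).
by apply: open_nbhs_nbhs; split; [exact: cimg_open|].
Qed.

Lemma chart_image_open p (O : set M) : open O ->
  open (cmap A p @` (dom A p `&` O)).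
Proof.
move=> oO; rewrite openE => _ [x [px Ox] <-].
have : nbhs (cinv A p (cmap A p x)) O.
  by rewrite cmapK//; apply: open_nbhs_nbhs.
move=> /(near_cinv (cimg_cmap px)); apply: filterS => z [pz Oz].
by exists (cinv A p z); [split => //; exact: dom_cinv|exact: cinvK].
Qed.

Hypothesis hE : hausdorff_space E.

Lemma transition_hdiff p q x : dom A p x -> dom A q x ->
  let T := cmap A q \o cinv A p in
  [/\ hdiff T (cmap A p x) (dderive T (cmap A p x)),
      linear (dderive T (cmap A p x)) & continuous (dderive T (cmap A p x))].
Proof.
move=> px qx T; have oV := chart_image_open p (dom_open q).
have CT : class_C 1 (cmap A p @` (dom A p `&` dom A q)) T by case: mA => _ _ _ _ /(_ p q 1%N).
have Vx : (cmap A p @` (dom A p `&` dom A q)) (cmap A p x) by exists x.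
split; first exact: C1_hdiff CT Vx.
- exact: C1_dderive_linear CT Vx.
- exact: C1_dderive_cont CT Vx.
Qed.

(** Tangent vectors at [p] are read in the chart at [p], so the change of chart is the identity near
    the centre. *)
Lemma of_chart_center p X : of_chart A p (cmap A p p) X = X.
Proof.
rewrite /of_chart cmapK; last exact: dom_center.
apply: (hdiff_dderive (df := id)) => //.
apply: hdiff_near (hdiff_id (cmap A p p)).
apply: filterS (open_nbhs_nbhs (conj (cimg_open p) (cimg_center p))) => y py /=.
by rewrite cinvK.
Qed.

Lemma to_chart_center p X : to_chart A p (cmap A p p) X = X.
Proof.
rewrite /to_chart cmapK; last exact: dom_center.
apply: (hdiff_dderive (df := id)) => //.
apply: hdiff_near (hdiff_id (cmap A p p)).
apply: filterS (open_nbhs_nbhs (conj (cimg_open p) (cimg_center p))) => y py /=.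
by rewrite cinvK.
Qed.

Lemma smooth_curve_chart c : smooth_curve A c ->
  exists2 V : set R^o, open V /\ V 0 & smooth_on V (cmap A (c 0) \o c : R^o -> E) /\
    forall t, V t -> dom A (c 0) (c t).
Proof.
move=> [cc /(_ 0)]; rewrite /= => sc.
exists (id @` (setT `&` c @^-1` dom A (c 0))); last first.
  by split => // _ [t [_ ct] <-].
split; last by exists 0 => //; split => //; exact: dom_center.
rewrite image_id setTI; apply: open_comp (dom_open (c 0)) => t _; exact: cc.
Qed.

Lemma smooth_curve_hdiff c : smooth_curve A c ->
  hdiff (cmap A (c 0) \o c : R^o -> E) 0 (fun v => v *: velocity A (c 0) c).
Proof.
move=> /smooth_curve_chart[V [oV V0] [sc _]].
have h := C1_hdiff hE oV (sc 1%N) V0.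
have e v : dderive (cmap A (c 0) \o c : R^o -> E) 0 v = v *: velocity A (c 0) c.
  rewrite -(hdiffZ v (1 : R^o) hE h); congr dderive.
  by rewrite /GRing.scale /= mulr1.
exact: hdiff_ext e h.
Qed.

End OneManifold.

End Charts.

(** * Differentials with linear continuous derivative *)

Section Differentiability.
Context {R : realType}.
Implicit Types E F K : tvsType R.

(** What class C^1 yields at one point, in a form stable under composition and under fixing one
    variable. *)
Definition diff_at E F (f : E -> F) (x : E) : Prop :=
  [/\ hdiff f x (dderive f x), linear (dderive f x) & continuous (dderive f x)].

Lemma diff_at_ext E F (f h : E -> F) x y : f =1 h -> x = y ->
  diff_at f x -> diff_at h y.
Proof. by move=> /funext -> ->. Qed.

Lemma diff_atP E F (f : E -> F) x df : hausdorff_space F -> hdiff f x df ->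
  linear df -> continuous df -> diff_at f x /\ dderive f x = df.
Proof.
move=> hF hf lf cf; have e : dderive f x = df.
  by apply: funext => v; exact: hdiff_dderive.
by split => //; split; rewrite e.
Qed.

Lemma diff_at_smooth E F (V : set E) (f : E -> F) x : hausdorff_space F ->
  open V -> smooth_on V f -> V x -> diff_at f x.
Proof.
move=> hF oV /(_ 1%N) fV Vx; split; first exact: C1_hdiff fV Vx.
- exact: C1_dderive_linear fV Vx.
- exact: C1_dderive_cont fV Vx.
Qed.

Lemma diff_at_comp E F K (f : E -> F) (h : F -> K) x : hausdorff_space K ->
  diff_at f x -> diff_at h (f x) ->
  diff_at (h \o f) x /\ dderive (h \o f) x = dderive h (f x) \o dderive f x.
Proof.
move=> hK [hf lf cf] [hh lh ch]; apply: diff_atP => //; first exact: hdiff_comp hf hh.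
  by move=> a u v /=; rewrite lf lh.
by move=> v; apply: cvg_comp; [exact: cf|exact: ch].
Qed.

Lemma diff_at_near E F (f h : E -> F) x : hausdorff_space F ->
  (\forall y \near x, f y = h y) -> diff_at f x ->
  diff_at h x /\ dderive h x = dderive f x.
Proof.
move=> hF fh [hf lf cf]; apply: diff_atP => //; exact: hdiff_near fh hf.
Qed.

Lemma dderive_near E F (f h : E -> F) x v : hausdorff_space F ->
  (\forall y \near x, f y = h y) -> diff_at f x -> dderive h x v = dderive f x v.
Proof. by move=> hF fh df; have [_ ->] := diff_at_near hF fh df. Qed.

Lemma linear0f E F (f : E -> F) : linear f -> f 0 = 0.
Proof.
by move=> lf; have := lf (-1) 0 0; rewrite scaler0 addr0 scaleN1r addNr.
Qed.

Lemma linearDf E F (f : E -> F) x y : linear f -> f (x + y) = f x + f y.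
Proof. by move=> lf; have := lf 1 x y; rewrite !scale1r. Qed.

Lemma linearZf E F (f : E -> F) a x : linear f -> f (a *: x) = a *: f x.
Proof. by move=> lf; have := lf a x 0; rewrite (linear0f lf) !addr0. Qed.

Lemma linearNf E F (f : E -> F) x : linear f -> f (- x) = - f x.
Proof. by move=> lf; rewrite -scaleN1r (linearZf _ _ lf) scaleN1r. Qed.

Lemma diff_at_partial1 E F K (f : E * F -> K) x y : hausdorff_space K ->
  diff_at f (x, y) -> diff_at (fun z => f (z, y)) x /\
  dderive (fun z => f (z, y)) x = fun v => dderive f (x, y) (v, 0).
Proof.
move=> hK [hf lf cf]; apply: diff_atP => //.
- apply: (hdiff_comp (f := fun z => (z, y)) (df := fun v => (v, 0)) _ hf).
  by apply: hdiff_pair; [exact: hdiff_id|exact: hdiff_cst].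
- move=> a u v; rewrite -lf; congr dderive.
  congr (_, _); exact: (esym (etrans (addr0 _) (scaler0 _ _))).
- move=> v; apply: (@cvg_comp _ _ _ (fun v => (v, 0 : F)) _ _ (nbhs (v, 0 : F))).
    by apply: (@cvg_pair _ _ _ _ (nbhs v) (nbhs (0 : F))); [exact: cvg_id|exact: cvg_cst].
  exact: (cf (v, 0)).
Qed.

Lemma diff_at_partial2 E F K (f : E * F -> K) x y : hausdorff_space K ->
  diff_at f (x, y) -> diff_at (fun z => f (x, z)) y /\
  dderive (fun z => f (x, z)) y = fun v => dderive f (x, y) (0, v).
Proof.
move=> hK [hf lf cf]; apply: diff_atP => //.
- apply: (hdiff_comp (f := fun z => (x, z)) (df := fun v => (0, v)) _ hf).
  by apply: hdiff_pair; [exact: hdiff_cst|exact: hdiff_id].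
- move=> a u v; rewrite -lf; congr dderive.
  congr (_, _); exact: (esym (etrans (addr0 _) (scaler0 _ _))).
- move=> v; apply: (@cvg_comp _ _ _ (fun v => (0 : E, v)) _ _ (nbhs (0 : E, v))).
    by apply: (@cvg_pair _ _ _ _ (nbhs (0 : E)) (nbhs v)); [exact: cvg_cst|exact: cvg_id].
  exact: (cf (0, v)).
Qed.

Lemma class_C2_second E F (V : set E) (f : E -> F) x u : hausdorff_space F ->
  open V -> smooth_on V f -> V x ->
  diff_at (fun p : (E * E)%type => dderive f p.1 p.2) (x, u).
Proof.
move=> hF oV /(_ 2%N)/C2_dderive CD Vx.
have oVT : open (V `*` [set: E]) by exact: open_setXT.
have VTx : (V `*` [set: E]) (x, u) by [].
split; first exact: C1_hdiff CD VTx.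
- exact: C1_dderive_linear CD VTx.
- exact: C1_dderive_cont CD VTx.
Qed.

(** [df(x; u)] is linear and continuous in [u], so its derivative in that slot is itself. *)
Lemma dderive_second_linear E F (V : set E) (f : E -> F) x u v : hausdorff_space F ->
  open V -> smooth_on V f -> V x ->
  dderive (fun p : (E * E)%type => dderive f p.1 p.2) (x, u) (0, v) = dderive f x v.
Proof.
move=> hF oV sV Vx; have dD := class_C2_second u hF oV sV Vx.
have [_ e] := diff_at_partial2 hF dD.
have := congr1 (fun h => h v) e; rewrite /= => <-.
have [_ lf cf] := diff_at_smooth hF oV sV Vx.
exact: (hdiff_dderive v hF (@hdiff_linear _ _ _ (dderive f x) u lf cf)).
Qed.

End Differentiability.

(** * Maps of two variables in charts *)

Section BinaryMaps.
Context {R : realType} {E F K : tvsType R} {M N P : topologicalType}.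
Variables (A : atlas E M) (B : atlas F N) (C : atlas K P) (f : M * N -> P).
Hypotheses (mA : manifold A) (mB : manifold B) (mC : manifold C).
Hypothesis sf : smooth (prod_atlas A B) C f.

(** The target chart is named by a point [r] of its own, so that equations such as [act 1 m = m] can
    select the chart at [m]. *)
Definition local_dom (p : M) (q : N) (r : P) : set (E * F) :=
  [set z | [/\ cimg A p z.1, cimg B q z.2 &
             dom C r (f (cinv A p z.1, cinv B q z.2))]].

Definition local_rep (p : M) (q : N) (r : P) (z : E * F) : K :=
  cmap C r (f (cinv A p z.1, cinv B q z.2)).

Lemma local_dom_open p q r : open (local_dom p q r).
Proof.
rewrite openE => -[x y] [/= px qy rf].
have : nbhs (f (cinv A p x, cinv B q y)) (dom C r).
  by apply: open_nbhs_nbhs; split => //; exact: dom_open.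
case: sf => cf _ rO; have [[W1 W2] /= [w1 w2] W12] := cf (cinv A p x, cinv B q y) _ rO.
exists ([set z | cimg A p z /\ W1 (cinv A p z)],
        [set z | cimg B q z /\ W2 (cinv B q z)]) => /=.
  by split; apply: near_cinv.
by move=> [x' y'] /= [[px' W1x'] [qy' W2y']]; split => //; apply: W12.
Qed.

Lemma local_dom_mem p q r x y : dom A p x -> dom B q y -> dom C r (f (x, y)) ->
  local_dom p q r (cmap A p x, cmap B q y).
Proof. by move=> px qy rf; split; [exists x|exists y|rewrite /= !cmapK]. Qed.

Lemma local_rep_smooth p q r : f (p, q) = r -> smooth_on (local_dom p q r) (local_rep p q r).
Proof.
move=> <-; case: sf => _ /(_ (p, q)); apply: smooth_on_subset => -[x y] [/= px qy rf].
exists (cinv A p x, cinv B q y); last by rewrite /= !cinvK.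
by split => //; split; exact: dom_cinv.
Qed.

End BinaryMaps.

(** * Infinitesimal action, adjoint representation, stabilizers *)

Section Action.
Context {R : realType} {E g : tvsType R} {M : topologicalType} {G : topoGroupType}.
Variables (AM : atlas E M) (AG : atlas g G) (act : G -> M -> M) (expG : g -> G).
Hypotheses (hE : hausdorff_space E) (hg : hausdorff_space g).
Hypotheses (mM : manifold AM) (lie_G : lie_group AG).
Hypothesis exp_expG : exponential_map AG expG.
Hypothesis smooth_act : smooth_action AM AG act.

Local Notation e0 := (cmap AG 1%g 1%g).

Lemma lie_manifold : manifold AG. Proof. by case: lie_G. Qed.
Let mG := lie_manifold.

Lemma act1 n : act 1%g n = n. Proof. by case: smooth_act. Qed.

Lemma actM a b n : act (a * b)%g n = act a (act b n).
Proof. by case: smooth_act. Qed.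

Lemma actK a n : act a n = n -> act (a^-1)%g n = n.
Proof. by move=> an; rewrite -{1}an -actM mulVg act1. Qed.

Let sact : smooth (prod_atlas AG AM) AM (fun p : (G * M)%type => act p.1 p.2).
Proof. by case: smooth_act. Qed.

Let smul : smooth (prod_atlas AG AG) AG (fun p : (G * G)%type => (p.1 * p.2)%g).
Proof. by case: lie_G. Qed.

Lemma act_cvg (T : Type) (F : set_system T) (FF : Filter F) (f : T -> G)
    (h : T -> M) a n : f @ F --> a -> h @ F --> n ->
  (fun t => act (f t) (h t)) @ F --> act a n.
Proof.
move=> fa hn; case: sact => cact _.
apply: (@cvg_comp _ _ _ (fun t => (f t, h t)) (fun p : (G * M)%type => act p.1 p.2)
  _ (nbhs (a, n))); first exact: cvg_pair.
exact: (cact (a, n)).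
Qed.

Lemma mul_cvg (T : Type) (F : set_system T) (FF : Filter F) (f h : T -> G) a b :
  f @ F --> a -> h @ F --> b -> (fun t => (f t * h t)%g) @ F --> (a * b)%g.
Proof.
move=> fa hb; case: smul => cmul _.
apply: (@cvg_comp _ _ _ (fun t => (f t, h t)) (fun p : (G * G)%type => (p.1 * p.2)%g)
  _ (nbhs (a, b))); first exact: cvg_pair.
exact: (cmul (a, b)).
Qed.

Definition act_rep (a : G) (n n' : M) : g * E -> E :=
  local_rep AG AM AM (fun p : (G * M)%type => act p.1 p.2) a n n'.

Definition act_dom (a : G) (n n' : M) : set (g * E) :=
  local_dom AG AM AM (fun p : (G * M)%type => act p.1 p.2) a n n'.

Definition mul_rep (a b c : G) : g * g -> g :=
  local_rep AG AG AG (fun p : (G * G)%type => (p.1 * p.2)%g) a b c.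

Definition mul_dom (a b c : G) : set (g * g) :=
  local_dom AG AG AG (fun p : (G * G)%type => (p.1 * p.2)%g) a b c.

Lemma act_dom_open a n n' : open (act_dom a n n').
Proof. exact: (local_dom_open mG mM mM sact). Qed.

Lemma mul_dom_open a b c : open (mul_dom a b c).
Proof. exact: (local_dom_open mG mG mG smul). Qed.

Lemma act_rep_smooth a n n' : act a n = n' ->
  smooth_on (act_dom a n n') (act_rep a n n').
Proof. by move=> an; apply: (local_rep_smooth mG mM sact). Qed.

Lemma mul_rep_smooth a b c : (a * b)%g = c ->
  smooth_on (mul_dom a b c) (mul_rep a b c).
Proof. by move=> ab; apply: (local_rep_smooth mG mG smul). Qed.

Lemma act_dom_mem a n n' b k : dom AG a b -> dom AM n k -> dom AM n' (act b k) ->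
  act_dom a n n' (cmap AG a b, cmap AM n k).
Proof. exact: (local_dom_mem mG mM). Qed.

Lemma mul_dom_mem a b c a' b' : dom AG a a' -> dom AG b b' ->
  dom AG c (a' * b')%g -> mul_dom a b c (cmap AG a a', cmap AG b b').
Proof. exact: (local_dom_mem mG mG). Qed.

Lemma act_rep_diff a n n' b k : act a n = n' -> dom AG a b -> dom AM n k ->
  dom AM n' (act b k) -> diff_at (act_rep a n n') (cmap AG a b, cmap AM n k).
Proof.
move=> an ab nk nbk; apply: (@diff_at_smooth R (g * E)%type E (act_dom a n n') _ _ hE).
    exact: act_dom_open.
  exact: act_rep_smooth.
exact: act_dom_mem.
Qed.

Lemma mul_rep_diff a b c a' b' : (a * b)%g = c -> dom AG a a' -> dom AG b b' ->
  dom AG c (a' * b')%g -> diff_at (mul_rep a b c) (cmap AG a a', cmap AG b b').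
Proof.
move=> ab aa bb cc; apply: (@diff_at_smooth R (g * g)%type g (mul_dom a b c) _ _ hg).
    exact: mul_dom_open.
  exact: mul_rep_smooth.
exact: mul_dom_mem.
Qed.

Lemma act_diff a n : diff_at (cmap AM (act a n) \o act a \o cinv AM n) (cmap AM n n).
Proof.
have Da := dom_center mG a; have Dn := dom_center mM n.
have [+ _] := diff_at_partial2 hE (act_rep_diff erefl Da Dn (dom_center mM _)).
by apply: diff_at_ext => // x; rewrite /act_rep /local_rep /= cmapK.
Qed.

Definition orbit_map (n : M) (y : g) : E := cmap AM n (act (cinv AG 1%g y) n).

Lemma orbit_map_diff n : diff_at (orbit_map n) e0.
Proof.
have D1 := dom_center mG 1%g; have Dn := dom_center mM n.
have D' : dom AM n (act 1%g n) by rewrite act1.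
have [+ _] := diff_at_partial1 hE (act_rep_diff (act1 n) D1 Dn D').
by apply: diff_at_ext => // x; rewrite /act_rep /local_rep /= cmapK.
Qed.

Lemma expG0 : expG 0 = 1%g.
Proof.
have [_ /(_ 0 0) + _] := exp_expG 0; rewrite !scaler0 => e.
by apply: (mulgI (expG 0)); rewrite mulg1 -e.
Qed.

Lemma expGD xi s t : expG ((s + t) *: xi) = (expG (s *: xi) * expG (t *: xi))%g.
Proof. by have [_ h _] := exp_expG xi. Qed.

Lemma expGN xi t : expG ((- t) *: xi) = ((expG (t *: xi))^-1)%g.
Proof.
by apply: (mulIg (expG (t *: xi))); rewrite mulVg -expGD addNr scale0r expG0.
Qed.

Definition exp_chart (xi : g) (t : R^o) : g := cmap AG 1%g (expG (t *: xi)).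

Lemma exp_chart_hdiff xi : hdiff (exp_chart xi) 0 (fun v => v *: xi).
Proof.
have [sc _ v] := exp_expG xi.
have := smooth_curve_hdiff mG hg sc.
by rewrite /= scale0r expG0 v.
Qed.

Lemma exp_chart0 xi : exp_chart xi 0 = e0.
Proof. by rewrite /exp_chart scale0r expG0. Qed.

Lemma exp_curve_continuous xi : continuous (fun t : R^o => expG (t *: xi)).
Proof. by have [[c _] _ _] := exp_expG xi. Qed.

Lemma near_exp xi (O : set G) : nbhs 1%g O ->
  \forall t \near (0 : R^o), O (expG (t *: xi)).
Proof.
move=> nO.
have : (fun t : R^o => expG (t *: xi)) @ (0 : R^o) --> expG (0 *: xi).
  exact: exp_curve_continuous.
by apply; rewrite scale0r expG0.
Qed.

Lemma nbhs_dom1 : nbhs 1%g (dom AG 1%g).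
Proof. by apply: open_nbhs_nbhs; split; [exact: dom_open|exact: dom_center]. Qed.

(** Chain rule along [t |-> exp (t xi)]. It exhibits [xi |-> xi . n] as a differential, hence as
    linear and continuous. *)
Lemma inf_actE xi n : inf_act AM act expG xi n = dderive (orbit_map n) e0 xi.
Proof.
rewrite /inf_act /velocity /ddt0.
have e : \forall t \near (0 : R^o), (orbit_map n \o exp_chart xi) t =
    cmap AM n (act (expG (t *: xi)) n).
  have := near_exp xi nbhs_dom1; apply: filterS => t Dt.
  by rewrite /orbit_map /exp_chart /= cmapK.
have hY := @exp_chart_hdiff xi.
have [hO _ _] := orbit_map_diff n; rewrite -(exp_chart0 xi) in hO.
have := hdiff_near e (hdiff_comp hY hO).
by move=> /(hdiff_dderive (1 : R^o) hE) ->; rewrite /= scale1r exp_chart0.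
Qed.

Lemma inf_act_linear n : linear ((inf_act AM act expG)^~ n).
Proof.
move=> a x y; rewrite /= !inf_actE; have [_ lin _] := orbit_map_diff n; exact: lin.
Qed.

Lemma inf_act_continuous n : continuous ((inf_act AM act expG)^~ n).
Proof.
have -> : (inf_act AM act expG)^~ n = dderive (orbit_map n) e0.
  by apply: funext => x; exact: inf_actE.
by have [] := orbit_map_diff n.
Qed.

Definition conj_map (a : G) (z : g) : g :=
  cmap AG 1%g (a * cinv AG 1%g z * a^-1)%g.

Definition Ad (a : G) : g -> g := dderive (conj_map a) e0.

Lemma conj_map_center a : conj_map a e0 = e0.
Proof. by rewrite /conj_map cmapK ?mulg1 ?mulgV//; exact: dom_center. Qed.

Lemma near_chart1 (f : G -> G) (O : set G) : {for 1%g, continuous f} ->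
  nbhs (f 1%g) O -> \forall z \near e0, O (f (cinv AG 1%g z)).
Proof.
move=> cf /cf nO.
have h : cinv AG 1%g @ e0 --> cinv AG 1%g e0.
  exact: (cinv_cvg mG (cimg_center mG 1%g)).
apply: (h (f @^-1` O)); rewrite cmapK//; exact: dom_center.
Qed.

(** Since [a] may lie outside the chart at 1, conjugation is split into a left translation into the
    chart at [a] and a right translation back. *)
Lemma conj_map_diff a : diff_at (conj_map a) e0.
Proof.
have D1 := dom_center mG 1%g; have Da := dom_center mG a.
have Dv := dom_center mG (a^-1)%g.
pose lam z := cmap AG a (a * cinv AG 1%g z)%g.
pose rho z := cmap AG 1%g (cinv AG a z * a^-1)%g.
have dl : diff_at lam e0.
  have D' : dom AG a (a * 1)%g by rewrite mulg1.
  have [+ _] := diff_at_partial2 hg (mul_rep_diff (mulg1 a) Da D1 D').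
  by apply: diff_at_ext => // x; rewrite /mul_rep /local_rep /= cmapK.
have dr : diff_at rho (lam e0).
  have D' : dom AG 1%g (a * a^-1)%g by rewrite mulgV.
  have [+ _] := diff_at_partial1 hg (mul_rep_diff (mulgV a) Da Dv D').
  apply: diff_at_ext => [x|]; last by rewrite /lam cmapK ?mulg1.
  by rewrite /mul_rep /local_rep /= cmapK.
have [dc _] := diff_at_comp hg dl dr.
apply: (diff_at_near hg _ dc).1.
have : \forall z \near e0, dom AG a (a * cinv AG 1%g z)%g.
  apply: (near_chart1 (f := fun b => (a * b)%g)).
    by apply: mul_cvg; [exact: cvg_cst|exact: cvg_id].
  by rewrite mulg1; apply: open_nbhs_nbhs; split => //; exact: dom_open.
by apply: filterS => z Dz; rewrite /= /rho /lam cmapK.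
Qed.

Lemma Ad_linear a : linear (Ad a).
Proof. by have [] := conj_map_diff a. Qed.

Lemma near_conj a (O : set G) : nbhs 1%g O ->
  \forall z \near e0, O (a * cinv AG 1%g z * a^-1)%g.
Proof.
move=> O1; apply: (near_chart1 (f := fun b => (a * b * a^-1)%g)).
  apply: mul_cvg; last exact: cvg_cst.
  by apply: mul_cvg; [exact: cvg_cst|exact: cvg_id].
by rewrite mulg1 mulgV.
Qed.

Lemma AdM a b xi : Ad (a * b)%g xi = Ad a (Ad b xi).
Proof.
have db := conj_map_diff b; have da := conj_map_diff a.
rewrite -(conj_map_center b) in da.
have [dab e] := diff_at_comp hg db da.
rewrite /Ad -[X in dderive _ X (dderive _ _ _)](conj_map_center b).
rewrite -[RHS]/((dderive (conj_map a) (conj_map b e0) \o dderive (conj_map b) e0) xi).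
rewrite -e; apply: (dderive_near _ hg) => //.
have := near_conj b nbhs_dom1; apply: filterS => z Dz /=.
by rewrite {1}/conj_map [conj_map b z]/conj_map cmapK// /conj_map invgM !mulgA.
Qed.

Lemma Ad1 xi : Ad 1%g xi = xi.
Proof.
apply: (hdiff_dderive (df := id)) => //.
apply: hdiff_near (hdiff_id e0).
have := open_nbhs_nbhs (conj (cimg_open mG 1%g) (cimg_center mG 1%g)).
by apply: filterS => z cz; rewrite /conj_map mul1g invg1 mulg1 cinvK.
Qed.

Section Stabilizer.
Variable m : M.
Local Notation x0 := (cmap AM m m).
Local Notation V a := (tmap AM AM (act a) m).

Lemma tmap_act_diff a : act a m = m ->
  diff_at (cmap AM m \o act a \o cinv AM m) x0 /\
  V a = dderive (cmap AM m \o act a \o cinv AM m) x0.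
Proof. by move=> am; have := act_diff a m; rewrite /tmap am. Qed.

Lemma tmap_act_linear a : linear (V a).
Proof. by have [] := act_diff a m. Qed.

Lemma tmap_act1 X : V 1%g X = X.
Proof.
have [_ ->] := tmap_act_diff (act1 m).
apply: (hdiff_dderive (df := id)) => //.
apply: hdiff_near (hdiff_id x0).
have := open_nbhs_nbhs (conj (cimg_open mM m) (cimg_center mM m)).
by apply: filterS => z cz; rewrite /= act1 cinvK.
Qed.

Lemma act_rep_center a : act a m = m -> (cmap AM m \o act a \o cinv AM m) x0 = x0.
Proof. by move=> am; rewrite /= cmapK ?am//; exact: dom_center. Qed.

Lemma near_act a : act a m = m ->
  \forall z \near x0, dom AM m (act a (cinv AM m z)).
Proof.
move=> am; have Dm := dom_center mM m.
have : (fun z => act a (cinv AM m z)) @ x0 --> act a m.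
  apply: act_cvg; first exact: cvg_cst.
  by have := cinv_cvg mM (cimg_center mM m); rewrite cmapK.
by apply; rewrite am; apply: open_nbhs_nbhs; split => //; exact: dom_open.
Qed.

Lemma tmap_actM a b X : act a m = m -> act b m = m -> V (a * b)%g X = V a (V b X).
Proof.
move=> am bm; have abm : act (a * b)%g m = m by rewrite actM bm am.
have [da ea] := tmap_act_diff am; have [db eb] := tmap_act_diff bm.
have [_ ->] := tmap_act_diff abm.
rewrite ea eb; rewrite -(act_rep_center bm) in da.
have [dab e] := diff_at_comp hE db da.
rewrite -[X in dderive _ X (dderive _ _ _)](act_rep_center bm).
rewrite -[RHS]/((dderive (cmap AM m \o act a \o cinv AM m)
  ((cmap AM m \o act b \o cinv AM m) x0) \o
  dderive (cmap AM m \o act b \o cinv AM m) x0) X).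
rewrite -e; apply: (dderive_near _ hE) => //.
have := near_act bm; apply: filterS => z Dz.
by rewrite /= cmapK// actM.
Qed.

Lemma orbit_map_center : orbit_map m e0 = x0.
Proof. by rewrite /orbit_map cmapK ?act1//; exact: dom_center. Qed.

(** Differentiate [a (b m) = (a b a^-1) m] in [b] at 1; the identity holds because [a] fixes [m]. *)
Lemma tmap_inf_act a xi : act a m = m ->
  V a (inf_act AM act expG xi m) = inf_act AM act expG (Ad a xi) m.
Proof.
move=> am; have [da ->] := tmap_act_diff am; rewrite !inf_actE.
have dO := orbit_map_diff m; have dC := conj_map_diff a.
rewrite -orbit_map_center in da *.
have [d1 e1] := diff_at_comp hE dO da.
have dO' := dO; rewrite -(conj_map_center a) in dO'.
have [d2 e2] := diff_at_comp hE dC dO'.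
have := congr1 (fun f => f xi) e1; rewrite /= => <-.
have := congr1 (fun f => f xi) e2; rewrite /= conj_map_center => <-.
symmetry; apply: (dderive_near _ hE) => //.
have := near_conj a nbhs_dom1.
have : \forall z \near e0, dom AM m (act (cinv AG 1%g z) m).
  have : (fun z => act (cinv AG 1%g z) m) @ e0 --> act 1%g m.
    apply: act_cvg; last exact: cvg_cst.
    by have := cinv_cvg mG (cimg_center mG 1%g); rewrite cmapK//; exact: dom_center.
  apply; rewrite act1; apply: open_nbhs_nbhs.
  by split; [exact: dom_open|exact: dom_center].
apply: filterS2 => z D1 D2.
rewrite /= /orbit_map cmapK// /conj_map cmapK//.
by rewrite !actM (actK am).
Qed.

End Stabilizer.

Lemma near_exp_local xi (O : set G) : nbhs 1%g O ->
  exists2 r : R, 0 < r & forall t, `|t| < r -> O (expG (t *: xi)).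
Proof.
move=> /(near_exp xi)/nbhs_ballP[r /= r0 rP]; exists r => // t tr; apply: rP.
by rewrite -ball_normE /= sub0r normrN.
Qed.

Section Fixed.
Variable m : M.
Local Notation x0 := (cmap AM m m).

(** At time [t + h] the curve is [exp (t xi)] applied to [exp (h xi) m], so its velocity is the
    image of [xi . m = 0]. *)
Lemma exp_curve_constant xi : inf_act AM act expG xi m = 0 ->
  (forall s : R, 0 <= s <= 1 ->
     dom AG 1%g (expG (s *: xi)) /\ dom AM m (act (expG (s *: xi)) m)) ->
  act (expG xi) m = m.
Proof.
move=> xi0 sD.
pose c (s : R^o) : E := cmap AM m (act (expG (s *: xi)) m).
suff : c 1 = c 0.
  rewrite /c scale1r scale0r expG0 act1 => e.
  have [_ D1] := sD 1 ltac:(lra); rewrite scale1r in D1.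
  by rewrite -(cmapK mM D1) e cmapK//; exact: dom_center.
apply: curve_constant => // t t01.
have [Dt1 Dt2] := sD t t01.
pose psi z := act_rep 1%g m m (exp_chart xi t, z).
have dpsi : diff_at psi (orbit_map m (exp_chart xi 0)).
  rewrite exp_chart0 orbit_map_center.
  by have [] := diff_at_partial2 hE
    (act_rep_diff (act1 m) Dt1 (dom_center mM m) Dt2).
have [hO _ _] := orbit_map_diff m; rewrite -(exp_chart0 xi) in hO.
have [hpsi lpsi _] := dpsi.
have hc := hdiff_comp (hdiff_comp (@exp_chart_hdiff xi) hO) hpsi.
have e : \forall h \near (0 : R^o), (psi \o (orbit_map m \o exp_chart xi)) h = c (t + h).
  have := near_exp xi nbhs_dom1.
  have : \forall h \near (0 : R^o), dom AM m (act (expG (h *: xi)) m).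
    have : (fun h : R^o => act (expG (h *: xi)) m) @ (0 : R^o) --> act 1%g m.
      apply: act_cvg; last exact: cvg_cst.
      by have := @exp_curve_continuous xi 0; rewrite /continuous_at scale0r expG0.
    apply; rewrite act1; apply: open_nbhs_nbhs.
    by split; [exact: dom_open|exact: dom_center].
  apply: filterS2 => h D1 D2.
  rewrite /= /psi /orbit_map /act_rep /local_rep /= /exp_chart !cmapK//.
  by rewrite /c expGD actM.
have := hdiff_line (v := (1 : R^o)) (hdiff_near e hc).
rewrite /= exp_chart0 -inf_actE (linearZf _ _ (@inf_act_linear m)) xi0 scaler0.
rewrite exp_chart0 in lpsi; rewrite (linear0f lpsi); apply: cvg_trans.
by apply: near_eq_cvg; near=> h; rewrite /dquot /= add0r addr0.
Unshelve. all: by end_near. Qed.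

(** Small times are covered by the previous lemma; a general [t] is [N] steps of length [t / N]. *)
Lemma exp_fixes xi t : inf_act AM act expG xi m = 0 -> act (expG (t *: xi)) m = m.
Proof.
move=> xi0.
have [r1 r10 D1] := near_exp_local xi nbhs_dom1.
have nD : nbhs 1%g [set a | dom AM m (act a m)].
  have : (fun a : G => act a m) @ 1%g --> act 1%g m.
    by apply: act_cvg; [exact: cvg_id|exact: cvg_cst].
  apply; rewrite act1; apply: open_nbhs_nbhs.
  by split; [exact: dom_open|exact: dom_center].
have [r2 r20 D2] := near_exp_local xi nD.
have small s : `|s| < Num.min r1 r2 -> act (expG (s *: xi)) m = m.
  rewrite lt_min => /andP[s1 s2]; apply: exp_curve_constant.
    by rewrite (linearZf _ _ (@inf_act_linear m)) xi0 scaler0.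
  move=> u /andP[u0 u1]; rewrite scalerA.
  have us : `|u * s| <= `|s| by rewrite normrM (ger0_norm u0) ler_piMl.
  by split; [apply: D1|apply: D2]; exact: le_lt_trans us _.
have r0 : 0 < Num.min r1 r2 by rewrite lt_min r10.
pose N := (Num.bound (`|t| / Num.min r1 r2)).+1.
have N0 : 0 < N%:R :> R by rewrite ltr0n.
have sN : `|t / N%:R| < Num.min r1 r2.
  rewrite normrM normfV (gtr0_norm N0) ltr_pdivrMr// mulrC -ltr_pdivrMr//.
  apply: lt_trans (archi_boundP _) _; first by rewrite divr_ge0// ltW.
  by rewrite ltr_nat.
have iter k : act (expG ((k%:R * (t / N%:R)) *: xi)) m = m.
  elim: k => [|k IH]; first by rewrite mul0r scale0r expG0 act1.
  by rewrite -natr1 mulrDl mul1r expGD actM small.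
by have := iter N; rewrite mulrCA mulfV ?mulr1// gt_eqF.
Qed.

Variable sigma : g.
Hypothesis sigma0 : inf_act AM act expG sigma m = 0.
Local Notation Phi := (act_rep 1%g m m).
Local Notation DPhi := (fun p : ((g * E) * (g * E))%type => dderive Phi p.1 p.2).
Local Notation V t := (tmap AM AM (act (expG (t *: sigma))) m).

Lemma act_dom_base : act_dom 1%g m m (e0, x0).
Proof.
apply: act_dom_mem; [exact: dom_center lie_manifold _|exact: dom_center|].
by rewrite act1; exact: dom_center.
Qed.

(** For small [t] all [V t] are partial differentials of the one smooth map [Phi], so they can be
    differentiated in [t]. *)
Lemma tmap_exp_near : \forall t \near (0 : R^o), forall X,
  V t X = dderive Phi (exp_chart sigma t, x0) (0, X).
Proof.
have := near_exp sigma nbhs_dom1; apply: filterS => t Dt X.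
have am := exp_fixes t sigma0.
have [_ ->] := tmap_act_diff am.
have Dm : dom AM m (act (expG (t *: sigma)) m) by rewrite am; exact: dom_center.
have [_ e] := diff_at_partial2 hE (act_rep_diff (act1 m) Dt (dom_center mM m) Dm).
have := congr1 (fun h => h X) e; rewrite /= => <-; congr dderive.
by apply: funext => z; rewrite /act_rep /local_rep /= cmapK.
Qed.

(** The argument may vary with [t], as in [V t (j (V (- t) X))]. *)
Lemma tmap_exp_hdiff (X : R^o -> E) dX : hdiff X 0 dX ->
  hdiff (fun t : R^o => V t (X t)) 0
    (fun v => dderive DPhi ((e0, x0), (0, X 0)) ((v *: sigma, 0), (0, dX v))).
Proof.
move=> hX.
have dD := class_C2_second (0, X 0) hE (@act_dom_open 1%g m m)
  (act_rep_smooth (act1 m)) act_dom_base.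
pose c (t : R^o) : (g * E) * (g * E) := ((exp_chart sigma t, x0), (0, X t)).
have hc : hdiff c 0 (fun v => ((v *: sigma, 0), (0, dX v))).
  apply: hdiff_pair; apply: hdiff_pair => //; [|exact: hdiff_cst|exact: hdiff_cst].
  exact: exp_chart_hdiff.
have c0 : c 0 = ((e0, x0), (0, X 0)) by rewrite /c exp_chart0.
have [hD _ _] := dD; rewrite -c0 in hD.
have := hdiff_comp hc hD; rewrite c0; apply: hdiff_near.
have := tmap_exp_near; apply: filterS => t -> //.
Qed.

Lemma isotropy_repE X : isotropy_rep AM act expG m sigma X =
  dderive DPhi ((e0, x0), (0, X)) ((sigma, 0), (0, 0)).
Proof.
have e : dderive (fun t : R^o => V t X) 0 (1 : R^o) =
    dderive DPhi ((e0, x0), (0, X)) ((1 *: sigma, 0), (0, 0)).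
  exact: (hdiff_dderive (1 : R^o) hE (tmap_exp_hdiff (@hdiff_cst R R^o E X 0))).
rewrite scale1r in e; exact: e.
Qed.

(** The fundamental vector field of [sigma] in the chart at [m]; see [field_in_chartE]. *)
Definition field_in_chart (x : E) : E := dderive Phi (e0, x) (sigma, 0).

(** Linearized field and isotropy representation are the same mixed second derivative of the action,
    taken in opposite orders. *)
Lemma field_in_chart_hdiff :
  hdiff field_in_chart x0 (isotropy_rep AM act expG m sigma).
Proof.
have C2 : class_C 2 (act_dom 1%g m m) Phi by exact: (act_rep_smooth (act1 m)).
have := C2_dderive_hdiff (u := (sigma, 0 : E)) hE (@act_dom_open 1%g m m) C2 act_dom_base.
move=> h.
have hx : hdiff (fun x : E => (e0, x)) x0 (fun v => (0, v)).
  by apply: hdiff_pair; [exact: hdiff_cst|exact: hdiff_id].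
have := hdiff_comp (f := fun x : E => (e0, x)) hx h.
apply: hdiff_ext => X; rewrite /= isotropy_repE.
exact: C2_sym hE (@act_dom_open 1%g m m) C2 act_dom_base.
Qed.

Lemma field_in_chartE x : cimg AM m x ->
  inf_act AM act expG sigma (cinv AM m x) = of_chart AM m x (field_in_chart x).
Proof.
move=> mx; set n := cinv AM m x.
have Dn : dom AM m n by exact: dom_cinv.
have [hT lT cT] := transition_hdiff mM hE Dn (dom_center mM n).
set T := cmap AM n \o cinv AM m in hT lT cT.
have ex : cmap AM m n = x by exact: cinvK.
have D1n : dom AM m (act 1%g n) by rewrite act1.
have [] := diff_at_partial1 hE
  (act_rep_diff (act1 m) (dom_center lie_manifold 1%g) Dn D1n).
set h := fun z => Phi (z, cmap AM m n); move=> [hh _ _] eh.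
have ehx : h (exp_chart sigma 0) = cmap AM m n.
  rewrite exp_chart0 /h /act_rep /local_rep /= !cmapK ?act1//.
  exact: dom_center lie_manifold _.
rewrite -(exp_chart0 sigma) in hh.
have := hdiff_comp (hdiff_comp (@exp_chart_hdiff sigma) hh)
  (dg := dderive T (cmap AM m n)) (g := T).
rewrite /= ehx => /(_ hT) hc.
rewrite /inf_act /velocity /ddt0.
have e : \forall t \near (0 : R^o), (T \o (h \o exp_chart sigma)) t =
    cmap AM n (act (expG (t *: sigma)) n).
  have := near_exp sigma nbhs_dom1.
  have : \forall t \near (0 : R^o), dom AM m (act (expG (t *: sigma)) n).
    have : (fun t : R^o => act (expG (t *: sigma)) n) @ (0 : R^o) --> act 1%g n.
      apply: act_cvg; last exact: cvg_cst.
      by have := @exp_curve_continuous sigma 0; rewrite /continuous_at scale0r expG0.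
    by apply; rewrite act1; apply: open_nbhs_nbhs; split; [exact: dom_open|].
  apply: filterS2 => t D1 D2.
  by rewrite /= /T /h /act_rep /local_rep /exp_chart /= !cmapK.
have := hdiff_dderive (1 : R^o) hE (hdiff_near e hc).
rewrite /= scale1r exp_chart0 eh /of_chart /= => ->.
by rewrite /field_in_chart /T ex.
Qed.

End Fixed.

(** * The bracket as the derivative of the adjoint representation *)

Section AdjointDerivative.
Local Notation mu := (mul_rep 1%g 1%g 1%g).
Local Notation Dmu := (fun p : ((g * g) * (g * g))%type => dderive mu p.1 p.2).
Let muV := mul_dom 1%g 1%g 1%g.
Let D1 : dom AG 1%g 1%g := dom_center lie_manifold 1%g.
Let mu_open : open muV := @mul_dom_open 1%g 1%g 1%g.
Let mu_smooth : smooth_on muV mu := mul_rep_smooth (mulg1 1%g).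

Lemma mul_dom_base : muV (e0, e0).
Proof. by apply: mul_dom_mem; rewrite ?mulg1. Qed.

Lemma mul_rep_e0r y : cimg AG 1%g y -> mu (y, e0) = y.
Proof. by move=> cy; rewrite /mul_rep /local_rep /= cmapK// mulg1 cinvK. Qed.

Lemma mul_rep_e0l y : cimg AG 1%g y -> mu (e0, y) = y.
Proof. by move=> cy; rewrite /mul_rep /local_rep /= cmapK// mul1g cinvK. Qed.

Lemma near_cimg x : cimg AG 1%g x -> \forall y \near x, cimg AG 1%g y.
Proof. by move=> cx; apply: open_nbhs_nbhs; split => //; exact: cimg_open. Qed.

Lemma mul_dom_e0r x : cimg AG 1%g x -> muV (x, e0).
Proof. by move=> [a Da <-]; apply: mul_dom_mem => //; rewrite mulg1. Qed.

Lemma mul_dom_e0l x : cimg AG 1%g x -> muV (e0, x).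
Proof. by move=> [a Da <-]; apply: mul_dom_mem => //; rewrite mul1g. Qed.

Lemma mu_diff p : muV p -> diff_at mu p.
Proof. exact: diff_at_smooth hg mu_open mu_smooth. Qed.

Lemma dderive_mul_e0r x xi : cimg AG 1%g x -> dderive mu (x, e0) (xi, 0) = xi.
Proof.
move=> cx; have [_ e] := diff_at_partial1 hg (mu_diff (mul_dom_e0r cx)).
have := congr1 (fun h => h xi) e; rewrite /= => <-.
apply: (hdiff_dderive (df := id)) => //; apply: hdiff_near (hdiff_id x).
by have := near_cimg cx; apply: filterS => y cy; rewrite mul_rep_e0r.
Qed.

Lemma dderive_mul_e0l xi : dderive mu (e0, e0) (0, xi) = xi.
Proof.
have c0 : cimg AG 1%g e0 by exact: cimg_center lie_manifold _.
have [_ e] := diff_at_partial2 hg (mu_diff (mul_dom_e0l c0)).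
have := congr1 (fun h => h xi) e; rewrite /= => <-.
apply: (hdiff_dderive (df := id)) => //; apply: hdiff_near (hdiff_id e0).
by have := near_cimg c0; apply: filterS => y cy; rewrite mul_rep_e0l.
Qed.

Lemma left_invariantE xi x : cimg AG 1%g x ->
  left_invariant AG xi x = dderive mu (x, e0) (0, xi).
Proof.
move=> cx; have [_ e] := diff_at_partial2 hg (mu_diff (mul_dom_e0r cx)).
exact: (congr1 (fun h => h xi) e).
Qed.

Lemma left_invariant_e0 xi : left_invariant AG xi e0 = xi.
Proof.
by rewrite left_invariantE ?dderive_mul_e0l//; exact: cimg_center lie_manifold _.
Qed.

Let D2mu u : diff_at Dmu ((e0, e0), u) :=
  class_C2_second u hg mu_open mu_smooth mul_dom_base.

Lemma dderive_left_invariant xi eta :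
  dderive (left_invariant AG xi) e0 eta = dderive Dmu ((e0, e0), (0, xi)) ((eta, 0), (0, 0)).
Proof.
have [hD _ _] := D2mu (0, xi).
apply: (hdiff_dderive (df := fun v => dderive Dmu ((e0, e0), (0, xi)) ((v, 0), (0, 0)))) => //.
have hx : hdiff (fun x : g => ((x, e0), (0 : g, xi))) e0
    (fun v => ((v, 0 : g), (0 : g, 0 : g))).
  apply: hdiff_pair; last exact: hdiff_cst.
  by apply: hdiff_pair; [exact: hdiff_id|exact: hdiff_cst].
have := hdiff_comp hx hD; apply: hdiff_near.
have := near_cimg (cimg_center lie_manifold 1%g).
by apply: filterS => x cx; rewrite left_invariantE.
Qed.

(** The bracket is the antisymmetrized mixed second derivative of the multiplication. *)
Lemma bracketE xi eta : bracket AG xi eta =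
  dderive Dmu ((e0, e0), (0, eta)) ((xi, 0), (0, 0)) -
  dderive Dmu ((e0, e0), (0, xi)) ((eta, 0), (0, 0)).
Proof. by rewrite /bracket !left_invariant_e0 !dderive_left_invariant. Qed.

(** The slot of [z] is linear. Moving the first factor contributes nothing, as [mu (x, e0) = x] has
    constant differential; moving the second one gives a mixed derivative, rewritten by symmetry. *)
Lemma second_mul_split xi (v w z : g) :
  dderive Dmu ((e0, e0), (xi, 0)) ((v, - w), (z, 0)) =
  z - dderive Dmu ((e0, e0), (0, w)) ((xi, 0), (0, 0)).
Proof.
have [hD lD _] := D2mu (xi, 0).
have c0 : cimg AG 1%g e0 by exact: cimg_center lie_manifold _.
have -> : ((v, - w), (z, 0)) = ((v, 0 : g), (0 : g, 0 : g)) +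
    (((0 : g, 0 : g), (z, 0 : g)) - ((0, w), (0, 0))).
  congr ((_, _), (_, _)); rewrite /= ?(add0r, addr0, subr0, sub0r, oppr0) //.
rewrite (linearDf _ _ lD) (linearDf _ _ lD) (linearNf _ lD).
rewrite (dderive_second_linear _ _ hg mu_open mu_smooth mul_dom_base).
rewrite dderive_mul_e0r//.
have -> : dderive Dmu ((e0, e0), (xi, 0)) ((v, 0), (0, 0)) = 0.
  have hx : hdiff (fun x : g => ((x, e0), (xi, 0 : g))) e0
      (fun v => ((v, 0 : g), (0 : g, 0 : g))).
    apply: hdiff_pair; last exact: hdiff_cst.
    by apply: hdiff_pair; [exact: hdiff_id|exact: hdiff_cst].
  have := hdiff_dderive v hg (hdiff_comp hx hD); rewrite /= => <-.
  apply: (hdiff_dderive (df := fun=> 0)) => //.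
  apply: hdiff_near (hdiff_cst xi e0).
  by have := near_cimg c0; apply: filterS => x cx; rewrite /= dderive_mul_e0r.
rewrite add0r; congr (_ - _).
exact: (C2_sym (x := (e0, e0)) (xi, 0) (0, w) hg mu_open (mu_smooth 2%N) mul_dom_base).
Qed.

(** Near 1 everything is expressed by the single map [mu], which makes [Ad a] differentiable in
    [a]. *)
Lemma Ad_chart a xi : dom AG 1%g a -> dom AG 1%g (a^-1)%g ->
  Ad a xi = dderive mu (cmap AG 1%g a, cmap AG 1%g (a^-1)%g)
    (dderive mu (cmap AG 1%g a, e0) (0, xi), 0).
Proof.
move=> Da Dv; pose f z := mu (cmap AG 1%g a, z).
pose h w := mu (w, cmap AG 1%g (a^-1)%g).
have Vf : muV (cmap AG 1%g a, e0) by apply: mul_dom_mem; rewrite ?mulg1.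
have Vh : muV (cmap AG 1%g a, cmap AG 1%g (a^-1)%g).
  by apply: mul_dom_mem; rewrite ?mulgV.
have [df ef] := diff_at_partial2 hg (mu_diff Vf).
have fe : f e0 = cmap AG 1%g a by apply: mul_rep_e0r; exists a.
have [dh eh] := diff_at_partial1 hg (mu_diff Vh); rewrite -fe in dh.
have [dhf ehf] := diff_at_comp hg df dh.
have <- : dderive (h \o f) e0 xi = Ad a xi.
  symmetry; apply: (dderive_near _ hg) => //.
  have : \forall z \near e0, dom AG 1%g (a * cinv AG 1%g z)%g.
    apply: (near_chart1 (f := fun b => (a * b)%g)).
      by apply: mul_cvg; [exact: cvg_cst|exact: cvg_id].
    by rewrite mulg1; apply: open_nbhs_nbhs; split => //; exact: dom_open lie_manifold _.
  apply: filterS => z Dz.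
  by rewrite /= /h /f /mul_rep /local_rep /= !(cmapK lie_manifold).
have -> : dderive (h \o f) e0 xi = dderive h (f e0) (dderive f e0 xi).
  exact: (congr1 (fun k => k xi) ehf).
have -> : dderive f e0 xi = dderive mu (cmap AG 1%g a, e0) (0, xi).
  exact: (congr1 (fun k => k xi) ef).
by rewrite fe; exact: (congr1 (fun k => k _) eh).
Qed.

(** The factors [exp (t sigma)] and [exp (- t sigma)] of the conjugation contribute the two mixed
    derivatives that make up the bracket. *)
Lemma Ad_exp_hdiff sigma xi :
  hdiff (fun t : R^o => Ad (expG (t *: sigma)) xi) 0
    (fun v => v *: bracket AG sigma xi).
Proof.
pose y := exp_chart sigma.
have hy : hdiff y 0 (fun v => v *: sigma) := @exp_chart_hdiff sigma.
have y0 : y 0 = e0 by exact: exp_chart0.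
have hym : hdiff (fun t : R^o => y (- t) : g) 0 (fun v => - (v *: sigma)).
  have hN : hdiff (fun t : R^o => - t : R^o) 0 (fun v => - v).
    apply: hdiff_linear; last exact: opp_continuous.
    by move=> a u v; rewrite opprD scalerN.
  have hy' : hdiff y (- 0) (fun v => v *: sigma) by rewrite oppr0.
  by have := hdiff_comp hN hy'; apply: hdiff_ext => v; rewrite /= scaleNr.
pose l t := dderive mu (y t, e0) (0, xi).
have l0 : l 0 = xi by rewrite /l y0 dderive_mul_e0l.
have hl : hdiff l 0
    (fun v => dderive Dmu ((e0, e0), (0, xi)) ((v *: sigma, 0), (0, 0))).
  have hc : hdiff (fun t : R^o => ((y t, e0), (0 : g, xi))) 0
      (fun v => ((v *: sigma, 0 : g), (0 : g, 0 : g))).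
    apply: hdiff_pair; last exact: hdiff_cst.
    by apply: hdiff_pair; [|exact: hdiff_cst].
  have [hD _ _] := D2mu (0, xi); rewrite -{1}y0 in hD.
  exact: hdiff_comp hc hD.
have hc : hdiff (fun t : R^o => ((y t, y (- t)), (l t, 0 : g))) 0
    (fun v => ((v *: sigma, - (v *: sigma)),
      (dderive Dmu ((e0, e0), (0, xi)) ((v *: sigma, 0), (0, 0)), 0 : g))).
  by apply: hdiff_pair; apply: hdiff_pair => //; exact: hdiff_cst.
have c0 : ((y 0, y (- 0)), (l 0, 0)) = ((e0, e0), (xi, 0)).
  by rewrite oppr0 y0 l0.
have [hD _ _] := D2mu (xi, 0); rewrite -c0 in hD.
have := hdiff_comp hc hD; rewrite c0 => h.
apply: (@hdiff_ext _ _ _ _ _ (fun v : R^o => v *: bracket AG sigma xi)); first by [].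
apply: hdiff_ext (hdiff_near _ h) => [v|].
  rewrite /= second_mul_split bracketE scalerBr.
  have [_ lD1 _] := D2mu (0, xi); have [_ lD2 _] := D2mu (xi, 0).
  have zZ (u : g) : ((v *: u, 0 : g), (0 : g, 0 : g)) = v *: ((u, 0 : g), (0 : g, 0 : g)).
    by congr ((_, _), (_, _)); rewrite /= scaler0.
  have zZ' (u : g) : ((0 : g, v *: u), (0 : g, 0 : g)) = v *: ((0 : g, u), (0 : g, 0 : g)).
    by congr ((_, _), (_, _)); rewrite /= scaler0.
  have sym u := C2_sym (x := (e0, e0)) (xi, 0) (0, u) hg mu_open (mu_smooth 2%N)
    mul_dom_base.
  rewrite -(sym (v *: sigma)) -(sym sigma) (zZ sigma) (zZ' sigma).
  by rewrite (linearZf _ _ lD1) (linearZf _ _ lD2).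
have := near_exp sigma nbhs_dom1.
have : \forall t \near (0 : R^o), dom AG 1%g (expG ((- t) *: sigma)).
  have := near_exp (- sigma) nbhs_dom1; apply: filterS => t.
  by rewrite scalerN scaleNr.
apply: filterS2 => t Dm Dp.
rewrite (Ad_chart _ Dp) -?expGN//.
Qed.

End AdjointDerivative.

End Action.

(** * The Hessian at a critical point *)

Section CurveLemmas.
Context {R : realType}.
Implicit Types E F : tvsType R.

Lemma hdiff_shift E F (c : E -> F) t df :
  hdiff (fun h => c (t + h)) 0 df -> hdiff c t df.
Proof.
have e : dquot c t = dquot (fun h => c (t + h)) 0.
  by apply: funext => v; apply: funext => h; rewrite /dquot add0r addr0.
by move=> hc v; rewrite e; exact: hc.
Qed.

Lemma mulr_hdiff (a s : R) : hdiff (fun t : R^o => t * a : R^o) s (fun t => t * a).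
Proof.
apply: hdiff_linear => [k u v|x]; first by rewrite mulrDl scalerAl.
apply: (@tvs_cvgZ R R^o _ (nbhs x) _ id (fun=> a)); [exact: cvg_id|exact: cvg_cst].
Qed.

Lemma zero_derivative_constant F (c : R^o -> F) : hausdorff_space F ->
  (forall t, hdiff c t (fun=> 0)) -> forall t, c t = c 0.
Proof.
move=> hF hc t.
pose d (s : R^o) := c (s * t).
have : d 1 = d 0.
  apply: curve_constant => // s _.
  exact: (hdiff_line (v := (1 : R^o)) (hdiff_comp (@mulr_hdiff t s) (hc (s * t)))).
by rewrite /d mul1r mul0r.
Qed.

Lemma hdiff_opp F (c : R^o -> F) dc : hdiff c 0 dc ->
  hdiff (fun t => c (- t)) 0 (fun v => dc (- v)).
Proof.
move=> hc; have hN : hdiff (fun t : R^o => - t : R^o) 0 (fun v => - v).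
  apply: hdiff_linear; last exact: opp_continuous.
  by move=> a u v; rewrite opprD scalerN.
rewrite -[X in hdiff c X]oppr0 in hc.
exact: (hdiff_comp hN hc).
Qed.

End CurveLemmas.

(** * The flow of J m and the operators L and Z *)

Section Symmetry.
Context {R : realType} {E g : tvsType R} {M : topologicalType} {G : topoGroupType}.
Variables (AM : atlas E M) (AG : atlas g G) (act : G -> M -> M) (expG : g -> G).
Hypotheses (hE : hausdorff_space E) (hg : hausdorff_space g).
Hypotheses (mM : manifold AM) (lie_G : lie_group AG).
Hypothesis exp_expG : exponential_map AG expG.
Hypothesis smooth_act : smooth_action AM AG act.
Variables (w : M -> E -> E -> R) (kappa : g -> g -> R) (J : M -> g) (j : M -> E -> E).
Hypothesis symplectic_w : symplectic_form AM w.
Hypothesis symplectic_act : preserves_form AM act w.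
Hypothesis pairing_kappa : pairing kappa.
Hypothesis momentum_J : momentum_map AM act expG w kappa J.
Hypothesis equivariant_J : ad_equivariant AM AG act expG J.
Hypothesis complex_j : almost_complex AM j.
Hypothesis compatible_j : compatible w j.
Variable m : M.

Local Notation x0 := (cmap AM m m).
Local Notation TJ := (tmap AM (tvs_atlas g) J m).
Local Notation inf xi := (inf_act AM act expG xi m).
Local Notation L := (opL AM act expG j J m).
Local Notation Z := (opZ AM act expG J m).
Local Notation wm := (w m).

Let hR : hausdorff_space (R^o : tvsType R).
Proof. exact: (@norm_hausdorff R R^o). Qed.

Lemma wZl a X Y : wm (a *: X) Y = a * wm X Y.
Proof. by case: symplectic_w => /(_ m)[[_ l] _] _ _ _; exact: (linearZf (F := R^o) a X (l Y)). Qed.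
Lemma w0l Y : wm 0 Y = 0.
Proof. by have := wZl 0 0 Y; rewrite scale0r mul0r. Qed.
Lemma wDl X X' Y : wm (X + X') Y = wm X Y + wm X' Y.
Proof. by case: symplectic_w => /(_ m)[[_ l] _] _ _ _; exact: (linearDf (F := R^o) X X' (l Y)). Qed.
Lemma wN X Y : wm X Y = - wm Y X.
Proof. by case: symplectic_w => /(_ m)[_ h] _ _ _; exact: h. Qed.
Lemma wNl X Y : wm (- X) Y = - wm X Y.
Proof. by rewrite -scaleN1r wZl mulN1r. Qed.
Lemma wDr X Y Y' : wm X (Y + Y') = wm X Y + wm X Y'.
Proof. by rewrite wN wDl opprD -!wN. Qed.
Lemma wZr a X Y : wm X (a *: Y) = a * wm X Y.
Proof. by rewrite wN wZl -mulrN -wN. Qed.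
Lemma w0r Y : wm Y 0 = 0. Proof. by rewrite wN w0l oppr0. Qed.
Lemma wNr X Y : wm X (- Y) = - wm X Y.
Proof. by rewrite wN wNl -wN. Qed.
Lemma w_eq0 X : (forall Y, wm X Y = 0) -> X = 0.
Proof. by case: symplectic_w => _ _ _; apply. Qed.

Lemma j_linear : linear (j m). Proof. by case: complex_j. Qed.
Lemma jj X : j m (j m X) = - X. Proof. by case: complex_j => _ /(_ m). Qed.
Lemma wjj X Y : wm (j m X) (j m Y) = wm X Y. Proof. by case: compatible_j => /(_ m). Qed.
Lemma wj_ge0 X : 0 <= wm X (j m X).
Proof.
have [->|X0] := eqVneq X 0; last by apply: ltW; case: compatible_j => _; apply.
by rewrite w0l.
Qed.
Lemma wjC X Y : wm (j m X) Y = - wm X (j m Y).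
Proof. by rewrite -wjj jj wNl. Qed.

Lemma kappaC x y : kappa x y = kappa y x. Proof. by case: pairing_kappa => _ _ + _ _; apply. Qed.
Lemma kappaZl a x y : kappa (a *: x) y = a * kappa x y.
Proof. by case: pairing_kappa => [[_ l] _ _ _ _]; exact: (linearZf (F := R^o) a x (l y)). Qed.
Lemma kappa0l y : kappa 0 y = 0.
Proof. by have := kappaZl 0 0 y; rewrite scale0r mul0r. Qed.
Lemma kappa0r y : kappa y 0 = 0. Proof. by rewrite kappaC kappa0l. Qed.
Lemma kappaDl x x' y : kappa (x + x') y = kappa x y + kappa x' y.
Proof. by case: pairing_kappa => [[_ l] _ _ _ _]; exact: (linearDf (F := R^o) x x' (l y)). Qed.
Lemma kappaNl x y : kappa (- x) y = - kappa x y.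
Proof. by rewrite -scaleN1r kappaZl mulN1r. Qed.
Lemma kappaNr x y : kappa x (- y) = - kappa x y.
Proof. by rewrite kappaC kappaNl kappaC. Qed.
Lemma kappaZr a x y : kappa x (a *: y) = a * kappa x y.
Proof. by rewrite kappaC kappaZl kappaC. Qed.
Lemma kappaDr x y y' : kappa x (y + y') = kappa x y + kappa x y'.
Proof. by rewrite kappaC kappaDl !(kappaC x). Qed.
Lemma kappa_eq0 x : (forall y, kappa x y = 0) -> x = 0.
Proof. by case: pairing_kappa => _ _ _ _; apply. Qed.

Lemma kappa_bilin_hdiff x y :
  hdiff (fun p : g * g => kappa p.1 p.2 : R^o) (x, y) (fun p => kappa x p.2 + kappa p.1 y).
Proof.
case: pairing_kappa => [[lr ll] ck _ _ _].
by apply: (@hdiff_bilinear _ _ _ R^o (fun x y => kappa x y : R^o)).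
Qed.

Lemma kappa_hdiff (c c' : R^o -> g) t dc dc' : hdiff c t dc -> hdiff c' t dc' ->
  hdiff (fun s => kappa (c s) (c' s) : R^o) t
    (fun v => kappa (c t) (dc' v) + kappa (dc v) (c' t)).
Proof.
move=> hc hc'; exact: (hdiff_comp (hdiff_pair hc hc') (@kappa_bilin_hdiff (c t) (c' t))).
Qed.

Lemma momentumE xi X : kappa (TJ X) xi = - wm (inf xi) X.
Proof.
by case: momentum_J => _ /(_ m xi X) h; apply/eqP; rewrite -addr_eq0 addrC h.
Qed.

Lemma momentum_chart_smooth : smooth_on (cimg AM m) (J \o cinv AM m).
Proof.
case: momentum_J => -[_ /(_ m)] + _; apply: smooth_on_subset => _ [x Dx <-].
by exists x.
Qed.

Lemma momentum_diff : diff_at (J \o cinv AM m) x0.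
Proof.
apply: (diff_at_smooth hg (cimg_open mM m) momentum_chart_smooth).
exact: cimg_center.
Qed.

Lemma TJ_linear : linear TJ. Proof. by have [] := momentum_diff. Qed.

Lemma opL_linear : linear L.
Proof.
move=> a x y; rewrite /opL (inf_act_linear hE hg mM lie_G exp_expG smooth_act m).
by rewrite j_linear TJ_linear.
Qed.

Lemma opZ_linear : linear Z.
Proof.
move=> a x y; rewrite /opZ (inf_act_linear hE hg mM lie_G exp_expG smooth_act m).
by rewrite TJ_linear.
Qed.

Lemma opLE xi eta : kappa (L xi) eta = - wm (inf eta) (j m (inf xi)).
Proof. exact: momentumE. Qed.

Lemma opZE xi eta : kappa (Z xi) eta = - wm (inf eta) (inf xi).
Proof. exact: momentumE. Qed.

Lemma opL_sym x y : kappa (L x) y = kappa x (L y).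
Proof.
rewrite (kappaC x) (opLE x y) (opLE y x); congr (- _).
by rewrite -[LHS]wjj jj wNr wN opprK.
Qed.

Lemma opZ_skew x y : kappa (Z x) y = - kappa x (Z y).
Proof. by rewrite (kappaC x) (opZE x y) (opZE y x) opprK wN opprK. Qed.

Lemma opZ_bracket xi : Z xi = - bracket AG (J m) xi.
Proof. by rewrite /opZ equivariant_J /bracket opprB. Qed.

(** The value is [- w (X, j X)] for [X = a + s j b]; with [s ^+ 2 = 1] the term in [b] becomes
    [w (b, j b)]. *)
Lemma opC_le0 s p : s ^+ 2 = 1 -> pair_dot kappa p (opLZ L Z s p) <= 0.
Proof.
move=> s1; set a := inf p.1; set b := inf p.2.
have := wj_ge0 (a + s *: j m b).
rewrite (linearDf _ _ j_linear) (linearZf _ _ j_linear) jj !wDl !wDr !wZl !wZr !wNr.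
rewrite wjj wjC (wN b a) => h.
rewrite /pair_dot /opLZ /= !kappaDr !kappaNr !kappaZr.
have e1 := opLE p.1 p.1; have e2 := opLE p.2 p.2.
have e3 := opZE p.2 p.1; have e4 := opZE p.1 p.2.
rewrite (kappaC p.1 (L _)) (kappaC p.2 (L _)) (kappaC p.1 (Z _)) (kappaC p.2 (Z _)).
rewrite e1 e2 e3 e4 -/a -/b (wN b a).
have : s * (s * wm b (j m b)) = wm b (j m b) by rewrite mulrA -expr2 s1 mul1r.
by move: h; rewrite !mulrN !opprK; lra.
Qed.

Lemma critical_fixed : critical_point AM (norm_sq kappa J) m -> inf (J m) = 0.
Proof.
move=> crit; apply: w_eq0 => X; apply/eqP; rewrite -oppr_eq0 -momentumE; apply/eqP.
have [hJ _ _] := momentum_diff.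
have hk := @kappa_bilin_hdiff ((J \o cinv AM m) x0) ((J \o cinv AM m) x0).
have := hdiff_comp (hdiff_pair hJ hJ) hk => /(hdiff_dderive X hR).
rewrite [LHS](crit X) /= (cmapK mM); last exact: dom_center.
by rewrite kappaC; lra.
Qed.

Hypothesis fixed : inf (J m) = 0.
Local Notation sigma := (J m).
Local Notation a t := (expG (t *: sigma)).
Local Notation U t := (Ad AG (expG (t *: sigma))).
Local Notation V t := (tmap AM AM (act (expG (t *: sigma))) m).

Let am t : act (a t) m = m.
Proof. exact: (exp_fixes hE hg mM lie_G exp_expG smooth_act t fixed). Qed.

Lemma flowD s t x : U (s + t) x = U s (U t x).
Proof. by rewrite (expGD exp_expG) (AdM hg lie_G). Qed.

Lemma flow0 x : U 0 x = x.
Proof. by rewrite scale0r (expG0 exp_expG) (Ad1 hg lie_G). Qed.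

Lemma flow_linear t : linear (U t).
Proof. exact: (Ad_linear hg lie_G). Qed.

Lemma flow_inv t x : U t (U (- t) x) = x.
Proof. by rewrite -flowD subrr flow0. Qed.

(** By equivariance [Z x = [x, J m]], so [Ad (exp (t J m))] has generator [- Z]. *)
Lemma flow_hdiff x : hdiff (fun t : R^o => U t x) 0 (fun v => v *: - Z x).
Proof. by rewrite opZ_bracket opprK; exact: (Ad_exp_hdiff hg lie_G exp_expG). Qed.

(** [Z] is skew, so the derivative vanishes at 0, and at all times by the group law. *)
Lemma flow_isometry t x y : kappa (U t x) (U t y) = kappa x y.
Proof.
have -> : kappa x y = kappa (U 0 x) (U 0 y) by rewrite !flow0.
apply: (zero_derivative_constant (c := fun t => kappa (U t x) (U t y) : R^o) hR) => {t}t.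
apply: hdiff_shift.
have := kappa_hdiff (@flow_hdiff (U t x)) (@flow_hdiff (U t y)).
rewrite !flow0.
have -> : (fun s : R^o => kappa (U s (U t x)) (U s (U t y)) : R^o) =
    (fun s : R^o => kappa (U (t + s) x) (U (t + s) y) : R^o).
  by apply: funext => s; rewrite ![t + s]addrC !flowD.
apply: hdiff_ext => v.
by rewrite kappaZr kappaZl kappaNr kappaNl opZ_skew opprK; lra.
Qed.

Lemma tflowD s t X : V (s + t) X = V s (V t X).
Proof. by rewrite (expGD exp_expG) (tmap_actM hE mM lie_G smooth_act). Qed.

Lemma tflow0 X : V 0 X = X.
Proof. by rewrite scale0r (expG0 exp_expG) (tmap_act1 hE mM lie_G smooth_act). Qed.

Lemma tflow_inv t X : V t (V (- t) X) = X.
Proof. by rewrite -tflowD subrr tflow0. Qed.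

Lemma tflow_linear t : linear (V t).
Proof. exact: (tmap_act_linear hE mM lie_G smooth_act). Qed.

Lemma tflow_inf t xi : V t (inf xi) = inf (U t xi).
Proof. exact: (tmap_inf_act hE hg mM lie_G exp_expG smooth_act xi (am t)). Qed.

Lemma tflow_isometry t X Y : wm (V t X) (V t Y) = wm X Y.
Proof. by have := symplectic_act (a t) m X Y; rewrite am. Qed.

Lemma form_continuous : continuous (fun p : (E * E)%type => wm p.1 p.2 : R^o).
Proof.
case: symplectic_w => _ /(_ m 0%N)[cw _] _ _.
have oV : open (cimg AM m `*` [set: (E * E)%type]).
  by apply: open_setXT; exact: cimg_open.
pose f (z : E * (E * E)) : R^o := form_in_chart AM w m z.1 z.2.1 z.2.2.
have e p : wm p.1 p.2 = f (x0, p).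
  rewrite /f /= /form_in_chart (cmapK mM); last exact: dom_center.
  by rewrite !of_chart_center.
have -> : (fun p : (E * E)%type => wm p.1 p.2 : R^o) = fun p => f (x0, p).
  by apply: funext => p; exact: e.
move=> p; apply: (@cvg_comp _ _ _ (fun p : E * E => (x0, p)) f _ (nbhs (x0, p))).
  by apply: (@cvg_pair _ _ _ (nbhs p) (nbhs x0) (nbhs p)); [exact: cvg_cst|exact: cvg_id].
exact: (within_open_cvg (x := (x0, p)) oV cw (conj (cimg_center mM m) I)).
Qed.

Lemma form_hdiff (c c' : R^o -> E) t dc dc' : hdiff c t dc -> hdiff c' t dc' ->
  hdiff (fun s => wm (c s) (c' s) : R^o) t
    (fun v => wm (c t) (dc' v) + wm (dc v) (c' t)).
Proof.
move=> hc hc'; have := hdiff_comp (hdiff_pair hc hc').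
move=> /(_ R^o (fun p => wm p.1 p.2 : R^o) (fun p => wm (c t) p.2 + wm p.1 (c' t))).
apply; apply: (@hdiff_bilinear _ _ _ R^o (fun x y => wm x y : R^o)).
- by move=> X k Y Y'; rewrite wDr wZr.
- by move=> X k Y Y'; rewrite wDl wZl.
- exact: form_continuous.
Qed.

Lemma j_continuous : continuous (j m).
Proof.
case: complex_j => _ _ /(_ m 0%N)[cj _].
have oV : open (cimg AM m `*` [set: E]) by apply: open_setXT; exact: cimg_open.
pose f (z : E * E) : E := to_chart AM m z.1 (j (cinv AM m z.1) (of_chart AM m z.1 z.2)).
have -> : j m = fun X => f (x0, X).
  apply: funext => X; rewrite /f /= to_chart_center// of_chart_center//.
  by rewrite (cmapK mM)//; exact: dom_center.
move=> X; apply: (@cvg_comp _ _ _ (fun Y : E => (x0, Y)) f _ (nbhs (x0, X))).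
  by apply: (@cvg_pair _ _ _ (nbhs X) (nbhs x0) (nbhs X)); [exact: cvg_cst|exact: cvg_id].
exact: (within_open_cvg (x := (x0, X)) oV cj (conj (cimg_center mM m) I)).
Qed.

Lemma j_hdiff (c : R^o -> E) t dc : hdiff c t dc ->
  hdiff (fun s => j m (c s)) t (fun v => j m (dc v)).
Proof.
move=> hc; apply: (hdiff_comp hc (dg := j m) (g := j m)).
by apply: hdiff_linear; [exact: j_linear|exact: j_continuous].
Qed.

Hypothesis invariant_j : invariant_at AM act expG j m.

Lemma conjugate_j_hdiff X : hdiff (fun t : R^o => V t (j m (V (- t) X))) 0 (fun=> 0).
Proof.
have hV := tmap_exp_hdiff hE hg mM lie_G exp_expG smooth_act fixed (@hdiff_cst R R^o E X 0).
(* [ddt0] defaults to 0 where no derivative exists, so differentiability is established before the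
   invariance of [j] is used. *)
have [d hd] : exists d, hdiff (fun t : R^o => V t (j m (V (- t) X))) 0 d.
  eexists; exact: (tmap_exp_hdiff hE hg mM lie_G exp_expG smooth_act fixed
    (j_hdiff (hdiff_opp hV))).
suff d0 : d = fun=> 0 by rewrite d0 in hd.
have hd' : hdiff (fun t : R^o => tau AM act j (a t) m X) 0 d.
  have := hdiffD hd (@hdiff_cst R R^o E (- j m X) 0).
  move=> h; have h' : hdiff (fun t : R^o => V t (j m (V (- t) X)) + - j m X) 0 d.
    by apply: hdiff_ext h => v; rewrite addr0.
  apply: hdiff_near h'; apply: filterE => s.
  by rewrite /tau -(expGN exp_expG) (am (- s)).
have := invariant_j fixed X; rewrite /tau' /ddt0 => e.
have d1 : d 1 = 0 by rewrite -e; symmetry; exact: (hdiff_dderive (1 : R^o) hE hd').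
apply: funext => v; have -> : v = v *: (1 : R^o) by rewrite /GRing.scale /= mulr1.
by rewrite (hdiffZ _ _ hE hd) d1 scaler0.
Qed.

Lemma tflow_j t X : V t (j m X) = j m (V t X).
Proof.
(* [wm (j (V t Y)) (V t Y')] has zero derivative at 0 by invariance of [j], and *)
(* at all times by the group property of [V].                                   *)
have form_const Y Y' : wm (j m (V t Y)) (V t Y') = wm (j m Y) Y'.
  have -> : wm (j m Y) Y' = wm (j m (V 0 Y)) (V 0 Y') by rewrite !tflow0.
  apply: (zero_derivative_constant (c := fun t => wm (j m (V t Y)) (V t Y') : R^o) hR) => {}t.
  apply: hdiff_shift.
  have h := hdiff_opp (form_hdiff (@conjugate_j_hdiff (V t Y)) (@hdiff_cst R R^o E (V t Y') 0)).
  have h' := hdiff_ext (dg := fun=> 0) _ h.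
  apply: hdiff_near (h' _) => [|v]; last by rewrite /= w0r w0l addr0.
  apply: filterE => s; rewrite /= opprK addrC !tflowD.
  by rewrite -[RHS](tflow_isometry (- s)) -(tflowD (- s) s) addNr tflow0.
apply/eqP; rewrite -subr_eq0; apply/eqP/w_eq0 => Y.
by rewrite -(tflow_inv t Y) wDl wNl tflow_isometry form_const subrr.
Qed.

Let kappa_ext x y : (forall z, kappa x z = kappa y z) -> x = y.
Proof.
move=> h; apply/eqP; rewrite -subr_eq0; apply/eqP/kappa_eq0 => z.
by rewrite kappaDl kappaNl h subrr.
Qed.

(** [kappa (L x, y)] is expressed by [w], [j] and the infinitesimal action, all of which the flow
    respects. *)
Lemma opL_flow t x : L (U t x) = U t (L x).
Proof.
apply: kappa_ext => y; rewrite -(flow_inv t y); set y' := U _ y.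
by rewrite flow_isometry !opLE -!tflow_inf -tflow_j tflow_isometry.
Qed.

Lemma opZ_flow t x : Z (U t x) = U t (Z x).
Proof.
apply: kappa_ext => y; rewrite -(flow_inv t y); set y' := U _ y.
by rewrite flow_isometry !opZE -!tflow_inf tflow_isometry.
Qed.

(** Differentiate [<U t (L x), y> = <U t x, L y>] at 0: symmetry moves [L] to a fixed vector, so
    only the flow is differentiated. *)
Lemma opLZ_commute x : L (Z x) = Z (L x).
Proof.
apply: kappa_ext => y.
have h1 := kappa_hdiff (@flow_hdiff (L x)) (@hdiff_cst R R^o g y 0).
have h2 := kappa_hdiff (@flow_hdiff x) (@hdiff_cst R R^o g (L y) 0).
have e : (fun s : R^o => kappa (U s (L x)) y : R^o) = (fun s : R^o => kappa (U s x) (L y) : R^o).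
  by apply: funext => s; rewrite -opL_flow opL_sym.
rewrite e in h1.
have := hdiff_dderive (1 : R^o) hR h1; rewrite (hdiff_dderive (1 : R^o) hR h2).
rewrite (kappa0r (U 0 x)) (kappa0r (U 0 (L x))) !add0r !scale1r.
rewrite (kappaNl (Z x)) (kappaNl (Z (L x))) (opL_sym (Z x) y).
by lra.
Qed.

(** Continuity of [kappa] converts convergence in [g] into convergence in its norm. *)
Lemma flow_deriv x (s : R) : 0 < s -> exists2 r : R, 0 < r &
  forall t, 0 < `|t| < r -> kappa (t^-1 *: (U t x - x) + Z x)
    (t^-1 *: (U t x - x) + Z x) <= s ^+ 2.
Proof.
move=> s0.
have h := hdiff_line (v := (1 : R^o)) (@flow_hdiff x).
have lim : (fun t : R => kappa (dquot (fun t : R^o => U t x) 0 (1 : R^o) t + Z x)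
    (dquot (fun t : R^o => U t x) 0 (1 : R^o) t + Z x) : R^o) @ (0 : R)^' --> (0 : R^o).
  have hq : (fun t : R => dquot (fun t : R^o => U t x) 0 (1 : R^o) t + Z x) @ (0 : R)^' --> (0 : g).
    rewrite -[X in _ --> X](addNr (Z x)).
    by apply: tvs_cvgD; [rewrite scale1r in h; exact: h|exact: cvg_cst].
  have k0 := kappa0l 0.
  case: (pairing_kappa) => _ ck _ _ _.
  have := ck (0, 0); rewrite /continuous_at /= k0 => ck0.
  apply: (@cvg_comp _ _ _ (fun t : R => (dquot (fun t : R^o => U t x) 0 (1 : R^o) t + Z x,
    dquot (fun t : R^o => U t x) 0 (1 : R^o) t + Z x)) _ _ (nbhs (0 : g, 0 : g)) _ _ ck0).
  exact: (@cvg_pair _ _ _ _ (nbhs (0 : g)) (nbhs (0 : g))).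
have s2 : 0 < s ^+ 2 by rewrite exprn_gt0.
have := lim _ (nbhsx_ballx (0 : R^o) _ s2) => /cvg_punctured0[r r0 rP].
exists r => // t /andP[t0 tr].
have := rP t tr; rewrite -normr_gt0 => /(_ t0).
rewrite /= -ball_normE /= sub0r normrN => /ltW/(le_trans (ler_norm _)).
by rewrite /dquot /= add0r flow0 /GRing.scale /= mulr1.
Qed.

Lemma norm_opZ_le_opL x :
  (finite_dimensional g \/
   exists (H : completeNormedModType R[i]) (dot : {dot H for Num.conj})
     (iota : (g * g)%type -> H),
     [/\ hilbert_completion kappa dot iota,
         essentially_self_adjoint dot iota (opC AM act expG 1 j J m) &
         essentially_self_adjoint dot iota (opC AM act expG (-1) j J m)]) ->
  kappa (Z x) (Z x) <= kappa (L x) (L x).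
Proof.
case: (pairing_kappa) => bk _ _ k_gt0 _.
apply: (norm_Z_le_norm_L bk kappaC k_gt0 (U := fun t => U t)).
- exact: opL_linear.
- exact: opZ_linear.
- exact: opL_sym.
- exact: opZ_skew.
- exact: opLZ_commute.
- exact: opC_le0.
- exact: flow_linear.
- exact: flow_isometry.
- exact: flow_inv.
- exact: opL_flow.
- exact: opZ_flow.
- exact: flow_deriv.
Qed.

(** On orbit directions [V t] acts through [Ad], and it commutes with [j]; differentiate. *)
Lemma isotropy_rep_orbit xi eta :
  isotropy_rep AM act expG m sigma (inf xi + j m (inf eta)) =
  - inf (Z xi) - j m (inf (Z eta)).
Proof.
have lin := inf_act_linear hE hg mM lie_G exp_expG smooth_act m.
have hinf x : hdiff (fun t : R^o => inf (U t x)) 0 (fun v => inf (v *: - Z x)).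
  apply: (hdiff_comp (@flow_hdiff x) (g := fun x => inf x) (dg := fun x => inf x)).
  apply: hdiff_linear; first exact: lin.
  exact: (inf_act_continuous hE hg mM lie_G exp_expG smooth_act).
have h := hdiffD (hinf xi) (j_hdiff (hinf eta)).
have e : (fun t : R^o => V t (inf xi + j m (inf eta))) =
    (fun t : R^o => inf (U t xi) + j m (inf (U t eta))).
  apply: funext => t; rewrite (linearDf _ _ (tflow_linear t)).
  by rewrite tflow_j !tflow_inf.
rewrite /isotropy_rep /ddt0 e (hdiff_dderive (1 : R^o) hE h) !scale1r.
by rewrite !(linearNf _ lin) (linearNf _ j_linear).
Qed.

(** The two [|Z xi|^2] cancel, and so do the mixed terms [2 <Z xi, L eta>], because [L] and [Z]
    commute. *)
Lemma hessian_value xi eta :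
  let X := inf xi + j m (inf eta) in
  kappa (TJ X) (TJ X) + wm X (isotropy_rep AM act expG m sigma X) =
  kappa (L eta) (L eta) - kappa (Z eta) (Z eta).
Proof.
move=> X; rewrite /X isotropy_rep_orbit (linearDf _ _ TJ_linear).
rewrite -[TJ (inf xi)]/(Z xi) -[TJ (j m (inf eta))]/(L eta).
have k1 : kappa (Z xi + L eta) (Z xi + L eta) = kappa (Z xi) (Z xi) +
    2 * kappa (Z xi) (L eta) + kappa (L eta) (L eta).
  rewrite kappaDl !kappaDr (kappaC (L eta) (Z xi)); lra.
have w1 a b c d : wm (a + j m b) (- c - j m d) =
    - wm a c - wm a (j m d) + wm b (j m c) - wm b d.
  by rewrite wDl !wDr !wNr wjj wjC; lra.
have q x : wm (inf x) (inf (Z x)) = kappa (Z x) (Z x).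
  by apply: oppr_inj; rewrite -[LHS](opZE (Z x) x); exact: opZ_skew.
have p x y : wm (inf x) (j m (inf (Z y))) = - kappa (L (Z y)) x.
  by have := opLE (Z y) x; lra.
have r1 := opL_sym (Z xi) eta.
have r2 : kappa (L (Z eta)) xi = - kappa (Z xi) (L eta).
  by rewrite (opLZ_commute eta) (opZ_skew (L eta) xi) (kappaC (L eta) (Z xi)).
have alg (T W z y l c d e w1' w2' w3' w4' : R) : T = z + 2 * c + l ->
    W = - w1' - w2' + w3' - w4' -> w1' = z -> w2' = - d -> w3' = - e -> w4' = y ->
    e = c -> d = - c -> T + W = l - y by lra.
exact: (alg _ _ _ _ _ _ _ _ _ _ _ _ k1 (w1 _ _ _ _) (q xi) (p xi eta) (p eta xi)
  (q eta) r1 r2).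
Qed.

End Symmetry.

(** * The second derivative along a curve *)

Section HessianAlongCurve.
Context {R : realType} {E g : tvsType R} {M : topologicalType} {G : topoGroupType}.
Variables (AM : atlas E M) (AG : atlas g G) (act : G -> M -> M) (expG : g -> G).
Hypotheses (hE : hausdorff_space E) (hg : hausdorff_space g).
Hypotheses (mM : manifold AM) (lie_G : lie_group AG).
Hypothesis exp_expG : exponential_map AG expG.
Hypothesis smooth_act : smooth_action AM AG act.
Variables (w : M -> E -> E -> R) (kappa : g -> g -> R) (J : M -> g).
Hypothesis symplectic_w : symplectic_form AM w.
Hypothesis pairing_kappa : pairing kappa.
Hypothesis momentum_J : momentum_map AM act expG w kappa J.
Variables (m : M) (c : R -> M).
Hypothesis fixed : inf_act AM act expG (J m) m = 0.
Hypotheses (smooth_c : smooth_curve AM c) (c0 : c 0 = m).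

Local Notation x0 := (cmap AM m m).
Local Notation sigma := (J m).
Local Notation TJ := (tmap AM (tvs_atlas g) J m).
Local Notation X := (velocity AM m c).
Local Notation Jm := (J \o cinv AM m).

Lemma derive1_dquot (F : R -> R^o) t l :
  dquot (F : R^o -> R^o) t 1 h @[h --> (0 : R)^'] --> (l : R^o) -> derive1 F t = l.
Proof.
move=> Fl; rewrite /derive1; apply: cvg_lim; first exact: norm_hausdorff.
have -> : (fun h : R => h^-1 *: (F (h + t) - F t)) = dquot (F : R^o -> R^o) t (1 : R^o).
  by apply: funext => h; rewrite /dquot [t + _]addrC /GRing.scale /= mulr1.
exact: Fl.
Qed.

(** The momentum identity at nearby points, moved to the fixed chart at [m], where it can be
    followed along a curve. *)
Lemma momentum_field_in_chart x u : cimg AM m x ->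
  kappa (dderive Jm x u) sigma =
  - form_in_chart AM w m x (field_in_chart AM AG act m sigma x) u.
Proof.
move=> mx; set n := cinv AM m x.
have Dn : dom AM m n by exact: dom_cinv.
have ex : cmap AM m n = x by exact: cinvK.
have [hT lT cT] := transition_hdiff mM hE Dn (dom_center mM n).
rewrite ex in hT lT cT.
set T := cmap AM n \o cinv AM m in hT lT cT.
have dJn := momentum_diff hg mM momentum_J n.
have eT : T x = cmap AM n n by rewrite /T /=.
have -> : dderive Jm x u = tmap AM (tvs_atlas g) J n (of_chart AM m x u).
  have [hJn _ _] := dJn; rewrite -eT in hJn.
  have := hdiff_comp hT hJn; rewrite eT => h.
  apply: (hdiff_dderive (df := dderive (J \o cinv AM n) (cmap AM n n) \o dderive T x)) => //.
  apply: hdiff_near h; have nD : nbhs n (dom AM n).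
    by apply: open_nbhs_nbhs; split; [exact: dom_open|exact: dom_center].
  have := near_cinv mM mx nD; apply: filterS => y [_ Dy].
  by rewrite /= /T /= cmapK.
rewrite (momentumE momentum_J n sigma) /form_in_chart -/n.
by rewrite /n (field_in_chartE hE hg mM lie_G exp_expG smooth_act sigma mx).
Qed.

(** The first derivative at [h], divided by [h], is twice [kappa (gam' h, (gam h - sigma) / h) - w
    (S (x h) / h, x' h)]. As [S x0 = 0], both inner quotients tend to first derivatives, and the
    acceleration of the curve does not appear. *)
Lemma hessian_along_curve : derive1n 2 (norm_sq kappa J \o c) 0 =
  2 * (kappa (TJ X) (TJ X) + w m X (isotropy_rep AM act expG m sigma X)).
Proof.
have [V [oV V0] [sx cD]] := smooth_curve_chart mM smooth_c; rewrite c0 in sx cD.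
pose x : R^o -> E := cmap AM m \o c.
have hR : hausdorff_space (R^o : tvsType R) by exact: (@norm_hausdorff R R^o).
have dx t : V t -> diff_at x t by exact: (diff_at_smooth hE oV sx).
have xm t : V t -> cimg AM m (x t) by move=> /cD Dt; exists (c t).
have sJ : smooth_on (cimg AM m) Jm by exact: (momentum_chart_smooth momentum_J).
have dJ y : cimg AM m y -> diff_at Jm y.
  exact: (diff_at_smooth hg (cimg_open mM m) sJ).
pose gam : R^o -> g := J \o c.
pose x' (t : R) : E := dderive x t (1 : R^o).
pose gam' (t : R) : g := dderive Jm (x t) (x' t).
have nearV t : V t -> \forall s \near (t : R^o), V s.
  by move=> Vt; apply: open_nbhs_nbhs.
have hgam t : V t -> hdiff gam t (fun v => dderive Jm (x t) (dderive x t v)).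
  move=> Vt; have [hx _ _] := dx t Vt; have [hJ _ _] := dJ _ (xm t Vt).
  apply: hdiff_near (hdiff_comp hx hJ); have := nearV t Vt; apply: filterS => s Vs.
  by rewrite /= /gam /x /= (cmapK mM)//; exact: cD.
have F1 t : V t -> derive1 (norm_sq kappa J \o c) t = 2 * kappa (gam' t) (gam t).
  move=> Vt; apply: derive1_dquot.
  have := hdiff_line (v := (1 : R^o)) (kappa_hdiff pairing_kappa (hgam t Vt) (hgam t Vt)).
  rewrite -/(x' t) -/(gam' t) (kappaC pairing_kappa (gam t)).
  have -> : 2 * kappa (gam' t) (gam t) = kappa (gam' t) (gam t) + kappa (gam' t) (gam t) by lra.
  by [].
have ex0 : x 0 = x0 by rewrite /x /= c0.
have x'0 : x' 0 = X by [].
have gam'0 : gam' 0 = TJ X by rewrite /gam' ex0 x'0.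
have gam0 : gam 0 = sigma by rewrite /gam /= c0.
pose S := field_in_chart AM AG act m sigma.
have S0 : S x0 = 0.
  have := field_in_chartE hE hg mM lie_G exp_expG smooth_act sigma (cimg_center mM m).
  rewrite (cmapK mM) ?fixed; last exact: dom_center.
  by rewrite of_chart_center.
have V0' : \forall h \near (0 : R)^', V h.
  by apply: (@nbhs_dnbhs R 0); exact: (nearV 0 V0).
have key h : V h -> kappa (gam' h) sigma = - form_in_chart AM w m (x h) (S (x h)) (x' h).
  by move=> Vh; apply: momentum_field_in_chart; exact: xm.
have form_center u v : form_in_chart AM w m x0 u v = w m u v.
  rewrite /form_in_chart (cmapK mM); last exact: dom_center.
  by rewrite !of_chart_center.
have form_scale y k u v : cimg AM m y ->
    form_in_chart AM w m y (k *: u) v = k * form_in_chart AM w m y u v.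
  move=> my; rewrite /form_in_chart.
  have [_ lT _] := transition_hdiff mM hE (dom_cinv mM my) (dom_center mM (cinv AM m y)).
  rewrite (cinvK mM my) in lT.
  by rewrite {1}/of_chart (linearZf _ _ lT); exact: (wZl symplectic_w).
have k0 : kappa (gam' 0) sigma = 0.
  by rewrite (key 0 V0) ex0 S0 form_center (w0l symplectic_w) oppr0.
have limx : x h @[h --> (0 : R)^'] --> x0.
  have [hx _ _] := dx 0 V0; have := curve_continuous hx; rewrite ex0 => h.
  by apply: cvg_trans h; apply: cvg_app; exact: (@nbhs_dnbhs R 0).
have limx' : x' h @[h --> (0 : R)^'] --> X.
  have hD : (fun p : R^o * R^o => dderive x p.1 p.2) @ (0 : R^o, 1 : R^o) --> x' 0.
    exact: (C1_dderive_continuous oV (sx 1%N) V0).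
  rewrite x'0 in hD.
  apply: (@cvg_comp _ _ _ (fun h : R => (h : R^o, 1 : R^o)) _ _ (nbhs (0 : R^o, 1 : R^o)) _ _ hD).
  apply: (@cvg_pair _ _ _ _ (nbhs (0 : R^o)) (nbhs (1 : R^o))); last exact: cvg_cst.
  exact: (@nbhs_dnbhs R 0).
have limgam' : gam' h @[h --> (0 : R)^'] --> TJ X.
  have hD : (fun p : E * E => dderive Jm p.1 p.2) @ (x0, X) --> dderive Jm x0 X.
    exact: (C1_dderive_continuous (cimg_open mM m) (sJ 1%N) (cimg_center mM m)).
  apply: (@cvg_comp _ _ _ (fun h : R => (x h, x' h)) _ _ (nbhs (x0, X)) _ _ hD).
  exact: (@cvg_pair _ _ _ _ (nbhs x0) (nbhs X)).
have limgam : dquot gam 0 (1 : R^o) h @[h --> (0 : R)^'] --> TJ X.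
  by have := hdiff_line (v := (1 : R^o)) (hgam 0 V0); rewrite -/(x' 0) -/(gam' 0) gam'0.
have limk : (kappa (gam' h) (dquot gam 0 (1 : R^o) h) : R^o) @[h --> (0 : R)^'] -->
    (kappa (TJ X) (TJ X) : R^o).
  case: (pairing_kappa) => _ ck _ _ _.
  apply: (@cvg_comp _ _ _ (fun h : R => (gam' h, dquot gam 0 (1 : R^o) h)) _ _
    (nbhs (TJ X, TJ X)) _ _ (ck (TJ X, TJ X))).
  exact: (@cvg_pair _ _ _ _ (nbhs (TJ X)) (nbhs (TJ X))).
have limS : dquot (S \o x) 0 (1 : R^o) h @[h --> (0 : R)^'] -->
    isotropy_rep AM act expG m sigma X.
  have hS := field_in_chart_hdiff hE hg mM lie_G exp_expG smooth_act fixed.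
  rewrite -ex0 in hS; have [hx _ _] := dx 0 V0.
  exact: (hdiff_line (v := (1 : R^o)) (hdiff_comp hx hS)).
have limw : (form_in_chart AM w m (x h) (dquot (S \o x) 0 (1 : R^o) h) (x' h))
    @[h --> (0 : R)^'] --> (w m (isotropy_rep AM act expG m sigma X) X : R^o).
  case: symplectic_w => _ /(_ m 0%N)[cw _] _ _.
  have oVT : open (cimg AM m `*` [set: (E * E)%type]).
    by apply: open_setXT; exact: cimg_open.
  set tX := isotropy_rep _ _ _ _ _ _.
  have hw := within_open_cvg (x := (x0, (tX, X))) oVT cw (conj (cimg_center mM m) I).
  rewrite -form_center.
  apply: (@cvg_comp _ _ _ (fun h : R => (x h, (dquot (S \o x) 0 (1 : R^o) h, x' h)))
    (fun z : E * (E * E) => form_in_chart AM w m z.1 z.2.1 z.2.2 : R^o) _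
    (nbhs (x0, (tX, X))) _ _ hw).
  apply: (@cvg_pair _ _ _ _ (nbhs x0) (nbhs (tX, X))) => //.
  exact: (@cvg_pair _ _ _ _ (nbhs tX) (nbhs X)).
have -> : 2 * (kappa (TJ X) (TJ X) + w m X (isotropy_rep AM act expG m sigma X)) =
    2 *: ((kappa (TJ X) (TJ X) : R^o) - w m (isotropy_rep AM act expG m sigma X) X).
  by rewrite (wN symplectic_w m X) /GRing.scale.
rewrite /derive1n /=; apply: derive1_dquot.
have : (fun h : R => 2 *: ((kappa (gam' h) (dquot gam 0 (1 : R^o) h) : R^o) -
    form_in_chart AM w m (x h) (dquot (S \o x) 0 (1 : R^o) h) (x' h))) @ (0 : R)^' -->
    2 *: ((kappa (TJ X) (TJ X) : R^o) - w m (isotropy_rep AM act expG m sigma X) X).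
  by apply: tvs_cvgZ; [exact: cvg_cst|exact: tvs_cvgB].
apply: cvg_trans; apply: near_eq_cvg.
have := V0'; apply: filterS => h Vh.
rewrite /dquot /= add0r [h *: 1]mulr1 (F1 h Vh) (F1 0 V0) gam0 k0 mulr0 subr0.
rewrite -/(gam h) ex0 S0 subr0 (form_scale _ _ _ _ (xm h Vh)).
rewrite (kappaZr pairing_kappa) (kappaDr pairing_kappa) (kappaNr pairing_kappa).
rewrite (key h Vh) /GRing.scale /=.
lra.
Qed.

End HessianAlongCurve.

Theorem theorem4p13
  (R : realType)
  (E : tvsType R) (frechet_E : frechet_space E)
  (M : topologicalType) (AM : atlas E M) (manifold_M : manifold AM)
  (connected_M : connected [set: M])
  (w : M -> E -> E -> R) (symplectic_w : symplectic_form AM w)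
  (g : tvsType R) (frechet_g : frechet_space g)
  (G : topoGroupType) (AG : atlas g G) (lie_G : lie_group AG)
  (expG : g -> G) (exp_expG : exponential_map AG expG)
  (act : G -> M -> M) (smooth_act : smooth_action AM AG act)
  (symplectic_act : preserves_form AM act w)
  (kappa : g -> g -> R) (pairing_kappa : pairing kappa)
  (adjoints : ad_adjoints_exist AG kappa)
  (J : M -> g) (momentum_J : momentum_map AM act expG w kappa J)
  (equivariant_J : ad_equivariant AM AG act expG J)
  (j : M -> E -> E) (complex_j : almost_complex AM j)
  (compatible_j : compatible w j)
  (m : M) (critical_m : critical_point AM (norm_sq kappa J) m)
  (invariant_j : invariant_at AM act expG j m)
  (* the assumptions (1)-(4) made in infinite dimensions *)
  (infinite_dim : ~ (finite_dimensional E /\ finite_dimensional g) ->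
    [/\ smooth (tvs_atlas g) AG expG,
        lie_subgroup AG (stabilizer act m),
        exists Jhat : E -> g,
          isotropy_momentum_map AM act expG w kappa m Jhat &
        exists (H : completeNormedModType R[i]) (dot : {dot H for Num.conj})
            (iota : (g * g)%type -> H),
          [/\ hilbert_completion kappa dot iota,
              essentially_self_adjoint dot iota (opC AM act expG 1 j J m) &
              essentially_self_adjoint dot iota (opC AM act expG (-1) j J m)]]) :
  hessian_psd_on AM (norm_sq kappa J) m (complex_orbit_space AM act expG j m).
Proof.
have hE : hausdorff_space E by case: frechet_E.
have hg : hausdorff_space g by case: frechet_g.
have fixed : inf_act AM act expG (J m) m = 0.
  exact: (critical_fixed hg manifold_M symplectic_w pairing_kappa momentum_J).
move=> X [xi [eta eX]] c smooth_c c0 vX.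
rewrite (hessian_along_curve hE hg manifold_M lie_G exp_expG smooth_act symplectic_w
  pairing_kappa momentum_J fixed smooth_c c0) vX eX.
rewrite (hessian_value hE hg manifold_M lie_G exp_expG smooth_act symplectic_w
  symplectic_act pairing_kappa momentum_J equivariant_J complex_j compatible_j
  fixed invariant_j xi eta).
apply: mulr_ge0 => //; rewrite subr_ge0.
apply: (norm_opZ_le_opL hE hg manifold_M lie_G exp_expG smooth_act symplectic_w
  symplectic_act pairing_kappa momentum_J equivariant_J complex_j compatible_j
  fixed invariant_j).
(* In finite dimension linear algebra provides the resolvent; otherwise assumption (4) provides the
   completion. *)
have [[_ fd_g]|/infinite_dim[_ _ _]] := pselect (finite_dimensional E /\ finite_dimensional g).
  by left.
by right.
Qed.
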